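(* Consider the controlled system $x_{n+1}=f(x_n,w_n)+Bu_n$, $n\ge 0$, controlled over a (possibly non-memoryless) channel with finite input alphabet $\mathcal{M}$ and finite output alphabet $\mathcal{M}'$. Suppose that $f(\cdot,w):\mathbb{R}^N\to\mathbb{R}^N$ is invertible for every realization $w$, and that $x_0$ has finite differential entropy. If there is an admissible coding and control policy with $\limsup_{t\to\infty}h(x_t)/t\le 0$, then under this policy $$\limsup_{T\to\infty}\frac1T I(q_{[0,T-1]}\to q'_{[0,T-1]})\ \ge\ \limsup_{T\to\infty}\frac1T\sum_{t=0}^{T-1}\int\pi_t(dx)\Big(\int\nu(dw)\,\log_2(|J(f(x,w))|)\Big),$$ where $\pi_t(A)=P(x_t\in A)$ for Borel $A$.
   Context: System: $x_n\in\mathbb{R}^N$ is the state, $u_n\in\mathbb{R}^s$ the control, $B$ a real $N\times s$ matrix, and $\{w_n\}$ an i.i.d. sequence of $\mathbb{R}^N$-valued noise variables with law $\nu$, independent of $x_0$. $f$ is Borel measurable and continuously differentiable in the state variable. With $f_w(x)=f(x,w)$, $J(f(x,w))$ denotes the Jacobian matrix of $f_w$ at $x$ and $|J(\cdot)|$ the absolute value of its determinant. All random variables live on a common probability space. Admissible (causal) policies: the channel input at time $t$ is $q_t=\gamma^e_t(x_{[0,t]},q'_{[0,t-1]})\in\mathcal{M}$ and the control is $u_t=\gamma_t(q'_{[0,t]})$, for (measurable) functions $\gamma^e_t,\gamma_t$, where $q'_t\in\mathcal{M}'$ is the channel output and $y_{[0,t]}=\{y_s,0\le s\le t\}$. The channel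 generates $q'_t$ from $q_t$ and the past according to a conditional probability $P(q'_t\mid q_t,q_{[0,t-1]},q'_{[0,t-1]})$ on $\mathcal{M}'$, in the sense that for all $t\ge 0$, almost surely, $P(q'_t\in A\mid q_t,q_{[0,t-1]},q'_{[0,t-1]},x_0,w_s,s\ge 0)=P(q'_t\in A\mid q_t,q_{[0,t-1]},q'_{[0,t-1]})$ for all $A\subset\mathcal{M}'$. Directed information: $I(q_{[0,T-1]}\to q'_{[0,T-1]})=\sum_{t=1}^{T-1} I(q_{[0,t]};q'_t\mid q'_{[0,t-1]})+I(q_0;q'_0)$. $h(x)=-\int p(x)\log_2 p(x)\,dx$ is the differential entropy of a random vector with density $p$. *)

(* Defs.v *)
From HB Require Import structures.
From mathcomp Require Import all_boot all_order all_algebra.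
From mathcomp Require Import all_classical all_reals all_analysis.

Set Implicit Arguments.
Unset Strict Implicit.
Unset Printing Implicit Defensive.

Import Order.TTheory GRing.Theory Num.Theory.
Import numFieldNormedType.Exports.

Local Open Scope classical_set_scope.
Local Open Scope ring_scope.

Definition borel_mx_display : measure_display. Proof. by constructor. Qed.

Section borel_matrix.
Variables (R : realType) (m n : nat).

Definition borel_mx : set (set 'M[R]_(m, n)) := <<s open >>.

Let borel_mx0 : borel_mx set0.
Proof. exact: sigma_algebra0. Qed.

Let borel_mxC A : borel_mx A -> borel_mx (~` A).
Proof. exact: sigma_algebraC. Qed.

Let borel_mx_bigcup (F : (set 'M[R]_(m, n))^nat) :
  (forall i, borel_mx (F i)) -> borel_mx (\bigcup_i F i).
Proof. exact: sigma_algebra_bigcup. Qed.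

HB.instance Definition _ := @isMeasurable.Build
  borel_mx_display 'M[R]_(m, n)
  borel_mx borel_mx0 borel_mxC borel_mx_bigcup.

Lemma open_measurable_mx (A : set 'M[R]_(m, n)) : open A -> measurable A.
Proof. exact: sub_gen_smallest. Qed.

End borel_matrix.

Section borel_matrix_theory.
Variable R : realType.

Lemma measurable_coord m n (i : 'I_m) (j : 'I_n) :
  measurable_fun setT (fun M : 'M[R]_(m, n) => M i j : R).
Proof.
apply: (measurability _ (measurable_realfun.RGenOpens.measurableE R)) => //.
move=> _ [_ [a [b ->] <-]]; rewrite setTI; apply: open_measurable_mx.
apply: open_comp; last exact: interval_open.
by move=> x _; exact: coord_continuous.
Qed.

(* Balls with rational centre and radius form a countable base. *)
Lemma open_bigcup_mx_ball m n (A : set 'M[R]_(m, n)) : open A ->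
  exists F : ('M[R]_(m, n) * R)^nat,
    A = \bigcup_(k in [set k | 0 < (F k).2 /\ ball (F k).1 (F k).2 `<=` A])
          ball (F k).1 (F k).2.
Proof.
move=> oA.
pose F k : 'M[R]_(m, n) * R :=
  if @unpickle ('M[rat]_(m, n) * rat)%type k is Some (c, r)
  then (map_mx ratr c, ratr r) else (0, 0).
exists F; apply/seteqP; split; last by move=> x [k [_ /[apply]]].
move=> x Ax.
have [e /= e0 xeA] : exists2 e, 0 < e & ball x e `<=` A.
  by move: oA; rewrite openE => /(_ _ Ax) /= /nbhs_ballP.
have [r rP] : exists r : rat, ratr r \in `]0, (e / 2)[%R.
  have /rat_in_itvoo[r rP] : 0 < e / 2 by rewrite divr_gt0.
  by exists r.
move: rP; rewrite in_itv /= => /andP[r0 re].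
have cP : forall i j, exists c : rat, `|x i j - ratr c| < ratr r.
  move=> i j.
  have /rat_in_itvoo[c] : x i j - ratr r < x i j + ratr r.
    by rewrite ltrD2l gtrN.
  rewrite in_itv /= => /andP[c1 c2]; exists c.
  by rewrite distrC ltr_distl c1.
pose c : 'M[rat]_(m, n) := \matrix_(i, j) projT1 (cid (cP i j)).
have cE i j : `|x i j - ratr (c i j)| < ratr r.
  by rewrite mxE; exact: (projT2 (cid (cP i j))).
have xc : ball (map_mx ratr c : 'M[R]_(m, n)) (ratr r) x.
  split=> // i j; rewrite mxE /ball /= distrC; exact: cE.
have Fk : F (pickle ((c, r) : 'M[rat]_(m, n) * rat)%type) =
    (map_mx ratr c, ratr r) by rewrite /F pickleK.
exists (pickle ((c, r) : 'M[rat]_(m, n) * rat)%type); rewrite /= Fk //=; split=> // y cy.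
apply: xeA; have : ball x (ratr r + ratr r) y.
  exact: ball_triangle (ball_sym xc) cy.
by apply: le_ball; rewrite (splitr e) lerD// ltW.
Qed.

Lemma measurable_fun_mx_ball d (T : measurableType d) m n
    (f : T -> 'M[R]_(m, n)) :
  (forall x (e : R), 0 < e -> measurable (f @^-1` ball x e)) ->
  measurable_fun setT f.
Proof.
move=> fm; apply: (@measurability _ _ _ _ _ _ (@open 'M[R]_(m, n))) => //.
move=> _ [A oA <-]; rewrite setTI.
have [F ->] := open_bigcup_mx_ball oA.
rewrite preimage_bigcup bigcup_mkcond; apply: bigcupT_measurable => k.
by case: ifPn => [/[!inE] -[F0 _]|_//]; exact: fm.
Qed.

End borel_matrix_theory.

(* Lebesgue measure on R^n, built by R^(n+1) = R * R^n. *)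
Section lebesgue_rV.
Variable R : realType.

Definition consrV n (p : measurableTypeR R * 'rV[R]_n) : 'rV[R]_n.+1 :=
  row_mx (p.1 : R)%:M p.2.

Lemma consrVl n p i j : @consrV n p i (@lshift 1 n j) = p.1.
Proof.
by apply: etrans (row_mxEl (p.1%:M) p.2 i j) _; rewrite ord1 (ord1 j) mxE.
Qed.

Lemma consrVr n p i j : @consrV n p i (@rshift 1 n j) = p.2 i j.
Proof. exact: row_mxEr. Qed.

Lemma preimage_consrV_ball n (x : 'rV[R]_n.+1) (e : R) : 0 < e ->
  @consrV n @^-1` ball x e =
  ball ((lsubmx (x : 'rV_(1 + n))) 0 0) e `*` ball (rsubmx (x : 'rV_(1 + n))) e.
Proof.
move=> e0; apply/seteqP; split => [[a v]|[a v]] /=.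
  move=> [_ xav]; split => /=.
    by have := xav 0 (@lshift 1 n 0); rewrite consrVl mxE.
  by split=> // i j; have := xav i (@rshift 1 n j); rewrite consrVr mxE.
move=> [/= xa [_ xv]]; split=> // i j.
case: (split_ordP (j : 'I_(1 + n))) => k ->.
  by rewrite consrVl (ord1 i) (ord1 k); rewrite mxE in xa.
by rewrite consrVr; have := xv i k; rewrite mxE.
Qed.

Lemma measurable_consrV n : measurable_fun setT (@consrV n).
Proof.
apply: measurable_fun_mx_ball => x e e0; rewrite preimage_consrV_ball//.
apply: measurableX; first exact: measurable_realfun.measurable_ball.
by apply: open_measurable_mx; exact: ball_open.
Qed.

HB.instance Definition _ n :=
  @isMeasurableFun.Build _ _ _ _ (@consrV n) (@measurable_consrV n).

Section lebesgue_rV_step.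
Variables (n : nat) (mu : {sigma_finite_measure set 'rV[R]_n -> \bar R}).

Definition lebesgue_rV_step : set 'rV[R]_n.+1 -> \bar R :=
  pushforward (@lebesgue_measure R \x mu)%E (@consrV n).

Let lebesgue_rV_step0 : lebesgue_rV_step set0 = 0%E.
Proof. exact: measure0. Qed.

Let lebesgue_rV_step_ge0 A : (0 <= lebesgue_rV_step A)%E.
Proof. exact: measure_ge0. Qed.

Let lebesgue_rV_step_sigma_additive : semi_sigma_additive lebesgue_rV_step.
Proof. exact: measure_semi_sigma_additive. Qed.

HB.instance Definition _ := isMeasure.Build _ _ _ lebesgue_rV_step
  lebesgue_rV_step0 lebesgue_rV_step_ge0 lebesgue_rV_step_sigma_additive.

Let lebesgue_rV_step_sigma_finite : sigma_finite setT lebesgue_rV_step.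
Proof.
have [F UF Fmu] := sigma_finiteT mu.
have [G UG Gl] := sigma_finiteT (@lebesgue_measure R).
pose hd (v : 'rV[R]_n.+1) : measurableTypeR R := v 0 (@lshift 1 n 0).
pose tl (v : 'rV[R]_n.+1) : 'rV[R]_n := \row_j v 0 (@rshift 1 n j).
have mhd : measurable_fun setT hd by exact: measurable_coord.
have mtl : measurable_fun setT tl.
  apply: measurable_fun_mx_ball => x e e0.
  rewrite (_ : _ @^-1` _ = \bigcap_(j in [set: 'I_n])
      (fun v : 'rV[R]_n.+1 => v 0 (@rshift 1 n j)) @^-1` ball (x 0 j) e).
    apply: fin_bigcap_measurable => [|j _]; first exact: finite_finset.
    rewrite -[X in measurable X]setTI; apply: measurable_coord => //.
    exact: measurable_realfun.measurable_ball.
  apply/seteqP; split => [v [_ xv] j _|v xv]; first by have := xv 0 j; rewrite mxE.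
  by split=> // i j; rewrite (ord1 i) mxE; exact: xv.
pose H k := if unpickle k is Some (i, j)
  then hd @^-1` G i `&` tl @^-1` F j else set0.
have mH i j : measurable (hd @^-1` G i `&` tl @^-1` F j).
  by apply: measurableI; rewrite -[X in measurable X]setTI;
    [apply: mhd => //; exact: (Gl i).1|apply: mtl => //; exact: (Fmu j).1].
exists H.
  apply/seteqP; split=> // v _.
  have [i _ Gi] : (\bigcup_i G i) (hd v) by rewrite -UG.
  have [j _ Fj] : (\bigcup_i F i) (tl v) by rewrite -UF.
  by exists (pickle (i, j)) => //; rewrite /H pickleK.
move=> k; rewrite /H; case: unpickle => [[i j]|]; last first.
  by split; [exact: measurable0|rewrite measure0].
split; first exact: mH.
have [mG Goo] := Gl i; have [mF Foo] := Fmu j.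
rewrite [ltLHS](_ : _ = (@lebesgue_measure R \x mu)%E (G i `*` F j)).
  rewrite product_measure1E//; apply: lte_mul_pinfty => //.
  by rewrite ge0_fin_numE.
congr (product_measure1 _ _ _).
apply/seteqP; split => -[a v]; rewrite /= /hd consrVl /=.
  move=> [Ga tF]; split => //; suff <- : tl (consrV (a, v)) = v by [].
  by apply/rowP => i'; rewrite mxE consrVr.
move=> [Ga tF]; split => //; suff -> : tl (consrV (a, v)) = v by [].
by apply/rowP => i'; rewrite mxE consrVr.
Qed.

HB.instance Definition _ := @Measure_isSigmaFinite.Build _ _ _
  lebesgue_rV_step lebesgue_rV_step_sigma_finite.

End lebesgue_rV_step.

Fixpoint lebesgue_rV n : {sigma_finite_measure set 'rV[R]_n -> \bar R} :=
  if n is n'.+1 then lebesgue_rV_step (lebesgue_rV n') else \d_(0 : 'rV[R]_0).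

End lebesgue_rV.

Section logarithms.
Variable R : realType.

(* [ln 0 = 0], so [0 * log2 0 = 0]. *)
Definition log2 (r : R) : R := ln r / ln 2.

(* [lne 0 = -oo], so [log2e 0 = -oo]. *)
Definition log2e (r : \bar R) : \bar R := (lne r * (ln 2)^-1%:E)%E.

End logarithms.

Definition history (Omega T : Type) (X : nat -> Omega -> T) (t : nat)
  (omega : Omega) : t.-tuple T := [tuple X i omega | i < t].

Section differential_entropy.
Context d (Omega : measurableType d) (R : realType) (N : nat).
Variables (P : probability Omega R) (X : {RV P >-> 'rV[R]_N}).

Definition is_density (p : 'rV[R]_N -> R) : Prop :=
  [/\ measurable_fun setT p, forall x, 0 <= p x &
    forall A, measurable A ->
      distribution P X A = (\int[lebesgue_rV R N]_(x in A) (p x)%:E)%E].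

Definition density_entropy (p : 'rV[R]_N -> R) : \bar R :=
  (- \int[lebesgue_rV R N]_x (p x * log2 (p x))%:E)%E.

(* Two densities of [X] agree almost everywhere, so the choice of [p] is
   irrelevant. By convention the entropy of a random vector whose law is not
   absolutely continuous is [-oo]; it is [+oo] when the positive and the
   negative part of the integral both diverge, since [+oo - +oo = -oo]. In
   particular a random vector of finite entropy has a density. *)
Definition diff_entropy : \bar R :=
  if pselect (exists p, is_density p) is left ex
  then density_entropy (projT1 (cid ex)) else -oo%E.

End differential_entropy.

Section mutual_information.
Context d (Omega : measurableType d) (R : realType).
Variable P : probability Omega R.

Definition pmf (A : finType) (X : Omega -> A) (a : A) : R :=
  fine (P (X @^-1` [set a])).

Definition mutual_info (A B : finType) (X : Omega -> A) (Y : Omega -> B) : R :=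
  \sum_(a : A) \sum_(b : B)
    pmf (fun o => (X o, Y o)) (a, b) *
    log2 (pmf (fun o => (X o, Y o)) (a, b) / (pmf X a * pmf Y b)).

Definition cond_mutual_info (A B C : finType)
    (X : Omega -> A) (Y : Omega -> B) (Z : Omega -> C) : R :=
  \sum_(a : A) \sum_(b : B) \sum_(c : C)
    pmf (fun o => (X o, Y o, Z o)) (a, b, c) *
    log2 (pmf (fun o => (X o, Y o, Z o)) (a, b, c) * pmf Z c /
          (pmf (fun o => (X o, Z o)) (a, c) *
           pmf (fun o => (Y o, Z o)) (b, c))).

Definition directed_info (M M' : finType)
    (q : nat -> Omega -> M) (q' : nat -> Omega -> M') (T : nat) : R :=
  \sum_(1 <= t < T)
    cond_mutual_info (history q t.+1) (q' t) (history q' t) +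
  mutual_info (q 0%N) (q' 0%N).

End mutual_information.

Section control_over_channel.
Context d (Omega : measurableType d) (R : realType) (P : probability Omega R).
Variables (N s : nat) (M M' : finType).

Definition C1_in_state (f : 'rV[R]_N -> 'rV[R]_N -> 'rV[R]_N) : Prop :=
  forall w, (forall x, differentiable (f ^~ w) x) /\
    continuous (fun x => 'J (f ^~ w) x).

(* Mutual independence of [x0], [w 0], [w 1], ...: taking [B i = setT] for the
   omitted indices gives the product rule for all finite subfamilies. *)
Definition iid_noise (x0 : {RV P >-> 'rV[R]_N}) (w : nat -> {RV P >-> 'rV[R]_N})
    (nu : probability 'rV[R]_N R) : Prop :=
  (forall n A, measurable A -> distribution P (w n) A = nu A) /\
  forall n (A : set 'rV[R]_N) (B : nat -> set 'rV[R]_N),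
    measurable A -> (forall i, measurable (B i)) ->
    (P (x0 @^-1` A `&` \bigcap_(i < n) w i @^-1` B i) =
     P (x0 @^-1` A) * \prod_(i < n) P (w i @^-1` B i))%E.

(* [phi] is a version of [P(E | G)], for a sub-sigma-algebra [G]. *)
Definition is_cond_prob (G : set (set Omega)) (E : set Omega)
    (phi : Omega -> R) : Prop :=
  [/\ P.-integrable setT (EFin \o phi),
    forall B : set R, measurable B -> G (phi @^-1` B) &
    forall A, G A -> (\int[P]_(omega in A) (phi omega)%:E)%E = P (A `&` E)].

(* [chan_prob K t a b c] is P(q'_t = c | q_[0,t] = a, q'_[0,t-1] = b). *)
Record channel := Channel {
  chan_prob : forall t : nat, t.+1.-tuple M -> t.-tuple M' -> M' -> R ;
  chan_prob_ge0 : forall t a b c, 0 <= @chan_prob t a b c ;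
  chan_prob_sum1 : forall t a b, \sum_(c : M') @chan_prob t a b c = 1 }.

(* The controller acts on a finite set, hence needs no measurability. *)
Record policy := Policy {
  encoder : forall t : nat, t.+1.-tuple 'rV[R]_N -> t.-tuple M' -> M ;
  measurable_encoder : forall t b m,
    measurable [set a : t.+1.-tuple 'rV[R]_N | @encoder t a b = m] ;
  controller : forall t : nat, t.+1.-tuple M' -> 'rV[R]_s }.

(* The sigma-algebra generated by q_[0,t], q'_[0,t-1], x_0 and all the w_i. *)
Definition channel_sigma (x0 : {RV P >-> 'rV[R]_N})
    (w : nat -> {RV P >-> 'rV[R]_N}) (q : nat -> Omega -> M)
    (q' : nat -> Omega -> M') (t : nat) : set (set Omega) :=
  <<s [set E |
    [\/ exists A : set (t.+1.-tuple M), E = history q t.+1 @^-1` A,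
        exists A : set (t.-tuple M'), E = history q' t @^-1` A,
        exists2 A : set 'rV[R]_N, measurable A & E = x0 @^-1` A |
        exists i, exists2 A : set 'rV[R]_N, measurable A &
          E = w i @^-1` A]] >>.

(* The conditional probability of [q'_t \in A] given everything is a function of
   (q_[0,t], q'_[0,t-1]) only, hence it is also its conditional probability
   given (q_[0,t], q'_[0,t-1]). *)
Definition driven_by_channel (K : channel) (x0 : {RV P >-> 'rV[R]_N})
    (w : nat -> {RV P >-> 'rV[R]_N}) (q : nat -> Omega -> M)
    (q' : nat -> Omega -> M') : Prop :=
  forall (t : nat) (A : {set M'}),
    is_cond_prob (channel_sigma x0 w q q' t) [set o | q' t o \in A]
      (fun o => \sum_(c in A)
                  chan_prob K (history q t.+1 o) (history q' t o) c).

(* Vectors are rows, so [B u] reads [u *m B^T]. *)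
Record closed_loop (f : 'rV[R]_N -> 'rV[R]_N -> 'rV[R]_N) (B : 'M[R]_(N, s))
    (K : channel) (gamma : policy)
    (x w : nat -> {RV P >-> 'rV[R]_N}) (u : nat -> Omega -> 'rV[R]_s)
    (q : nat -> Omega -> M) (q' : nat -> Omega -> M') : Prop := ClosedLoop {
  state_eq : forall n o, x n.+1 o = f (x n o) (w n o) + u n o *m B^T ;
  input_eq : forall t o,
    q t o = encoder gamma (history x t.+1 o) (history q' t o) ;
  control_eq : forall t o, u t o = controller gamma (history q' t.+1 o) ;
  measurable_output : forall t c, measurable (q' t @^-1` [set c]) ;
  channel_eq : driven_by_channel K (x 0%N) w q q' }.

End control_over_channel.

(* Main.v *)
Require Import Defs.
From HB Require Import structures.
From mathcomp Require Import all_boot all_order all_algebra.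
From mathcomp Require Import all_classical all_reals all_analysis.
From mathcomp Require Import measurable_realfun.
From mathcomp Require Import ring lra zify.

(** Fix a horizon [T], a density [p0] of [x 0] and a density [g] of [x T].  The
    proof is one application of [log2 z <= (z - 1) / ln 2] to the random variable
      [Z = g (x T) * ratio T * P(q'_[0,T-1])],
      [ratio T = \prod_(t < T) |J(f(x_t, w_t))| /
                (p0 (x 0) * \prod_(t < T) K_t(q'_t | q_[0,t], q'_[0,t-1]))],
    in which [P(q'_[0,T-1])] is the probability of the outputs that occur.

    Why [E Z <= 1].  Fix the output string [b].  The controls are then constants,
    so [x T] is obtained from [x 0] and the noise by composing injective C^1 maps.
    Multiplying by the Jacobian determinants, dividing by the density of [x 0] and
    dividing by the channel probabilities removes in turn the distortion of volume
    by these maps, the law of [x 0] and the law of the outputs; what remains is at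
    most the Lebesgue integral of [g].  [integral_ratio_le] is this statement, by
    induction on [T]; its three ingredients are the one-sided change of variables
    [integral_comp_jacobian_le], the channel law [integral_channel], and the
    independence of [w t] from the past [integral_past_w].  Averaging over [b] with
    weights [P(q'_[0,T-1] = b)] gives [E Z <= 1], hence [E log2 Z <= 0].

    What [E log2 Z] is.  The logarithm of [Z] is a sum of four terms: [log2 g(x T)],
    of expectation [- h(x T)]; [- log2 p0(x 0)], of expectation [h(x 0)]; the sum of
    the [log2 |J(f(x_t, w_t))|]; and minus the logarithm of the ratio of the channel
    probabilities to [P(q'_[0,T-1])], whose expectation is the directed information
    ([directed_infoE], a telescoping sum).  Thus
      [\sum_(t < T) rate t <= h(x T) - h(x 0) + I(q -> q')],
    which is [sum_rate_le]; the theorem follows on dividing by [T].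

    Integrability needs care, because only the iterated integrals [rate t] are
    given, and the logarithms need not be integrable a priori.  If some [rate t] is
    [-oo], the right-hand side of the theorem is [-oo].  Otherwise the Jacobians
    are almost surely nonzero, so [integral_ratio_le] applied to indicators of null
    sets shows that [x T] has a density; the Gibbs inequality bounds the positive
    part of the total log-growth; and [integral_log_growth] propagates this bound
    backwards in time, then adds up the increments forwards. *)

Set Implicit Arguments.
Unset Strict Implicit.
Unset Printing Implicit Defensive.

Import Order.TTheory GRing.Theory Num.Theory.
Import numFieldNormedType.Exports.

Local Open Scope classical_set_scope.
Local Open Scope ring_scope.

(** * Integrals against weighted pull-backs *)

Section weighted_pullback.
Local Open Scope ereal_scope.
Import HBNNSimple.
Context d1 d2 (T1 : measurableType d1) (T2 : measurableType d2) (R : realType).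
Variables (m : {measure set T1 -> \bar R}) (k : T1 -> T2) (phi : T1 -> R).
Hypotheses (mk : measurable_fun [set: T1] k) (mphi : measurable_fun [set: T1] phi).
Hypothesis phi0 : forall x, (0 <= phi x)%R.

Lemma measurable_weighted (g : T2 -> \bar R) : measurable_fun setT g ->
  measurable_fun setT (fun x => g (k x) * (phi x)%:E).
Proof.
move=> mg; apply: emeasurable_funM; first exact: measurableT_comp.
exact/measurable_EFinP.
Qed.

Lemma integral_weighted_nnsfun (g : {nnsfun T2 >-> R}) :
  \int[m]_x ((g (k x))%:E * (phi x)%:E) =
  \sum_(r \in range g)
    (r%:E * \int[m]_(x in k @^-1` (g @^-1` [set r])) (phi x)%:E).
Proof.
have mkA (A : set T2) : measurable A -> measurable (k @^-1` A).
  by move=> mA; rewrite -[X in measurable X]setTI; exact: mk.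
have mterm r : measurable_fun setT
    (fun x => (r * \1_(g @^-1` [set r]) (k x))%:E * (phi x)%:E).
  apply: emeasurable_funM => //; last exact/measurable_EFinP.
  apply/measurable_EFinP; apply: measurable_funM => //.
  have mi : measurable_fun setT (\1_(g @^-1` [set r]) : T2 -> R).
    exact: measurable_indic.
  exact: (measurableT_comp mi mk).
have term0 r x : 0 <= (r * \1_(g @^-1` [set r]) (k x))%:E * (phi x)%:E.
  by rewrite mule_ge0 ?lee_fin// -lee_fin EFinM nnfun_muleindic_ge0.
transitivity (\int[m]_x (\sum_(r \in range g)
    ((r * \1_(g @^-1` [set r]) (k x))%:E * (phi x)%:E))).
  apply: eq_integral => x _; rewrite -ge0_mule_fsuml.
    by rewrite fsumEFin// -fimfunE.
  by move=> r; rewrite EFinM nnfun_muleindic_ge0.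
rewrite ge0_integral_fsum//; apply: eq_fsbigr => r /set_mem [y _ gyr].
have r0 : (0 <= r)%R by rewrite -gyr.
rewrite [in RHS]integral_mkcond -ge0_integralZl//; last 2 first.
- apply/(measurable_restrictT _ _).1 => //; first exact/mkA.
  by apply/measurable_EFinP; exact: measurable_funS mphi.
- by move=> x _; rewrite patchE; case: ifP; rewrite ?lee_fin.
apply: eq_integral => x _; rewrite EFinM -muleA; congr (_ * _).
rewrite patchE indicE.
have -> : (k x \in g @^-1` [set r]) = (x \in k @^-1` (g @^-1` [set r])).
  by apply/idP/idP; rewrite !inE.
by case: ifP => _; rewrite ?mul1e ?mul0e.
Qed.

Lemma cvg_integral_weighted (g : T2 -> \bar R) (mg : measurable_fun setT g) :
  (forall y, 0 <= g y) ->
  (\int[m]_x ((nnsfun_approx measurableT mg n (k x))%:E * (phi x)%:E))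
    @[n --> \oo] --> \int[m]_x (g (k x) * (phi x)%:E).
Proof.
move=> g0; set g_ := nnsfun_approx measurableT mg.
have nd x : nondecreasing_seq (fun n => (g_ n (k x))%:E * (phi x)%:E).
  move=> a b ab; apply: lee_wpmul2r; rewrite lee_fin//.
  exact/lefP/nd_nnsfun_approx.
rewrite (_ : \int[m]_x (_ * _) =
    \int[m]_x limn (fun n => (g_ n (k x))%:E * (phi x)%:E)).
  apply: cvg_monotone_convergence => //.
  - move=> n; apply: (measurable_weighted (g := EFin \o g_ n)).
    exact/measurable_EFinP.
  - by move=> n x _; rewrite mule_ge0// lee_fin.
apply: eq_integral => x _; apply/esym/cvg_lim => //.
by apply: cvgeZr => //; apply: cvg_nnsfun_approx => // y _; exact: g0.
Qed.

End weighted_pullback.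

(** Changes of measure are compared below through a single principle: an
    inequality between two weighted pull-back measures passes from sets to
    nonnegative functions, by approximation with simple functions. *)
Section compare_weighted.
Local Open Scope ereal_scope.
Import HBNNSimple.
Context d1 d1' d2 (T1 : measurableType d1) (T1' : measurableType d1')
  (T2 : measurableType d2) (R : realType).
Variables (m : {measure set T1 -> \bar R}) (k : T1 -> T2) (phi : T1 -> R).
Variables (m' : {measure set T1' -> \bar R}) (k' : T1' -> T2) (phi' : T1' -> R).
Hypotheses (mk : measurable_fun [set: T1] k)
  (mphi : measurable_fun [set: T1] phi) (phi0 : forall x, (0 <= phi x)%R).
Hypotheses (mk' : measurable_fun [set: T1'] k')
  (mphi' : measurable_fun [set: T1'] phi') (phi0' : forall x, (0 <= phi' x)%R).

Lemma le_integral_weighted :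
  (forall A, measurable A -> \int[m]_(x in k @^-1` A) (phi x)%:E <=
                             \int[m']_(x in k' @^-1` A) (phi' x)%:E) ->
  forall g : T2 -> \bar R, measurable_fun setT g -> (forall y, 0 <= g y) ->
  \int[m]_x (g (k x) * (phi x)%:E) <= \int[m']_x (g (k' x) * (phi' x)%:E).
Proof.
move=> le_sets g mg g0.
have c := @cvg_integral_weighted _ _ _ _ _ m _ _ mk mphi phi0 _ mg g0.
have c' := @cvg_integral_weighted _ _ _ _ _ m' _ _ mk' mphi' phi0' _ mg g0.
apply: lee_cvg_to c c' _.
apply: nearW => n; rewrite !integral_weighted_nnsfun//.
apply: lee_fsum => [|r [y _ <-]]; first exact: fimfunP.
by apply: lee_wpmul2l; [rewrite lee_fin|exact: le_sets].
Qed.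

End compare_weighted.

Lemma eq_integral_weighted d1 d1' d2 (T1 : measurableType d1)
    (T1' : measurableType d1') (T2 : measurableType d2) (R : realType)
    (m : {measure set T1 -> \bar R}) (k : T1 -> T2) (phi : T1 -> R)
    (m' : {measure set T1' -> \bar R}) (k' : T1' -> T2) (phi' : T1' -> R) :
  measurable_fun setT k -> measurable_fun setT phi ->
  (forall x, 0 <= phi x) ->
  measurable_fun setT k' -> measurable_fun setT phi' ->
  (forall x, 0 <= phi' x) ->
  (forall A, measurable A -> \int[m]_(x in k @^-1` A) (phi x)%:E =
                             \int[m']_(x in k' @^-1` A) (phi' x)%:E)%E ->
  forall g : T2 -> \bar R, measurable_fun setT g -> (forall y, 0 <= g y)%E ->
  (\int[m]_x (g (k x) * (phi x)%:E) = \int[m']_x (g (k' x) * (phi' x)%:E))%E.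
Proof.
move=> mk mphi phi0 mk' mphi' phi0' eq_sets g mg g0.
by apply/eqP; rewrite eq_le; apply/andP; split;
  apply: le_integral_weighted => // A mA; rewrite eq_sets.
Qed.

(** * Lebesgue measure under invertible linear maps *)

Section affine1.
Local Open Scope ereal_scope.
Variable R : realType.
Local Notation mu := (@lebesgue_measure R).

Lemma pushforward_lebesgue_affine (c b : R) (A : set (measurableTypeR R)) :
  (c != 0)%R -> measurable A ->
  `|c|%:E * pushforward mu (fun a : measurableTypeR R => (c * a + b)%R : measurableTypeR R) A
  = mu A.
Proof.
move=> c0 mA.
have mf : measurable_fun [set: measurableTypeR R]
    (fun a : measurableTypeR R => (c * a + b)%R : measurableTypeR R).
  by apply: measurable_funD => //; exact: measurable_funM.
pose m' := mscale (NngNum (normr_ge0 c)) (pushforward mu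
  (fun a : measurableTypeR R => (c * a + b)%R : measurableTypeR R)).
change (m' mf A = mu A); apply/esym.
apply: (@lebesgue_measure_unique R (m' mf)) => //.
move=> _ [[x y]] _ <-.
change (mu `]x, y]%classic = `|c|%:E *
  mu ((fun a : measurableTypeR R => (c * a + b)%R) @^-1` `]x, y]%classic)).
have c0' := c0.
have [c1|c1|//] := ltgtP c 0%R; last by move/eqP: c0.
  rewrite (_ : _ @^-1` _ = `[(y - b) / c, (x - b) / c[%classic)%R; last first.
    apply/seteqP; split => a /=; rewrite !in_itv/=.
      move=> /andP[xa ay]; rewrite ler_ndivrMr// ltr_ndivlMr//.
      by rewrite lerBrDr ltrBlDr (mulrC a) ay xa.
    rewrite ler_ndivrMr// ltr_ndivlMr// lerBrDr ltrBlDr (mulrC a).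
    by move=> /andP[-> ->].
  rewrite !lebesgue_measure_itv/= !lte_fin ltr_nM2r ?invr_lt0// ltrD2r.
  case: ifPn => _; last by rewrite mule0.
  rewrite ltr0_norm// -!EFinD -EFinM; congr EFin; field; exact: c0'.
rewrite (_ : _ @^-1` _ = `](x - b) / c, (y - b) / c]%classic)%R; last first.
  apply/seteqP; split => a /=; rewrite !in_itv/=.
    move=> /andP[xa ay]; rewrite ltr_pdivrMr// ler_pdivlMr//.
    by rewrite lerBrDr ltrBlDr (mulrC a) ay xa.
  rewrite ltr_pdivrMr// ler_pdivlMr// lerBrDr ltrBlDr (mulrC a).
  by move=> /andP[-> ->].
rewrite !lebesgue_measure_itv/= !lte_fin ltr_pM2r ?invr_gt0// ltrD2r.
case: ifPn => _; last by rewrite mule0.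
by rewrite gtr0_norm// -!EFinD -EFinM; congr EFin; field; exact: c0'.
Qed.

Lemma integral_lebesgue_affine (c b : R) (g : measurableTypeR R -> \bar R) :
  (c != 0)%R -> measurable_fun setT g -> (forall x, 0 <= g x) ->
  `|c|%:E * \int[mu]_a g (c * a + b)%R = \int[mu]_a g a.
Proof.
move=> c0 mg g0.
have mf : measurable_fun [set: measurableTypeR R]
    (fun a : measurableTypeR R => (c * a + b)%R : measurableTypeR R).
  by apply: measurable_funD => //; exact: measurable_funM.
pose m' := mscale (NngNum (normr_ge0 c)) (pushforward mu
  (fun a : measurableTypeR R => (c * a + b)%R : measurableTypeR R)).
transitivity (\int[m' mf]_a g a).
  rewrite ge0_integral_mscale//=; congr (_ * _).
  by rewrite ge0_integral_pushforward.
apply: eq_measure_integral => A mA _.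
exact: pushforward_lebesgue_affine.
Qed.

End affine1.

Section measurable_mx.
Variable R : realType.

Lemma measurable_fun_mx d (T : measurableType d) m n (f : T -> 'M[R]_(m, n)) :
  (forall i j, measurable_fun setT (fun x => f x i j : R)) ->
  measurable_fun setT f.
Proof.
move=> mf; apply: measurable_fun_mx_ball => y e e0.
rewrite (_ : _ @^-1` _ = \bigcap_(p in [set: 'I_m * 'I_n])
    (fun x => f x p.1 p.2) @^-1` ball (y p.1 p.2) e).
  apply: fin_bigcap_measurable => [|p _]; first exact: finite_finset.
  rewrite -[X in measurable X]setTI; apply: mf => //.
  exact: measurable_ball.
apply/seteqP; split => [x [_ yx] [i j] _|x yx]; first exact: yx.
by split=> // i j; exact: (yx (i, j)).
Qed.

End measurable_mx.

Section fubini_rV.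
Local Open Scope ereal_scope.
Variable R : realType.

Lemma integral_lebesgue_rVS n (g : 'rV[R]_n.+1 -> \bar R) :
  measurable_fun setT g -> (forall x, 0 <= g x) ->
  \int[lebesgue_rV R n.+1]_x g x =
  \int[@lebesgue_measure R]_a \int[lebesgue_rV R n]_v g (consrV (a, v)).
Proof.
move=> mg g0.
rewrite -(fubini_tonelli1 (fun p => g (consrV p)))//; last first.
  by apply: measurableT_comp => //; exact: measurable_consrV.
by rewrite /= /lebesgue_rV_step ge0_integral_pushforward.
Qed.

End fubini_rV.

Arguments lebesgue_rV : simpl never.

Section linear_maps.
Variable R : realType.

Lemma measurable_mulmxr m n p (M : 'M[R]_(n, p)) :
  measurable_fun setT (fun x : 'M[R]_(m, n) => x *m M).
Proof.
apply: measurable_fun_mx => i j.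
under eq_fun do rewrite mxE.
apply: measurable_sum => k; apply: measurable_funM => //.
exact: measurable_coord.
Qed.

Lemma measurable_addmxr m n (b : 'M[R]_(m, n)) :
  measurable_fun setT (fun x : 'M[R]_(m, n) => b + x).
Proof.
apply: measurable_fun_mx => i j.
under eq_fun do rewrite mxE.
by apply: measurable_funD => //; exact: measurable_coord.
Qed.

Lemma consrVD n (a b : R) (v w : 'rV[R]_n) :
  consrV (a, v) + consrV (b, w) = consrV (a + b, v + w).
Proof.
apply/rowP => k; rewrite [LHS]mxE.
by case: (split_ordP (k : 'I_(1 + n))) => i ->; rewrite ?consrVl ?consrVr// mxE.
Qed.

Lemma consrV_surj n (x : 'rV[R]_n.+1) : exists a v, x = consrV (a, v).
Proof.
exists ((lsubmx (x : 'rV_(1 + n))) 0 0), (rsubmx (x : 'rV_(1 + n))).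
by rewrite /consrV/= -mx11_scalar hsubmxK.
Qed.

(** Fubini along the first coordinate reduces this to dimension one. *)
Lemma integral_rV_translate n (b : 'rV[R]_n) (g : 'rV[R]_n -> \bar R) :
  measurable_fun setT g -> (forall x, 0 <= g x)%E ->
  (\int[lebesgue_rV R n]_x g (b + x)%R = \int[lebesgue_rV R n]_x g x)%E.
Proof.
elim: n b g => [|n IH] b g mg g0.
  by apply: eq_integral => x _; rewrite (thinmx0 b) add0r.
have [c [w ->]] := consrV_surj b.
rewrite [LHS]integral_lebesgue_rVS//; last first.
  by apply: measurableT_comp => //; exact: measurable_addmxr.
have mc a : measurable_fun setT (fun v : 'rV[R]_n => consrV (a, v)).
  by apply: measurableT_comp; [exact: measurable_consrV|exact: measurable_pair1].
under eq_integral => a _.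
  under eq_integral do rewrite consrVD.
  rewrite (IH w (fun v => g (consrV (c + a, v))))//; last first.
    by apply: measurableT_comp => //; exact: mc.
  over.
rewrite [RHS]integral_lebesgue_rVS; [|exact: mg|exact: g0].
have mF : measurable_fun [set: measurableTypeR R]
  (fun a => (\int[lebesgue_rV R n]_v g (consrV (a, v)))%E).
  apply: (measurable_fun_fubini_tonelli_F (fun p => g (consrV p))) => //.
  by apply: measurableT_comp => //; exact: measurable_consrV.
rewrite -(@integral_lebesgue_affine _ 1 c _ _ mF)//; last first.
  by move=> a; exact: integral_ge0.
rewrite normr1 mul1e; apply: eq_integral => a _; by rewrite mul1r addrC.
Qed.

(** The change of variables formula for the map [x |-> x *m M], stated for
    functions so that it composes. *)
Definition scales_volume n (M : 'M[R]_n) :=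
  forall g : 'rV[R]_n -> \bar R, measurable_fun setT g -> (forall x, 0 <= g x)%E ->
  (`|\det M|%:E * \int[lebesgue_rV R n]_x g (x *m M) =
   \int[lebesgue_rV R n]_x g x)%E.

Lemma scales_volumeM n (M M' : 'M[R]_n) :
  scales_volume M -> scales_volume M' -> scales_volume (M *m M').
Proof.
move=> hM hM' g mg g0; rewrite det_mulmx normrM mulrC EFinM -muleA.
under eq_integral do rewrite mulmxA.
rewrite (hM (fun x => g (x *m M')))//; first exact: hM'.
by apply: measurableT_comp => //; exact: measurable_mulmxr.
Qed.

Section blocks.
Variable n : nat.
Implicit Types (g : 'rV[R]_n.+1 -> \bar R).

Lemma measurable_consrV2 g : measurable_fun setT g ->
  measurable_fun setT (fun p : measurableTypeR R * 'rV[R]_n => g (consrV p)).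
Proof. by move=> mg; apply: measurableT_comp => //; exact: measurable_consrV. Qed.

Lemma scales_volume_ushear (b : 'rV[R]_n) :
  scales_volume (block_mx 1%:M b 0 1%:M : 'M[R]_(1 + n)).
Proof.
move=> g mg g0.
rewrite (det_ublock 1%:M b 1%:M) !det1 mulr1 normr1 mul1e.
rewrite [RHS]integral_lebesgue_rVS; [|exact: mg|exact: g0].
rewrite [X in _ = X]lock integral_lebesgue_rVS; last 2 first.
- by apply: measurableT_comp => //; exact: measurable_mulmxr.
- by move=> x; exact: g0.
rewrite -lock.
apply: eq_integral => a _.
rewrite -[RHS](integral_rV_translate (a *: b)) //; last first.
  apply: (measurableT_comp (measurable_consrV2 mg)); exact: measurable_pair1.
apply: eq_integral => v _; congr g.
rewrite /consrV/= [LHS](mul_row_block a%:M v) !mulmx1 mulmx0 addr0.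
by rewrite mul_scalar_mx.
Qed.

Lemma scales_volume_lshear (c : 'cV[R]_n) :
  scales_volume (block_mx 1%:M 0 c 1%:M : 'M[R]_(1 + n)).
Proof.
move=> g mg g0.
rewrite (det_lblock 1%:M c 1%:M) !det1 mulr1 normr1 mul1e.
have mg' : measurable_fun setT
    (fun x : 'rV_n.+1 => g (x *m (block_mx 1%:M 0 c 1%:M : 'M[R]_(1 + n)))).
  by apply: measurableT_comp => //; exact: measurable_mulmxr.
rewrite [RHS]integral_lebesgue_rVS; [|exact: mg|exact: g0].
rewrite [LHS]integral_lebesgue_rVS; [|exact: mg'|by move=> x; exact: g0].
rewrite (fubini_tonelli (fun p => g (consrV p *m _))); last 2 first.
- exact: (measurable_consrV2 mg').
- by move=> p; exact: g0.
rewrite (fubini_tonelli (fun p => g (consrV p))); last 2 first.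
- exact: (measurable_consrV2 mg).
- by move=> p; exact: g0.
apply: eq_integral => v _.
have mv : measurable_fun [set: measurableTypeR R] (fun a => g (consrV (a, v))).
  apply: (measurableT_comp (measurable_consrV2 mg)); exact: measurable_pair2.
rewrite -(@integral_lebesgue_affine _ 1 ((v *m c) 0 0) _ _ mv)//.
rewrite normr1 mul1e; apply: eq_integral => a _; congr g.
rewrite /consrV/= [LHS](mul_row_block a%:M v) !mulmx1 mulmx0 add0r mul1r.
by rewrite [v *m c]mx11_scalar -raddfD/= -mx11_scalar.
Qed.

Lemma scales_volume_diag (a : R) (D : 'M[R]_n) : a != 0 -> scales_volume D ->
  scales_volume (block_mx a%:M 0 0 D : 'M[R]_(1 + n)).
Proof.
move=> a0 hD g mg g0.
rewrite (det_ublock a%:M 0 D) det_scalar1 normrM EFinM.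
rewrite [RHS]integral_lebesgue_rVS; [|exact: mg|exact: g0].
rewrite [X in _ = X]lock integral_lebesgue_rVS; last 2 first.
- by apply: measurableT_comp => //; exact: measurable_mulmxr.
- by move=> x; exact: g0.
rewrite -lock.
have mF : measurable_fun [set: measurableTypeR R]
  (fun a => (\int[lebesgue_rV R n]_v g (consrV (a, v)))%E).
  exact: (measurable_fun_fubini_tonelli_F (fun p => g (consrV p))
    (measurable_consrV2 mg)).
have F0 b : (0 <= \int[lebesgue_rV R n]_v g (consrV (b, v)))%E.
  exact: integral_ge0.
rewrite -[RHS](integral_lebesgue_affine 0 a0 mF F0) -muleA; congr (_ * _)%E.
have mv b : measurable_fun setT (fun v : 'rV[R]_n => g (consrV (b, v))).
  apply: (measurableT_comp (measurable_consrV2 mg)); exact: measurable_pair1.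
rewrite -ge0_integralZl//; first last.
- by move=> b _; exact: integral_ge0.
- have mg' : measurable_fun setT
      (fun x : 'rV_n.+1 => g (x *m (block_mx a%:M 0 0 D : 'M[R]_(1 + n)))).
    by apply: measurableT_comp => //; exact: measurable_mulmxr.
  exact: (measurable_fun_fubini_tonelli_F (fun p => g (consrV p *m _))
    (measurable_consrV2 mg')).
apply: eq_integral => b _; rewrite -(hD _ (mv _))//; congr (_ * _)%E.
apply: eq_integral => v _; congr g.
rewrite /consrV/= [LHS](mul_row_block b%:M v) !mulmx0 addr0 add0r.
by rewrite -scalar_mxM addr0 mulrC.
Qed.

End blocks.

(** Gaussian elimination: when the upper left entry is nonzero, a block LU
    factorization writes [M] as a product of two shears and a block-diagonal matrix,
    and the induction hypothesis applies to the Schur complement.  A zero pivot is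
    removed by a shear that adds to the first column a column with a nonzero first
    entry. *)
Lemma scales_volume_unitmx n (M : 'M[R]_n) : M \in unitmx -> scales_volume M.
Proof.
elim: n M => [|n IH] M Mu.
  move=> g mg g0; rewrite det_mx00 normr1 mul1e.
  by apply: eq_integral => x _; rewrite (thinmx0 (x *m M)) (thinmx0 x).
have pivot (M' : 'M[R]_(1 + n)) : M' \in unitmx -> ulsubmx M' 0 0 != 0 ->
    scales_volume (M' : 'M[R]_n.+1).
  move=> Mu' al0; set al := ulsubmx M' 0 0 in al0.
  set b := ursubmx M'; set c := dlsubmx M'; set D := drsubmx M'.
  have M'E : M' = block_mx al%:M b c D by rewrite -mx11_scalar submxK.
  (* The Schur complement of the pivot. *)
  pose D' := D - al^-1 *: (c *m b).
  have fac : M' = block_mx 1%:M 0 (al^-1 *: c) 1%:M *m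
      (block_mx al%:M 0 0 D' *m block_mx 1%:M (al^-1 *: b) 0 1%:M).
    rewrite !mulmx_block !mulmx0 !mul0mx !mulmx1 !mul1mx !addr0 !add0r.
    rewrite M'E; congr block_mx.
    - by rewrite mul_scalar_mx scalerA divff// scale1r.
    - by rewrite mul_mx_scalar scalerA divff// scale1r.
    - rewrite mul_scalar_mx scalerA divff// scale1r -scalemxAl /D'.
      by rewrite addrC subrK.
  have D'u : D' \in unitmx.
    move: Mu'; rewrite fac unitmxE !det_mulmx det_lblock.
    rewrite !(det_ublock, det1) mulr1 mul1r mulr1 unitrM unitmxE.
    by case/andP.
  rewrite fac; apply: scales_volumeM; first exact: scales_volume_lshear.
  apply: scales_volumeM; last exact: scales_volume_ushear.
  by apply: scales_volume_diag => //; exact: IH.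
have [al0|al0] := eqVneq (ulsubmx (M : 'M[R]_(1 + n)) 0 0) 0; last exact: pivot.
have [j bj] : exists j, ursubmx (M : 'M[R]_(1 + n)) 0 j != 0.
  apply/existsP; apply: contraT; rewrite negb_exists => /forallP b0.
  have r0 : row 0 M = 0.
    apply/rowP => k; rewrite !mxE.
    case: (split_ordP (k : 'I_(1 + n))) => i ->.
      by rewrite (ord1 i); move: al0; rewrite !mxE => <-; congr (M _ _); exact/val_inj.
    move: (b0 i); rewrite negbK !mxE => /eqP <-; congr (M _ _); exact/val_inj.
  move: Mu; rewrite unitmxE (expand_det_row _ 0) big1 ?unitr0// => k _.
  by move/rowP : r0 => /(_ k); rewrite !mxE => ->; rewrite mul0r.
pose S e : 'M[R]_(1 + n) := block_mx 1%:M 0 (e *: delta_mx j 0) 1%:M.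
have SS : S 1 *m S (-1) = 1%:M.
  rewrite /S mulmx_block !mulmx0 !mul0mx !mulmx1 !mul1mx !addr0 !add0r.
  by rewrite -scalerDl subrr scale0r -scalar_mx_block.
have -> : M = ((M : 'M[R]_(1 + n)) *m S 1) *m S (-1) by rewrite -mulmxA SS mulmx1.
apply: scales_volumeM; last exact: scales_volume_lshear.
apply: pivot.
  rewrite unitmx_mul Mu/= unitmxE det_lblock !det1 mulr1; exact: unitr1.
rewrite -[M in M *m _](submxK (M : 'M[R]_(1 + n))) /S mulmx_block block_mxKul.
rewrite !mulmx1 mxE al0 add0r scale1r mxE (bigD1 j)//= big1 ?addr0.
  by rewrite [delta_mx _ _ _ _]mxE !eqxx mulr1.
by move=> k kj; rewrite [delta_mx _ _ _ _]mxE (negbTE kj) mulr0.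
Qed.

End linear_maps.

(** * Outer regularity of finite Borel measures *)

Lemma near_lt_cvge (R : realType) (u : (\bar R)^nat) (l a : \bar R) :
  u @ \oo --> l -> (l < a)%E -> \forall n \near \oo, (u n < a)%E.
Proof.
move=> ul la; apply: (ul [set y | (y < a)%E]); apply: open_nbhs_nbhs.
by split => //; exact: open_ereal_lt_ereal.
Qed.

Section erosion.
Variables (R : realType) (m n : nat).
Implicit Types Z C : set 'M[R]_(m, n).

Lemma closed_measurable_mx C : closed C -> measurable C.
Proof.
move=> cC; rewrite -[C]setCK; apply: measurableC; apply: open_measurable_mx.
exact: closed_openC.
Qed.

(** Erosions by balls of radius [1 / (N + 1)] exhaust an open set by closed sets. *)
Definition erosion Z (r : R) : set 'M[R]_(m, n) := [set y | ball y r `<=` Z].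

Lemma closed_erosion Z r : 0 < r -> closed (erosion Z r).
Proof.
move=> r0; rewrite -[erosion Z r]setCK; apply: open_closedC; rewrite openE => y.
move=> /existsNP[z /not_implyP[yz nZz]].
have : nbhs y (ball z r).
  by apply: open_nbhs_nbhs; split; [exact: ball_open|exact: ball_sym].
by apply: filterS => t zt /= Ct; apply: nZz; apply: Ct; exact: ball_sym.
Qed.

Lemma sub_erosion Z r : 0 < r -> erosion Z r `<=` Z.
Proof. by move=> r0 y; apply; exact: ballxx. Qed.

Lemma nondecreasing_erosion Z :
  nondecreasing_seq (fun N => erosion Z (N.+1%:R^-1 : R)).
Proof.
move=> a b ab; apply/subsetPset => y; apply: subset_trans; apply: le_ball.
by rewrite lef_pV2 ?posrE// ler_nat.
Qed.

Lemma erosion_bigcup Z : open Z -> \bigcup_N erosion Z (N.+1%:R^-1 : R) = Z.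
Proof.
move=> oZ; apply/seteqP; split=> [y [N _]|y Zy]; first exact: sub_erosion.
have [r /= r0 yr] : exists2 r : R, (0 < r)%R & ball y r `<=` Z.
  by move: oZ; rewrite openE => /(_ _ Zy) /nbhs_ballP.
have [N _ HN] := near_infty_natSinv_lt (PosNum r0).
by exists N => //; apply: subset_trans yr; apply/le_ball/ltW/HN => /=.
Qed.

End erosion.

Section regularity.
Local Open Scope ereal_scope.
Variables (R : realType) (n : nat).
Variable m : {measure set 'rV[R]_n -> \bar R}.
Hypothesis m_fin : m setT < +oo.

(** Symmetric in inner and outer approximation, so that the sets with this
    property are closed under complement and form a sigma-algebra. *)
Definition approximable (Z : set 'rV[R]_n) : Prop :=
  forall e : R, (0 < e)%R -> exists C O,
    [/\ closed C, open O, C `<=` Z, Z `<=` O & m (O `\` C) <= e%:E].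

Lemma approximableC Z : approximable Z -> approximable (~` Z).
Proof.
move=> aZ e e0; have [C [V [cC oO CZ ZO mOC]]] := aZ _ e0.
exists (~` V), (~` C); split.
- exact: open_closedC.
- exact: closed_openC.
- exact: subsetC.
- exact: subsetC.
- by rewrite (_ : _ `\` _ = V `\` C)// setDE setCK setIC.
Qed.

Let m_lt_pinfty A : measurable A -> m A < +oo.
Proof. by move=> mA; apply: le_lt_trans m_fin; apply: le_measure; rewrite ?inE. Qed.

(** The open approximation may be an infinite union, but the closed one is cut
    to finitely many terms, at a rank given by continuity from above. *)
Lemma approximable_bigcup (F : (set 'rV[R]_n)^nat) :
  (forall k, approximable (F k)) -> approximable (\bigcup_k F k).
Proof.
move=> aF e e0.
have e20 k : (0 < e / 2 / (2 ^ k.+1)%:R)%R by rewrite !divr_gt0// ltr0n expn_gt0.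
have /choice [CO COP] : forall k, exists CO : set 'rV[R]_n * set 'rV[R]_n,
    [/\ closed CO.1, open CO.2, CO.1 `<=` F k, F k `<=` CO.2 &
      m (CO.2 `\` CO.1) <= (e / 2 / (2 ^ k.+1)%:R)%:E].
  by move=> k; have [C [V ?]] := aF k _ (e20 k); exists (C, V).
pose O := \bigcup_k (CO k).2; pose C N := \bigcup_(k < N) (CO k).1.
have oO : open O by apply: bigcup_open => k _; have [] := COP k.
have cC N : closed (C N).
  rewrite /C bigcup_mkord; apply: closed_bigsetU => k _; by have [] := COP k.
have mO := open_measurable_mx oO.
have mC N := closed_measurable_mx (cC N).
have mCO k : measurable ((CO k).2 `\` (CO k).1).
  have [cCk oOk _ _ _] := COP k.
  by apply: measurableD; [exact: open_measurable_mx|exact: closed_measurable_mx].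
have COinf : \bigcap_N (O `\` C N) `<=` \bigcup_k ((CO k).2 `\` (CO k).1).
  move=> y yI; have [[k _ yk] _] := yI 0%N I.
  exists k => //; split => // yCk.
  by have [_] := yI k.+1 I; apply; exists k => //=.
have mI : measurable (\bigcap_N (O `\` C N)).
  by apply: bigcapT_measurable => N; exact: measurableD.
have mle : m (\bigcap_N (O `\` C N)) <= (e / 2)%:E.
  apply: (@le_trans _ _ (\sum_(k <oo) (e / 2 / (2 ^ k.+1)%:R)%:E)); last first.
    by apply: (epsilon_trick0 xpredT); rewrite divr_ge0// ltW.
  apply: le_trans (measure_sigma_subadditive m mCO mI COinf) _.
  by apply: lee_nneseries => // k _; have [] := COP k.
have cvgm : m \o (fun N => O `\` C N) @ \oo --> m (\bigcap_N (O `\` C N)).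
  apply: nonincreasing_cvg_mu => //.
  - by apply: m_lt_pinfty; exact: measurableD.
  - by move=> N; exact: measurableD.
  - move=> a b ab; apply/subsetPset => y [Oy nCy]; split => // -[k /= ka Cy].
    by apply: nCy; exists k => //=; exact: leq_trans ab.
have [N _ HN] : \forall N \near \oo, m (O `\` C N) < e%:E.
  apply: (near_lt_cvge cvgm); apply: le_lt_trans mle _.
  by rewrite lte_fin ltr_pdivrMr// ltr_pMr// ltr1n.
exists (C N), O; split => //.
- move=> y [k _ yk]; exists k => //; by have [_ _ + _ _] := COP k; apply.
- move=> y [k _ yk]; exists k => //; by have [_ _ _ + _] := COP k; apply.
- by apply/ltW; apply: HN => /=.
Qed.

Lemma approximable_open Z : open Z -> approximable Z.
Proof.
move=> oZ e e0; pose C N := erosion Z (N.+1%:R^-1 : R).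
have cC N : closed (C N) by exact: closed_erosion.
have mC N := closed_measurable_mx (cC N).
have mZ := open_measurable_mx oZ.
have I0 : \bigcap_N (Z `\` C N) = set0.
  apply/seteqP; split => // y yI; have [Zy _] := yI 0%N I.
  move: Zy; rewrite -(erosion_bigcup oZ) => -[N _ yN].
  by have [_] := yI N I; apply.
have cvgm : m \o (fun N => Z `\` C N) @ \oo --> m (\bigcap_N (Z `\` C N)).
  apply: nonincreasing_cvg_mu => //.
  - by apply: m_lt_pinfty; exact: measurableD.
  - by move=> N; exact: measurableD.
  - by rewrite I0.
  - move=> a b ab; apply/subsetPset; apply: setDS.
    exact/subsetPset/(nondecreasing_erosion Z ab).
rewrite I0 measure0 in cvgm.
have [N _ HN] : \forall N \near \oo, m (Z `\` C N) < e%:E.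
  by apply: (near_lt_cvge cvgm); rewrite lte_fin.
exists (C N), Z; split => //; last by apply/ltW; apply: HN => /=.
exact: sub_erosion.
Qed.

Lemma approximable_borel Z : measurable Z -> approximable Z.
Proof.
apply: smallest_sub => //=; last by move=> A; exact: approximable_open.
split.
- exact/approximable_open/open0.
- by move=> A aA; rewrite setTD; exact: approximableC.
- exact: approximable_bigcup.
Qed.

Lemma outer_regular (Z : set 'rV[R]_n) (e : R) : measurable Z -> (0 < e)%R ->
  exists2 O : set 'rV[R]_n, open O & Z `<=` O /\ m O <= m Z + e%:E.
Proof.
move=> mZ e0; have [C [V [cC oO CZ ZO mOC]]] := approximable_borel mZ e0.
exists V => //; split => //.
have mC := closed_measurable_mx cC; have mV := open_measurable_mx oO.
rewrite -[in leLHS](setDUK (subset_trans CZ ZO)).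
apply: le_trans (measureU2 _ _ _) _ => //; first exact: measurableD.
by apply: leeD => //; apply: le_measure; rewrite ?inE.
Qed.

End regularity.

(** * Measures bounded on balls, and expanding maps *)

Section balls.
Variable R : realType.

Lemma lebesgue_rV_ball n (x : 'rV[R]_n) (r : R) : 0 < r ->
  lebesgue_rV R n (ball x r) = ((r *+ 2) ^+ n)%:E.
Proof.
elim: n x => [|n IH] x r0.
  rewrite expr0 (_ : ball x r = setT).
    by rewrite [LHS]diracT.
  by apply/seteqP; split => // y _; rewrite (thinmx0 y) -(thinmx0 x); exact: ballxx.
rewrite [LHS](_ : _ = (@lebesgue_measure R \x lebesgue_rV R n)%E
    (@consrV R n @^-1` ball x r)) // preimage_consrV_ball//.
rewrite product_measure1E//; last 2 first.
- exact: measurable_ball.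
- by apply: open_measurable_mx; exact: ball_open.
transitivity ((r *+ 2)%:E * ((r *+ 2) ^+ n)%:E)%E; last by rewrite exprS EFinM.
by congr (_ * _)%E; [apply: lebesgue_measure_ball; exact: ltW|exact: IH].
Qed.

(** For the sup norm, a set of diameter at most [e] lies in a cube of side [e].
    The slack [e'] absorbs the difference between closed and open balls. *)
Lemma lebesgue_rV_le_diam n (A : set 'rV[R]_n) (e e' : R) : measurable A ->
  0 <= e -> e < e' -> (forall a b, A a -> A b -> forall j, `|a 0 j - b 0 j| <= e) ->
  (lebesgue_rV R n A <= (e' ^+ n)%:E)%E.
Proof.
move=> mA e0 ee' Ae.
have e'0 : 0 < e' by exact: le_lt_trans ee'.
have [->|/set0P[a Aa]] := eqVneq A set0.
  by rewrite measure0 lee_fin exprn_ge0// ltW.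
(* The cube starts at the coordinatewise infima of A. *)
pose lo j := inf [set b 0 j | b in A].
have lo_le b j : A b -> lo j <= b 0 j.
  move=> Ab; apply: ge_inf; last by exists b.
  exists (a 0 j - e) => _ [c Ac <-].
  by have := Ae _ _ Aa Ac j; rewrite ler_norml => /andP[_]; lra.
have le_lo b j : A b -> b 0 j <= lo j + e.
  move=> Ab; rewrite -lerBlDr; apply: lb_le_inf; first by exists (a 0 j), a.
  by move=> _ [c Ac <-]; have := Ae _ _ Ab Ac j; rewrite ler_norml => /andP[_]; lra.
pose z : 'rV[R]_n := \row_j (lo j + e / 2).
have Az : A `<=` ball z (e' / 2).
  move=> b Ab; split; first by rewrite divr_gt0.
  move=> i j; rewrite (ord1 i) mxE /ball/= ltr_distl.
  by have := lo_le _ j Ab; have := le_lo _ j Ab; lra.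
apply: (@le_trans _ _ (lebesgue_rV R n (ball z (e' / 2)))).
  by apply: le_measure; rewrite ?inE//; apply: open_measurable_mx; exact: ball_open.
rewrite lebesgue_rV_ball ?divr_gt0// lee_fin.
by rewrite (_ : _ *+ 2 = e')// mulr2n -splitr.
Qed.

End balls.

(** A finite measure that is dominated by [K] times Lebesgue measure on all
    balls is dominated by it on all Borel sets.  On an open set, the measure is
    averaged over balls of a fixed radius by Fubini; outer regularity extends the
    bound to Borel sets. *)
Section averaging.
Local Open Scope ereal_scope.
Variables (R : realType) (n : nat).
Variables (mu : {finite_measure set 'rV[R]_n -> \bar R}) (K : R).
Hypothesis K0 : (0 <= K)%R.
Hypothesis mu_ball : forall z r, (0 < r)%R ->
  mu (ball z r) <= K%:E * lebesgue_rV R n (ball z r).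

Let mball (r : R) : measurable [set p : 'rV[R]_n * 'rV[R]_n | ball p.1 r p.2].
Proof.
have [r0|r0] := leP r 0%R.
  rewrite (_ : [set _ | _] = set0)//; apply/seteqP; split => // p [].
  by rewrite ltNge r0.
rewrite (_ : [set _ | _] = \bigcap_(j in [set: 'I_n])
    (fun p : 'rV[R]_n * 'rV[R]_n => p.1 0 j - p.2 0 j)%R @^-1` ball 0%R r).
  apply: fin_bigcap_measurable => [|j _]; first exact: finite_finset.
  rewrite -[X in measurable X]setTI.
  apply: (_ : measurable_fun setT _) => //; last exact: measurable_ball.
  apply: measurable_funB.
    exact: (measurableT_comp (measurable_coord 0%R j) measurable_fst).
  exact: (measurableT_comp (measurable_coord 0%R j) measurable_snd).
apply/seteqP; split => [p [_ pr] j _|p pr].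
  by have := pr 0%R j; rewrite /ball/= sub0r normrN.
by split=> // i j; rewrite (ord1 i); have := pr j I; rewrite /ball/= sub0r normrN.
Qed.

(** Points of the [r]-erosion of [O] have their whole [r]-ball inside [O].
    Integrating [lambda (O `&` ball z r)] over [z] and exchanging the integrals
    bounds the [mu]-measure of the erosion; then [r] tends to [0]. *)
Lemma le_measure_open_of_balls (O : set 'rV[R]_n) : open O ->
  mu O <= K%:E * lebesgue_rV R n O.
Proof.
move=> oO; have mO := open_measurable_mx oO.
pose C N := erosion O (N.+1%:R^-1 : R).
have mC N : measurable (C N) by apply: closed_measurable_mx; exact: closed_erosion.
have cvgC : mu \o C @ \oo --> mu O.
  rewrite -[X in mu X](erosion_bigcup oO); apply: nondecreasing_cvg_mu => //.
    exact: bigcupT_measurable.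
  exact: nondecreasing_erosion.
apply: (cvge_le _ cvgC); apply: nearW => N /=.
pose r : R := (N.+1%:R^-1)%R; have r0 : (0 < r)%R by rewrite invr_gt0.
pose E := [set p : 'rV[R]_n * 'rV[R]_n | O p.2 /\ ball p.1 r p.2].
have mE : measurable E.
  apply: measurableI; last exact: mball.
  rewrite -[X in measurable X]setTI; exact: measurable_snd.
have mind : measurable_fun setT (fun p => (\1_E p)%:E : \bar R).
  by apply/measurable_EFinP; exact: measurable_indic.
pose v : R := ((r *+ 2) ^+ n)%R; have v0 : (0 < v)%R by rewrite exprn_gt0// mulrn_wgt0.
have mOB (z : 'rV[R]_n) : measurable (O `&` ball z r).
  by apply: measurableI => //; apply: open_measurable_mx; exact: ball_open.
have lhs z : \int[lebesgue_rV R n]_y (\1_E (z, y))%:E =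
    lebesgue_rV R n (O `&` ball z r).
  by rewrite -(setIT (O `&` _)) -integral_indic.
have rhs y : \int[mu]_z (\1_E (z, y))%:E <= (K * v * \1_O y)%:E.
  have [Oy|nOy] := pselect (O y).
    rewrite indicE mem_set// mulr1 EFinM -(lebesgue_rV_ball y r0).
    apply: le_trans (mu_ball y r0).
    have mb : measurable (ball y r) by apply: open_measurable_mx; exact: ball_open.
    rewrite -(setIT (ball y r)) -integral_indic//; apply: ge0_le_integral => //.
    - by apply: (measurableT_comp mind); exact: measurable_pair2.
    - by apply/measurable_EFinP; exact: measurable_indic.
    - move=> z _; rewrite lee_fin !indicE ler_nat.
      have [/set_mem[_ /ball_sym /= zy]|//] := boolP ((z, y) \in E).
      by rewrite mem_set.
  rewrite indicE memNset// mulr0 integral0_eq// => z _.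
  by rewrite indicE memNset//= => -[].
have : v%:E * mu (C N) <= v%:E * (K%:E * lebesgue_rV R n O).
  apply: (@le_trans _ _ (\int[mu]_z \int[lebesgue_rV R n]_y (\1_E (z, y))%:E)).
    under eq_integral do rewrite lhs.
    rewrite -integral_cst//; apply: (@le_trans _ _
      (\int[mu]_(z in C N) lebesgue_rV R n (O `&` ball z r))).
      apply: ge0_le_integral => //.
      - by move=> z _; rewrite lee_fin ltW.
      - apply: measurable_funTS; under eq_fun do rewrite -lhs.
        exact: (measurable_fun_fubini_tonelli_F (fun p => (\1_E p)%:E)).
      - by move=> z Cz; rewrite setIidr// lebesgue_rV_ball.
    apply: ge0_subset_integral => //.
    by under eq_fun do rewrite -lhs; exact: (measurable_fun_fubini_tonelli_F
      (fun p => (\1_E p)%:E)).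
  rewrite (fubini_tonelli (fun p => (\1_E p)%:E))//.
  apply: (@le_trans _ _ (\int[lebesgue_rV R n]_y (K * v * \1_O y)%:E)).
    apply: ge0_le_integral => //.
    - by move=> y _; apply: integral_ge0 => z _; rewrite lee_fin.
    - exact: (measurable_fun_fubini_tonelli_G (fun p => (\1_E p)%:E)).
    - by apply/measurable_EFinP; apply: measurable_funM => //; exact: measurable_indic.
  under eq_integral do rewrite EFinM.
  rewrite ge0_integralZl//; last 2 first.
  - by apply/measurable_EFinP; exact: measurable_indic.
  - by rewrite lee_fin mulr_ge0// ltW.
  by rewrite integral_indic// setIT mulrC EFinM -muleA.
by rewrite lee_pmul2l// lte_fin.
Qed.

(** Outer regularity holds for finite measures, hence the restriction of
    Lebesgue measure to a ball. *)
Let bounded_part (k : nat) Z :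
  measurable Z -> Z `<=` ball (0%R : 'rV[R]_n) k.+1%:R ->
  mu Z <= K%:E * lebesgue_rV R n Z.
Proof.
move=> mZ Zk; set D := ball _ _ in Zk.
have oD : open D by exact: ball_open.
have mD : measurable D by exact: open_measurable_mx.
pose lD := mrestr (lebesgue_rV R n) mD.
have lDfin : lD setT < +oo by rewrite /lD /mrestr setTI lebesgue_rV_ball// ltry.
apply/lee_addgt0Pr => e e0.
have K1 : (0 < K + 1)%R by rewrite ltr_wpDl.
have [V oO [ZO lO]] := outer_regular lDfin mZ (divr_gt0 e0 K1).
have OD : mu Z <= mu (V `&` D).
  apply: le_measure; rewrite ?inE//; last by move=> y Zy; split; [exact: ZO|exact: Zk].
  by apply: measurableI => //; exact: open_measurable_mx.
apply: (le_trans OD).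
apply: (le_trans (le_measure_open_of_balls (openI oO oD))).
apply: (@le_trans _ _ (K%:E * (lebesgue_rV R n Z + (e / (K + 1))%:E))).
  apply: lee_wpmul2l; first by rewrite lee_fin.
  have : lebesgue_rV R n (V `&` D) <=
      lebesgue_rV R n (Z `&` D) + (e / (K + 1))%:E by exact: lO.
  by rewrite (setIidl Zk).
rewrite ge0_muleDr//; last by rewrite lee_fin divr_ge0// ltW.
rewrite leeD2l// -EFinM lee_fin mulrCA -[leRHS]mulr1 ler_pM2l//.
by rewrite ler_pdivrMr// mul1r lerDl.
Qed.

Lemma le_measure_of_balls Z : measurable Z -> mu Z <= K%:E * lebesgue_rV R n Z.
Proof.
move=> mZ; pose F k := Z `&` ball (0%R : 'rV[R]_n) k.+1%:R.
have mF k : measurable (F k).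
  by apply: measurableI => //; apply: open_measurable_mx; exact: ball_open.
have UF : \bigcup_k F k = Z.
  apply/seteqP; split=> [y [k _ []]//|y Zy].
  exists (Num.truncn `|y|) => //; split => //.
  by rewrite -ball_normE/= sub0r normrN; exact: truncnS_gt.
have cvgF : mu \o F @ \oo --> mu Z.
  rewrite -[X in mu X]UF; apply: nondecreasing_cvg_mu => //.
    exact: bigcupT_measurable.
  move=> a b ab; apply/subsetPset; apply: setIS; apply: le_ball.
  by rewrite ler_nat.
apply: (cvge_le _ cvgF); apply: nearW => k /=.
apply: le_trans (bounded_part (mF k) (@subIsetr _ _ _)) _.
apply: lee_wpmul2l; first by rewrite lee_fin.
by apply: le_measure; rewrite ?inE//; exact: subIsetl.
Qed.

End averaging.

Section expanding_maps.
Variables (R : realType) (n : nat).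

(** The pushforward of Lebesgue measure on [V] by [H] is at most [c' ^ n] times
    Lebesgue measure on balls, since the preimage in [V] of a ball of radius [r] has
    diameter at most [2 c r]. *)
Lemma lebesgue_rV_expanding (V Z : set 'rV[R]_n) (H : 'rV[R]_n -> 'rV[R]_n)
    (c c' : R) :
  measurable V -> (lebesgue_rV R n V < +oo)%E -> measurable_fun setT H ->
  0 < c -> c < c' ->
  (forall a b, V a -> V b -> `|a - b| <= c * `|H a - H b|) ->
  measurable Z ->
  (lebesgue_rV R n (V `&` H @^-1` Z) <= (c' ^+ n)%:E * lebesgue_rV R n Z)%E.
Proof.
move=> mV Vfin mH c0 cc' Hc mZ; have c'0 : 0 < c' by exact: lt_trans cc'.
pose mu0 := pushforward (mrestr (lebesgue_rV R n) mV) H :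
  {measure set 'rV[R]_n -> \bar R}.
have mu0fin : fin_num_fun (mu0 mH).
  apply: lty_fin_num_fun.
  suff : (lebesgue_rV R n (setT `&` V) < +oo)%E by []; by rewrite setTI.
pose mu : {finite_measure set 'rV[R]_n -> \bar R} :=
  HB.pack (Measure.sort (mu0 mH)) (Measure_isFinite.Build _ _ _ (mu0 mH) mu0fin).
have muE A : mu A = lebesgue_rV R n (V `&` H @^-1` A).
  by rewrite setIC.
rewrite -muE; apply: le_measure_of_balls => //; first by rewrite exprn_ge0// ltW.
move=> z r r0; rewrite muE lebesgue_rV_ball// -EFinM -exprMn.
have mb : measurable (ball z r) by apply: open_measurable_mx; exact: ball_open.
apply: (@lebesgue_rV_le_diam _ _ _ (c * (r *+ 2))).
- by apply: measurableI => //; rewrite -[X in measurable X]setTI; apply: (mH).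
- by rewrite mulr_ge0// ?mulrn_wge0// ltW.
- by rewrite ltr_pM2r// mulrn_wgt0.
move=> a b [Va zHa] [Vb zHb] j.
have ab : `|a 0 j - b 0 j| <= `|a - b|.
  rewrite [leRHS]mx_normrE; apply: le_trans (le_bigmax _ _ (0, j)).
  by rewrite !mxE.
apply: (le_trans ab); apply: (le_trans (Hc _ _ Va Vb)).
rewrite ler_pM2l// ltW// mulr2n.
have := ball_triangle (ball_sym zHa) zHb.
by rewrite -ball_normE.
Qed.

End expanding_maps.

(** * One-sided change of variables for injective C^1 maps *)

Section local_linearization.
Variable R : realType.

Lemma le_coord_norm m n (M : 'M[R]_(m, n)) i j : `|M i j| <= `|M|.
Proof. by rewrite [leRHS]mx_normrE; exact: (le_bigmax _ _ (i, j)). Qed.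

Lemma norm_rV_le n (v : 'rV[R]_n) (e : R) :
  0 <= e -> (forall j, `|v 0 j| <= e) -> `|v| <= e.
Proof.
move=> e0 ve; rewrite [leLHS]mx_normrE; apply: bigmax_le => // -[i j] _ /=.
by rewrite (ord1 i).
Qed.

Lemma norm_mulmx_le n p (v : 'rV[R]_n) (M : 'M[R]_(n, p)) :
  `|v *m M| <= n%:R * `|v| * `|M|.
Proof.
apply: norm_rV_le => [|j]; first by rewrite !mulr_ge0.
rewrite mxE; apply: (le_trans (ler_norm_sum _ _ _)).
apply: (@le_trans _ _ (\sum_(k < n) `|v| * `|M|)).
  by apply: ler_sum => k _; rewrite normrM ler_pM// le_coord_norm.
by rewrite sumr_const card_ord -[leLHS]mulr_natl mulrA.
Qed.

Lemma is_derive_along_line n m (F : 'rV[R]_n -> 'rV[R]_m) (b h : 'rV[R]_n) j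
    (t : R) : differentiable F (b + t *: h) ->
  is_derive t 1 (fun t : R => F (b + t *: h) 0 j) ((h *m 'J F (b + t *: h)) 0 j).
Proof.
move=> dF; have cF := @diff_derivable _ _ _ _ _ h dF.
have E : (fun e : R => e^-1 *: (((fun t : R => F (b + t *: h) 0 j : R) \o shift t)
      (e *: 1) - F (b + t *: h) 0 j)) =
    (fun e : R => (e^-1 *: ((F \o shift (b + t *: h)) (e *: h) - F (b + t *: h))) 0 j).
  apply/funext => e; rewrite /= !mxE; congr (_ *: (F _ _ _ - _)).
  by rewrite scalerDl addrCA -[e *: 1]/(e * 1) mulr1.
have cv : (fun e : R => e^-1 *: (((fun t : R => F (b + t *: h) 0 j : R) \o shift t)
      (e *: 1) - F (b + t *: h) 0 j))
    @ 0^' --> ((h *m 'J F (b + t *: h)) 0 j : R).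
  rewrite E -deriveEjacobian//.
  exact: (cvg_comp _ _ cF (@coord_continuous _ _ _ 0 j _)).
split; first by apply/cvg_ex; exists ((h *m 'J F (b + t *: h)) 0 j).
exact: cvg_lim.
Qed.

(** The mean value theorem along segments, one coordinate at a time: a C^1 map
    differs from its linearization at [x0] by a map of small Lipschitz constant
    near [x0]. *)
Lemma C1_near_linear n (F : 'rV[R]_n -> 'rV[R]_n) (x0 : 'rV[R]_n) (e : R) :
  (forall x, differentiable F x) -> {for x0, continuous (fun x => 'J F x)} ->
  0 < e ->
  \forall r \near (0:R)^'+, forall a b, ball x0 r a -> ball x0 r b ->
    `|F a - F b - (a - b) *m 'J F x0| <= e * `|a - b|.
Proof.
move=> dF cJ e0; have e1 : 0 < e / n.+1%:R by rewrite divr_gt0.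
have /nbhs_ballP[r0 /= r00 Hr0] : \forall x \near x0, `|'J F x0 - 'J F x| < e / n.+1%:R.
  by move/cvgrPdist_lt : cJ; exact.
near=> r => a b ra rb.
have rr0 : r <= r0 by near: r; exact: nbhs_right_le.
apply: norm_rV_le => [|j]; first by rewrite mulr_ge0// ltW.
pose g t := F (b + t *: (a - b)) 0 j : R.
pose dg t := ((a - b) *m 'J F (b + t *: (a - b))) 0 j : R.
have gd (t : R) : is_derive t 1 g (dg t) by exact: is_derive_along_line.
have gc : {within `[0, 1], continuous g}.
  by apply: derivable_within_continuous => t _; have [] := gd t.
have [c c01] := MVT_segment ler01 (fun t _ => gd t) gc.
rewrite subr0 mulr1 /g scale0r scale1r addr0 [b + _]addrC subrK => gE.
set y := b + c *: (a - b).
have yr : ball x0 r0 y.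
  apply: le_ball rr0 _ _; move: ra rb; rewrite -!ball_normE/= => ra rb.
  have -> : x0 - y = c *: (x0 - a) + (1 - c) *: (x0 - b).
    by rewrite /y; apply/matrixP => i k; rewrite !mxE; ring.
  move: c01; rewrite in_itv/= => /andP[c0 c1].
  apply: (le_lt_trans (ler_normD _ _)); rewrite !normrZ ger0_norm//.
  rewrite ger0_norm ?subr_ge0//.
  have [->|c1'] := eqVneq c 1; first by rewrite subrr mul0r addr0 mul1r.
  have {}c1' : 0 < 1 - c by rewrite subr_gt0 lt_neqAle c1'.
  by move: ra rb; nra.
have -> : (F a - F b - (a - b) *m 'J F x0) 0 j = ((a - b) *m ('J F y - 'J F x0)) 0 j.
  have coordB (A B : 'rV[R]_n) : (A - B) 0 j = A 0 j - B 0 j by rewrite !mxE.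
  by rewrite mulmxBr !coordB; congr (_ - _); exact: gE.
apply: (le_trans (le_coord_norm _ _ _)); apply: (le_trans (norm_mulmx_le _ _)).
rewrite (mulrC n%:R) -mulrA mulrC ler_wpM2r//.
have h : `|'J F y - 'J F x0| <= e / n.+1%:R.
  by rewrite distrC; apply: ltW; exact: (Hr0 _ yr).
apply: (@le_trans _ _ (n%:R * (e / n.+1%:R))); first by rewrite ler_wpM2l.
by rewrite mulrCA ger_pMr// ler_pdivrMr// mul1r ler_nat.
Unshelve. all: by end_near. Qed.

Lemma continuous_det n : continuous (fun M : 'M[R]_n => \det M).
Proof.
apply: continuous_big => [|s _]; first exact: add_continuous.
have cprod : continuous (fun M : 'M[R]_n => \prod_i M i (perm.fun_of_perm s i)).
  apply: continuous_big => [|i _]; first exact: mul_continuous.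
  exact: coord_continuous.
move=> M; have FM := @nbhs_filter _ M.
exact: (cvgM (cvg_cst _) (cprod M)).
Qed.

Lemma continuous_measurable_mx m n (g : 'M[R]_(m, n) -> R) :
  continuous g -> measurable_fun setT g.
Proof.
move=> cg; apply: (measurability _ (RGenOpens.measurableE R)) => //.
move=> _ [_ [a [b ->] <-]]; rewrite setTI; apply: open_measurable_mx.
by apply: open_comp => [x _|]; [exact: cg|exact: interval_open].
Qed.

Lemma continuous_measurable_mx2 m n p q (g : 'M[R]_(m, n) -> 'M[R]_(p, q)) :
  continuous g -> measurable_fun setT g.
Proof.
move=> cg; apply: measurable_fun_mx => i j; apply: continuous_measurable_mx.
by move=> x; exact: (cvg_comp _ _ (cg x) (@coord_continuous _ _ _ i j _)).
Qed.

End local_linearization.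

Section jacobian_inequality.
Variables (R : realType) (n : nat) (F : 'rV[R]_n -> 'rV[R]_n).
Hypothesis dF : forall x, differentiable F x.
Hypothesis cJ : continuous (fun x => 'J F x).
Local Notation lambda := (lebesgue_rV R n).
Local Notation absdet x := (`|\det ('J F x)|).

Let cF : continuous F.
Proof. by move=> x; exact: differentiable_continuous. Qed.

Let mF : measurable_fun setT F.
Proof. exact: continuous_measurable_mx2. Qed.

Lemma continuous_absdet : continuous (fun x => absdet x : R).
Proof.
move=> x; have cd : (\det ('J F y)) @[y --> x] --> \det ('J F x).
  exact: (cvg_comp _ _ (@cJ x) (@continuous_det R n _)).
exact: cvg_norm cd.
Qed.

Lemma measurable_absdet : measurable_fun setT (fun x => absdet x : R).
Proof. by apply: continuous_measurable_mx; exact: continuous_absdet. Qed.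

(** The change of variables inequality on subsets of [V], up to a factor [theta]. *)
Definition no_loss (theta : R) (V : set 'rV[R]_n) := forall A Z,
  measurable A -> A `<=` V -> measurable Z ->
  (\int[lambda]_(x in A `&` F @^-1` Z) (absdet x)%:E <= theta%:E * lambda Z)%E.

Lemma scale_preimage_linear (L : 'M[R]_n) Z : L \in unitmx -> measurable Z ->
  (`|\det L|%:E * lambda [set z | Z (z *m L)] = lambda Z)%E.
Proof.
move=> Lu mZ; have mZL : measurable [set z : 'rV[R]_n | Z (z *m L)].
  by rewrite -[X in measurable X]setTI; exact: measurable_mulmxr.
have -> : lambda Z = (\int[lambda]_x (\1_Z x)%:E)%E by rewrite integral_indic// setIT.
have -> : lambda [set z | Z (z *m L)] = (\int[lambda]_x (\1_Z (x *m L))%:E)%E.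
  by rewrite -[in LHS](setIT [set z | _]) -integral_indic.
apply: (scales_volume_unitmx Lu (g := fun x => (\1_Z x)%:E)).
  by apply/measurable_EFinP; exact: measurable_indic.
by move=> x; rewrite lee_fin.
Qed.

(** Choice of the relative error in [no_loss_near]: there, [1 + e] bounds the
    variation of the Jacobian determinant, [(1 - e)^-1] is the expansion constant of
    the rescaled map, and [(1 - 2 * e)^-1] is a constant strictly above it. *)
Lemma near_slack (theta : R) : 1 < theta ->
  \forall e \near (0:R)^'+, e < 2^-1 /\ (1 + e) * ((1 - 2 * e)^-1) ^+ n < theta.
Proof.
move=> t1; near=> e; split; first by near: e; exact: nbhs_right_lt.
near: e.
have : (fun e : R => (1 + e) * ((1 - 2 * e)^-1) ^+ n) @ (0:R)^'+ --> ((1 + 0) * ((1 - 2 * 0)^-1) ^+ n : R).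
  apply: cvg_at_right_filter; apply: cvgM.
    by apply: cvgD; [exact: cvg_cst|exact: cvg_id].
  apply: (@cvg_comp _ _ _ (fun e : R => (1 - 2 * e)^-1) (fun y => y ^+ n) _ _ _ _ (@exprn_continuous _ n _)).
  apply: cvgV; first by rewrite mulr0 subr0 oner_neq0.
  by apply: cvgB; [exact: cvg_cst|apply: cvgMr; exact: cvg_id].
rewrite addr0 mulr0 subr0 invr1 expr1n mulr1.
by move/cvgr_lt; apply.
Unshelve. all: by end_near. Qed.

(** Near a point with invertible derivative [L], the map [H = F *m invmx L] is
    close to the identity, so it nearly expands distances and the volume estimate for
    expanding maps applies to it; the determinant of [L] is restored by the
    linear change of variables. *)
Lemma no_loss_near (theta : R) x0 : 1 < theta -> \det ('J F x0) != 0 ->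
  exists2 r, 0 < r & no_loss theta (ball x0 r).
Proof.
move=> t1 d0; set L := 'J F x0; have Lu : L \in unitmx by rewrite unitmxE unitfE.
have [e [e0 [e12 eth]]] : exists e : R, 0 < e /\
    (e < 2^-1 /\ (1 + e) * ((1 - 2 * e)^-1) ^+ n < theta).
  have : \forall e \near (0:R)^'+, 0 < e /\
    (e < 2^-1 /\ (1 + e) * ((1 - 2 * e)^-1) ^+ n < theta).
    near=> e; split => //; near: e; exact: near_slack.
  by move/filter_ex => [e He]; exists e.
(* The error allowed for F so that the error of H stays below e. *)
pose eta := e / (n%:R * `|invmx L| + 1).
have den0 : 0 < n%:R * `|invmx L| + 1 by rewrite ltr_wpDl// mulr_ge0.
have eta0 : 0 < eta by rewrite divr_gt0.
have lt_det : `|\det L| < (1 + e) * `|\det L|.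
  by rewrite mulrDl mul1r ltrDl mulr_gt0// normr_gt0.
have /nbhs_ballP[r1 /= r10 Hr1] : \forall a \near x0, absdet a < (1 + e) * `|\det L|.
  exact: (cvgr_lt _ (@continuous_absdet x0) _ lt_det).
have [r [r0 [Hlin Hdet]]] : exists r : R, 0 < r /\
   ((forall a b, ball x0 r a -> ball x0 r b ->
    `|F a - F b - (a - b) *m L| <= eta * `|a - b|) /\
    (forall a, ball x0 r a -> absdet a <= (1 + e) * `|\det L|)).
  have : \forall r \near (0:R)^'+, 0 < r /\
   ((forall a b, ball x0 r a -> ball x0 r b ->
    `|F a - F b - (a - b) *m L| <= eta * `|a - b|) /\
    (forall a, ball x0 r a -> absdet a <= (1 + e) * `|\det L|)).
    near=> r; split; first by near: r; exact: nbhs_right_gt.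
    split; first by near: r; exact: (C1_near_linear dF (@cJ x0) eta0).
    move=> a ra; apply: ltW; apply: Hr1; apply: le_ball ra.
    near: r; exact: nbhs_right_le.
  by move/filter_ex => [r Hr]; exists r.
exists r => // A Z mA Ar mZ.
pose H x := F x *m invmx L.
have mH : measurable_fun setT H by exact: (measurableT_comp (measurable_mulmxr (invmx L)) mF).
have e1 : 0 < 1 - e by lra.
have Hexp a b : A a -> A b -> `|a - b| <= (1 - e)^-1 * `|H a - H b|.
  move=> Aa Ab; rewrite mulrC ler_pdivlMr//.
  have HE : H a - H b - (a - b) = (F a - F b - (a - b) *m L) *m invmx L.
    by rewrite mulmxBl mulmxBl mulmxK.
  have h : `|H a - H b - (a - b)| <= e * `|a - b|.
    rewrite HE; apply: (le_trans (norm_mulmx_le _ _)).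
    have := Hlin a b (Ar _ Aa) (Ar _ Ab); set w := `|_| => hw.
    have : w * (n%:R * `|invmx L|) <= eta * `|a - b| * (n%:R * `|invmx L| + 1).
      apply: ler_pM; [exact: normr_ge0|by rewrite mulr_ge0|exact: hw|].
      by rewrite lerDl.
    rewrite /eta mulrAC divfK ?gt_eqF//; apply: le_trans; lra.
  have := ler_normB (H a - H b) (H a - H b - (a - b)).
  rewrite subKr; lra.
have Afin : (lambda A < +oo)%E.
  apply: (@le_lt_trans _ _ (lambda (ball x0 r))).
    by apply: le_measure; rewrite ?inE//; apply: open_measurable_mx; exact: ball_open.
  by rewrite lebesgue_rV_ball// ltry.
pose ZL := [set z : 'rV[R]_n | Z (z *m L)].
have mZL : measurable ZL.
  by rewrite -[X in measurable X]setTI; exact: measurable_mulmxr.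
have preE : F @^-1` Z = H @^-1` ZL.
  by apply/seteqP; split => x /=; rewrite /H /ZL /= mulmxKV.
have mAZ : measurable (A `&` F @^-1` Z).
  by apply: measurableI => //; rewrite -[X in measurable X]setTI; apply: (mF).
apply: (@le_trans _ _ (\int[lambda]_(x in A `&` F @^-1` Z) ((1 + e) * `|\det L|)%:E)%E).
  apply: ge0_le_integral; first exact: mAZ.
  - by move=> x _; rewrite lee_fin.
  - apply/measurable_EFinP; apply: measurable_funTS; exact: measurable_absdet.
  - exact: measurable_cst.
  - by move=> x [Ax _]; rewrite lee_fin; apply: Hdet; exact: Ar.
rewrite integral_cst// preE.
have c12 : 0 < 1 - 2 * e by lra.
have := @lebesgue_rV_expanding _ _ A ZL H (1 - e)^-1 (1 - 2 * e)^-1 mA Afin mH.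
rewrite invr_gt0 ltf_pV2 ?posrE// => /(_ e1).
have -> : 1 - 2 * e < 1 - e by lra.
move=> /(_ isT Hexp mZL) hle.
apply: (@le_trans _ _ (((1 + e) * `|\det L|)%:E * ((1 - 2 * e)^-1 ^+ n)%:E * lambda ZL))%E.
  by rewrite -muleA lee_wpmul2l// lee_fin mulr_ge0// addr_ge0// ltW.
rewrite -EFinM mulrAC EFinM -muleA scale_preimage_linear//.
by rewrite lee_wpmul2r// lee_fin ltW.
Unshelve. all: by end_near. Qed.

End jacobian_inequality.

Section rational_balls.
Variables (R : realType) (n : nat).

(** Rational balls whose closures fit in prescribed balls: closed balls are
    compact, so that the images of the members of the cover are measurable. *)
Lemma countable_ball_base : exists c : nat -> 'rV[R]_n * R,
  forall (x : 'rV[R]_n) (e : R), 0 < e -> exists k,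
    [/\ 0 < (c k).2, ball (c k).1 (c k).2 x &
        closed_ball (c k).1 (c k).2 `<=` ball x e].
Proof.
exists (fun k => if @unpickle ('rV[rat]_n * rat)%type k is Some (z, r)
  then (map_mx ratr z, ratr r) else (0, 0)) => x e e0.
have [r rP] : exists r : rat, ratr r \in `]0, (e / 2)[%R.
  have /rat_in_itvoo[r rP] : 0 < e / 2 by rewrite divr_gt0.
  by exists r.
move: rP; rewrite in_itv /= => /andP[r0 re].
have zP j : exists z : rat, `|x 0 j - ratr z| < ratr r.
  have /rat_in_itvoo[z] : x 0 j - ratr r < x 0 j + ratr r by rewrite ltrD2l gtrN.
  by rewrite in_itv /= => /andP[z1 z2]; exists z; rewrite distrC ltr_distl z1.
pose z : 'rV[rat]_n := \row_j projT1 (cid (zP j)).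
exists (pickle ((z, r) : 'rV[rat]_n * rat)%type); rewrite /= pickleK /=.
have xz : ball (map_mx ratr z : 'rV[R]_n) (ratr r) x.
  split=> // i j; rewrite (ord1 i) mxE mxE /ball /= distrC.
  exact: (projT2 (cid (zP j))).
split => // y; rewrite closed_ballE// /closed_ball_/= => yz.
rewrite -ball_normE/=; apply: (@le_lt_trans _ _ (ratr r + ratr r)); last first.
  by rewrite (splitr e) ltrD.
rewrite -(subrK (map_mx ratr z) x) -addrA; apply: (le_trans (ler_normD _ _)).
rewrite lerD// distrC; move: xz; rewrite -ball_normE/= => /ltW //.
Qed.

End rational_balls.

Section global_inequality.
Variables (R : realType) (n : nat) (F : 'rV[R]_n -> 'rV[R]_n).
Hypothesis dF : forall x, differentiable F x.
Hypothesis cJ : continuous (fun x => 'J F x).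
Hypothesis injF : injective F.
Local Notation lambda := (lebesgue_rV R n).
Local Notation absdet x := (`|\det ('J F x)|).

Let cF : continuous F.
Proof. by move=> x; exact: differentiable_continuous. Qed.

Let mF : measurable_fun setT F.
Proof. exact: continuous_measurable_mx2. Qed.

Let mabsdet : measurable_fun setT (fun x => (absdet x)%:E).
Proof. by apply/measurable_EFinP; exact: measurable_absdet. Qed.

Lemma compact_closed_ball_rV (z : 'rV[R]_n) (r : R) : 0 < r ->
  compact (closed_ball z r).
Proof.
move=> r0; apply: bounded_closed_compact; last exact: closed_ball_closed.
exists (`|z| + r); split; first by rewrite num_real.
move=> M Mz y; rewrite closed_ballE// /closed_ball_/= => zy.
apply: (le_trans _ (ltW Mz)); rewrite -(subrK z y) addrC.
by apply: (le_trans (ler_normD _ _)); rewrite lerD2l distrC.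
Qed.

Lemma measurable_image_closed_ball (z : 'rV[R]_n) (r : R) : 0 < r ->
  measurable (F @` closed_ball z r).
Proof.
move=> r0; apply: closed_measurable_mx; apply: compact_closed.
  exact: norm_hausdorff.
apply: continuous_compact; last exact: compact_closed_ball_rV.
exact: continuous_subspaceT.
Qed.

(** Outside the critical points, countably many closed balls on which
    [no_loss] holds cover the space.  They are made disjoint in the source; their
    images are made disjoint as well, by injectivity, and the local inequalities add
    up. *)
Lemma integral_jacobian_le_slack (theta : R) (Z : set 'rV[R]_n) :
  1 < theta -> measurable Z ->
  (\int[lambda]_(x in F @^-1` Z) (absdet x)%:E <= theta%:E * lambda Z)%E.
Proof.
move=> t1 mZ; have [c cP] := countable_ball_base R n.
pose good k := 0 < (c k).2 /\ no_loss F theta (closed_ball (c k).1 (c k).2).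
pose V k := if pselect (good k) then closed_ball (c k).1 (c k).2 else set0.
have mV k : measurable (V k).
  rewrite /V; case: pselect => g /=; last exact: measurable0.
  by apply: closed_measurable_mx; exact: closed_ball_closed.
have mFV k : measurable (F @` V k).
  rewrite /V; case: pselect => g /=; last by rewrite image_set0.
  by case: g => r0 _; exact: measurable_image_closed_ball.
have goodV k A Y : measurable A -> A `<=` V k -> measurable Y ->
    (\int[lambda]_(x in A `&` F @^-1` Y) (absdet x)%:E <= theta%:E * lambda Y)%E.
  move=> mA AV mY; move: AV; rewrite /V; case: pselect => g /= => [AV|A0].
    by case: g => _; exact.
  have -> : A = set0 by rewrite -subset0.
  by rewrite set0I integral_set0 mule_ge0// lee_fin ltW// (lt_trans ltr01).
have coverU x : absdet x != 0 -> exists k, V k x.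
  rewrite normr_eq0 => d0; have [r r0 rgood] := no_loss_near dF cJ t1 d0.
  have [k [rk ck sub]] := cP x r r0; exists k; rewrite /V; case: pselect => g /=.
    exact: subset_closed_ball ck.
  case: g; split => // A Y mA AV mY; apply: rgood => //; exact: subset_trans sub.
pose D := seqDU V.
have mD k : measurable (D k).
  by apply: measurableD => //; exact: bigsetU_measurable.
have DV k : D k `<=` V k by move=> x [].
pose Y k := F @` V k `\` \big[setU/set0]_(i < k) (F @` V i).
have YE k : Y k = seqDU (fun k => F @` V k) k by [].
have mY k : measurable (Y k).
  by apply: measurableD => //; exact: bigsetU_measurable.
have DY k : D k `<=` F @^-1` Y k.
  move=> x [Vx nVx]; split; first by exists x.
  rewrite -(bigcup_mkord k (fun i => F @` V i)) => -[i /= ik [y Viy /injF yx]]; apply: nVx.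
  by rewrite -bigcup_mkord; exists i => //; rewrite -yx.
have mpre A : measurable A -> measurable (F @^-1` A).
  by move=> mA; rewrite -[X in measurable X]setTI; exact: mF.
pose G k := D k `&` F @^-1` Z.
have mG k : measurable (G k) by apply: measurableI => //; exact: mpre.
have mUG : measurable (\bigcup_k G k) by exact: bigcupT_measurable.
have tG : trivIset setT G by apply: trivIset_setIr; exact: trivIset_seqDU.
have UGsub : \bigcup_k G k `<=` F @^-1` Z by move=> x [k _ []].
apply: (@le_trans _ _ (\int[lambda]_(x in \bigcup_k G k) (absdet x)%:E)%E).
  rewrite [leLHS]integral_mkcond [leRHS]integral_mkcond.
  apply: ge0_le_integral; first exact: measurableT.
  - by move=> x _; rewrite patchE; case: ifP; rewrite ?lee_fin.
  - apply/(measurable_restrictT _ _).1; first exact: mpre.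
    exact: measurable_funTS.
  - apply/(measurable_restrictT _ _).1; first exact: mUG.
    exact: measurable_funTS.
  move=> x _; rewrite !patchE; case: ifPn => [/set_mem Zx|_]; last first.
    by case: ifP; rewrite ?lee_fin.
  case: ifPn => // /negP nG; rewrite lee_fin leNgt; apply/negP => d0.
  apply: nG; rewrite inE; have [k Vk] := coverU x (lt0r_neq0 d0).
  have : (\bigcup_k V k) x by exists k.
  by rewrite seqDU_bigcup_eq => -[i _ Di]; exists i.
rewrite ge0_integral_bigcup//; last by exact: measurable_funTS.
apply: (@le_trans _ _ (\sum_(k <oo) theta%:E * lambda (Z `&` Y k))%E).
  apply: lee_nneseries => [k _ _|k _].
    by apply: integral_ge0 => x _; rewrite lee_fin.
  rewrite (_ : G k = D k `&` F @^-1` (Z `&` Y k)); last first.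
    apply/seteqP; split=> [x [Dx Zx]|x [Dx [Zx _]]]; split => //.
    by split => //; exact: DY.
  by apply: goodV (DV k) _ => //; exact: measurableI.
have th0 : (0 <= theta%:E)%E by rewrite lee_fin ltW// (lt_trans ltr01).
rewrite nneseriesZl//; apply: lee_wpmul2l => //.
have tY : trivIset setT (fun k => Z `&` Y k).
  by apply: trivIset_setIl; exact: trivIset_seqDU.
rewrite -measure_semi_bigcup//; last 2 first.
- by move=> k; exact: measurableI.
- by apply: bigcupT_measurable => k; exact: measurableI.
apply: le_measure; rewrite ?inE//; last by move=> x [k _ []].
by apply: bigcupT_measurable => k; exact: measurableI.
Qed.

Lemma integral_jacobian_le (Z : set 'rV[R]_n) : measurable Z ->
  (\int[lambda]_(x in F @^-1` Z) (absdet x)%:E <= lambda Z)%E.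
Proof.
move=> mZ; have [->|Zfin] := eqVneq (lambda Z) +oo%E; first exact: leey.
have Zfn : lambda Z \is a fin_num by rewrite ge0_fin_numE// ltey.
apply/lee_addgt0Pr => e e0.
have l0 : 0 <= fine (lambda Z) by exact: fine_ge0.
have l1 : 0 < fine (lambda Z) + 1 by rewrite ltr_wpDl.
have t1 : 1 < 1 + e / (fine (lambda Z) + 1) by rewrite ltrDl divr_gt0.
apply: (le_trans (integral_jacobian_le_slack t1 mZ)).
rewrite -[X in (_ * X)%E](fineK Zfn) -[X in (X + _)%E](fineK Zfn) -EFinM -EFinD lee_fin.
rewrite mulrDl mul1r lerD2l mulrAC ler_pdivrMr// ler_pM2l//.
by rewrite lerDl.
Qed.

(** Half of the change of variables formula, with the integral of [g] taken over the
    whole space rather than over the range of [F]. *)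
Lemma integral_comp_jacobian_le (g : 'rV[R]_n -> \bar R) :
  measurable_fun setT g -> (forall y, 0 <= g y)%E ->
  (\int[lambda]_x (g (F x) * (absdet x)%:E) <= \int[lambda]_y g y)%E.
Proof.
move=> mg g0.
have h := @le_integral_weighted _ _ _ _ _ _ R lambda F (fun x => absdet x)
  lambda id (cst 1) mF (measurable_absdet cJ) (fun x => normr_ge0 _)
  (@measurable_id _ _ _) (measurable_cst _) (fun x => ler01).
apply: le_trans (h _ g mg g0) _.
  move=> A mA; have -> : (\int[lambda]_(x in id @^-1` A) (cst 1 x)%:E = lambda A)%E.
    by have := integral_cst lambda mA 1%:E; rewrite mul1e.
  exact: integral_jacobian_le.
by under eq_integral do rewrite mule1.
Qed.

End global_inequality.

Section joint_measurability.
Variables (R : realType) (n p : nat) (d : measure_display) (T : measurableType d).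
Variable f : 'rV[R]_n -> T -> 'rV[R]_p.
Hypothesis mf : measurable_fun setT (fun z : 'rV[R]_n * T => f z.1 z.2).
Hypothesis df : forall v x, differentiable (f ^~ v) x.

(** The entries of the Jacobian matrix are limits of difference quotients, which are
    jointly measurable in the point and in the parameter. *)
Lemma measurable_jacobian :
  measurable_fun setT (fun z : 'rV[R]_n * T => 'J (f ^~ z.2) z.1).
Proof.
apply: measurable_fun_mx => i j.
pose e : 'rV[R]_n := delta_mx 0 i.
pose h k : R := k.+1%:R^-1.
pose D k (z : 'rV[R]_n * T) : R :=
  (h k)^-1 * (f (h k *: e + z.1) z.2 0 j - f z.1 z.2 0 j).
apply: (@measurable_fun_cvg _ _ _ setT D) => //.
  move=> k; apply: measurable_funM => //; apply: measurable_funB.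
    have m1 : measurable_fun setT (fun z : 'rV[R]_n * T => (h k *: e + z.1, z.2)).
      apply/measurable_fun_pairP; split => /=.
        exact: (measurableT_comp (measurable_addmxr (h k *: e)) measurable_fst).
      exact: measurable_snd.
    exact: (measurableT_comp (measurable_coord 0 j) (measurableT_comp mf m1)).
  exact: (measurableT_comp (measurable_coord 0 j) mf).
move=> [y v] _ /=.
have cv := @diff_derivable _ _ _ _ _ e (df v y).
have h0 : h @ \oo --> 0^'.
  move=> A [r /= r0 Ar]; have [N _ HN] := near_infty_natSinv_lt (PosNum r0).
  exists N => // k Nk; apply: Ar => /=.
    by rewrite sub0r normrN ger0_norm ?invr_ge0//; exact: HN.
  by rewrite /h invr_eq0 pnatr_eq0.
have -> : 'J (f^~ v) y i j = ('D_e (f ^~ v) y) 0 j.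
  by rewrite (deriveEjacobian _ (df v y)) /e -rowE [RHS]mxE.
rewrite (_ : (fun k => D k (y, v)) = (fun M : 'rV[R]_p => M 0 j) \o
   (fun t : R => t^-1 *: (((f ^~ v) \o shift y) (t *: e) - f y v)) \o h).
  apply: cvg_comp; first exact: h0.
  exact: (cvg_comp _ _ cv (@coord_continuous _ _ _ 0 j _)).
by apply/funext => k; rewrite /D /= !mxE.
Qed.

End joint_measurability.

Section one_step.
Variables (R : realType) (n : nat).
Variable f : 'rV[R]_n -> 'rV[R]_n -> 'rV[R]_n.
Hypothesis mf : measurable_fun setT (fun z : 'rV[R]_n * 'rV[R]_n => f z.1 z.2).
Hypothesis f_C1 : C1_in_state f.
Hypothesis f_bij : forall v, bijective (f ^~ v).

Definition absjac (y v : 'rV[R]_n) : R := `|\det ('J (f ^~ v) y)|.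

Lemma absjac_ge0 y v : 0 <= absjac y v. Proof. exact: normr_ge0. Qed.

Lemma measurable_absjac :
  measurable_fun setT (fun z : 'rV[R]_n * 'rV[R]_n => absjac z.1 z.2).
Proof.
have mJ : measurable_fun setT (fun z : 'rV[R]_n * 'rV[R]_n => 'J (f ^~ z.2) z.1).
  by apply: measurable_jacobian => // v x; exact: (f_C1 v).1.
have md : measurable_fun setT (fun M : 'M[R]_n => `|\det M|).
  apply: continuous_measurable_mx => M.
  exact: (cvg_norm (@continuous_det _ _ M)).
exact: (measurableT_comp md mJ).
Qed.

Lemma measurable_step (b : 'rV[R]_n) :
  measurable_fun setT (fun z : 'rV[R]_n * 'rV[R]_n => b + f z.1 z.2).
Proof. exact: (measurableT_comp (measurable_addmxr b) mf). Qed.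

(** For each value of the noise this is the change of variables inequality, followed
    by the translation by the control [b]. *)
Lemma integral_step_le (nu : probability 'rV[R]_n R) (b : 'rV[R]_n)
    (g : 'rV[R]_n -> \bar R) :
  measurable_fun setT g -> (forall y, 0 <= g y)%E ->
  (\int[lebesgue_rV R n]_y \int[nu]_v (g (b + f y v)%R * (absjac y v)%:E) <=
   \int[lebesgue_rV R n]_y g y)%E.
Proof.
move=> mg g0.
have mG : measurable_fun setT (fun z : 'rV[R]_n * 'rV[R]_n =>
    (g (b + f z.1 z.2)%R * (absjac z.1 z.2)%:E)%E).
  apply: emeasurable_funM; first exact: (measurableT_comp mg (measurable_step b)).
  by apply/measurable_EFinP; exact: measurable_absjac.
have G0 z : (0 <= g (b + f z.1 z.2)%R * (absjac z.1 z.2)%:E)%E.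
  by rewrite mule_ge0 ?lee_fin ?absjac_ge0.
rewrite (fubini_tonelli (fun z => (g (b + f z.1 z.2)%R * (absjac z.1 z.2)%:E)%E))//=.
apply: (@le_trans _ _ (\int[nu]_v \int[lebesgue_rV R n]_y g y)%E); last first.
  have := integral_cst nu measurableT (\int[lebesgue_rV R n]_y g y)%E.
  by rewrite /cst => ->; rewrite [X in (_ * X)%E]probability_setT mule1.
apply: ge0_le_integral; first exact: measurableT.
- by move=> v _; apply: integral_ge0 => y _; exact: (G0 (y, v)).
- exact: (measurable_fun_fubini_tonelli_G _ mG).
- exact: measurable_cst.
move=> v _; have [dfv cJv] := f_C1 v.
rewrite -(integral_rV_translate b mg g0).
have mg' : measurable_fun setT (fun y : 'rV[R]_n => g (b + y)).
  exact: (measurableT_comp mg (measurable_addmxr b)).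
exact: (@integral_comp_jacobian_le _ _ (f ^~ v) dfv cJv (bij_inj (f_bij v)) _ mg').
Qed.

End one_step.

(** * Finite-valued variables and sub-sigma-algebras *)

(** The inverse is discontinuous at [0], where it is [0] by convention; on each
    side of [0] it is [expR \o -%R \o ln] up to signs. *)
Lemma measurable_invr (R : realType) : measurable_fun setT (fun x : R => x^-1).
Proof.
have -> : (fun x : R => x^-1) = (fun x => if 0 < x then expR (- ln x)
    else if x < 0 then - expR (- ln (- x)) else 0).
  apply/funext => x; have [x0|x0|x0] := ltgtP 0 x; last by rewrite -x0 invr0.
    by rewrite expRN lnK.
  by rewrite expRN lnK ?posrE ?oppr_gt0// invrN opprK.
have mexp (h : R -> R) : measurable_fun setT h -> measurable_fun setT (fun x => expR (h x)).
  by move=> mh; apply: measurableT_comp.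
apply: measurable_fun_ifT; first exact: measurable_fun_ltr.
  by apply: mexp; apply: measurableT_comp.
apply: measurable_fun_ifT; first exact: measurable_fun_ltr.
  apply: measurableT_comp => //; apply: mexp; apply: measurableT_comp => //.
  exact: measurableT_comp.
exact: measurable_cst.
Qed.

Lemma measurable_funV d (T : measurableType d) (R : realType) (h : T -> R) :
  measurable_fun setT h -> measurable_fun setT (fun x => (h x)^-1).
Proof. by move=> mh; exact: (measurableT_comp (@measurable_invr R) mh). Qed.

Section finite_valued.
Variables (R : realType) (d : measure_display) (T : measurableType d).

Lemma measurable_finite_preimage (A : finType) (h : T -> A) (D : set A) :
  (forall a, measurable (h @^-1` [set a])) -> measurable (h @^-1` D).
Proof.
move=> mh; rewrite (_ : h @^-1` D = \bigcup_(a in D) h @^-1` [set a]).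
  by apply: fin_bigcup_measurable => [|a _]; [exact: finite_finset|exact: mh].
by apply/seteqP; split => [x Dx|x [a Da /= ->]]//; exists (h x).
Qed.

Lemma measurable_finite_comp (A : finType) (h : T -> A) (d' : measure_display)
    (T' : measurableType d') (phi : A -> T') :
  (forall a, measurable (h @^-1` [set a])) -> measurable_fun setT (fun x => phi (h x)).
Proof.
move=> mh _ B _; rewrite setTI.
exact: (@measurable_finite_preimage _ h (phi @^-1` B)).
Qed.

Lemma measurable_history (A : finType) (h : nat -> T -> A) t :
  (forall i, (i < t)%N -> forall a, measurable (h i @^-1` [set a])) ->
  forall a, measurable (history h t @^-1` [set a]).
Proof.
move=> mh a; rewrite (_ : _ @^-1` _ = \bigcap_(i in [set: 'I_t]) (h i @^-1` [set tnth a i])).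
  apply: fin_bigcap_measurable => [|i _]; [exact: finite_finset|exact: mh].
apply/seteqP; split=> [x <- i _|x xa]; first by rewrite /= tnth_mktuple.
by apply: eq_from_tnth => i; rewrite tnth_mktuple; exact: xa.
Qed.

End finite_valued.

Section history_theory.
Variables (Omega T : Type) (X : nat -> Omega -> T).

Lemma val_history t o : history X t o = [seq X k o | k <- iota 0 t] :> seq T.
Proof. by rewrite /= -val_enum_ord -map_comp. Qed.

Lemma history_rcons t o :
  history X t.+1 o = [tuple of rcons (history X t o) (X t o)].
Proof.
apply: val_inj.
change (tval (history X t.+1 o) = rcons (tval (history X t o)) (X t o)).
by rewrite !val_history -addn1 iotaD map_cat cats1.
Qed.

Lemma tnth_history t o (i : 'I_t) : tnth (history X t o) i = X i o.
Proof. exact: tnth_mktuple. Qed.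

End history_theory.

Section sub_sigma_algebra.
Local Open Scope ereal_scope.
Variables (d : measure_display) (Omega : measurableType d) (R : realType).
Variable P : probability Omega R.
Variable G : set (set Omega).
Hypothesis Gm : G `<=` measurable.
Local Notation OmegaG := (g_sigma_algebraType G).

Lemma measurable_sub_sigma : measurable_fun [set: Omega] (fun o => o : OmegaG).
Proof.
move=> _ A mA; rewrite setTI; exact: (smallest_sub (@sigma_algebra_measurable _ _) Gm).
Qed.

(** Two weights with the same conditional expectation given [<<s G >>] are
    interchangeable in integrals of [<<s G >>]-measurable functions. *)
Lemma eq_integral_sub_sigma (phi phi' : Omega -> R) :
  measurable_fun setT phi -> (forall o, (0 <= phi o)%R) ->
  measurable_fun setT phi' -> (forall o, (0 <= phi' o)%R) ->
  (forall A, <<s G >> A ->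
    \int[P]_(o in A) (phi o)%:E = \int[P]_(o in A) (phi' o)%:E) ->
  forall g : OmegaG -> \bar R, measurable_fun [set: OmegaG] g -> (forall o, 0 <= g o) ->
  \int[P]_o (g o * (phi o)%:E) = \int[P]_o (g o * (phi' o)%:E).
Proof.
move=> mphi phi0 mphi' phi0' eqs g mg g0.
exact: (@eq_integral_weighted _ _ _ _ _ OmegaG R P (fun o => o) phi P
  (fun o => o) phi' measurable_sub_sigma mphi phi0 measurable_sub_sigma mphi' phi0').
Qed.

Section independent_factor.
Variables (dV : measure_display) (V : measurableType dV) (W : Omega -> V).
Variable nu : probability V R.
Hypothesis mW : measurable_fun setT W.
Hypothesis indep : forall A C, <<s G >> A -> measurable C ->
  P (A `&` W @^-1` C) = P A * nu C.

(** Fubini for a variable [W] independent of a sub-sigma-algebra: the law of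
    [(id, W)] on [OmegaG * V] is a product measure. *)
Lemma integral_independent (psi : OmegaG * V -> \bar R) :
  measurable_fun [set: OmegaG * V] psi -> (forall z, 0 <= psi z) ->
  \int[P]_o psi (o, W o) = \int[P]_o \int[nu]_v psi (o, v).
Proof.
move=> mpsi psi0.
pose PG := pushforward P (fun o => o : OmegaG) : {measure set OmegaG -> \bar R}.
have PG_fin : fin_num_fun (PG measurable_sub_sigma).
  apply: lty_fin_num_fun; suff : P setT < +oo by [].
  by rewrite probability_setT ltry.
pose PG' : {finite_measure set OmegaG -> \bar R} :=
  HB.pack (Measure.sort (PG measurable_sub_sigma))
    (Measure_isFinite.Build _ _ _ (PG measurable_sub_sigma) PG_fin).
have mk : measurable_fun [set: Omega] (fun o => (o : OmegaG, W o)).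
  by apply/measurable_fun_pairP; split => //; exact: measurable_sub_sigma.
pose Q := pushforward P (fun o => (o : OmegaG, W o)) :
  {measure set (OmegaG * V) -> \bar R}.
have QE : forall X, measurable X -> (PG' \x nu) X = Q mk X.
  by apply: product_measure_unique => A C mA mC; rewrite -indep.
transitivity (\int[Q mk]_z psi z).
  by rewrite ge0_integral_pushforward.
transitivity (\int[PG' \x nu]_z psi z).
  by apply: eq_measure_integral => X mX _; rewrite -QE.
rewrite fubini_tonelli1//.
transitivity (\int[PG measurable_sub_sigma]_o \int[nu]_v psi (o, v)) => //.
rewrite ge0_integral_pushforward//.
- exact: measurable_sub_sigma.
- exact: (measurable_fun_fubini_tonelli_F _ mpsi).
- by move=> o _; exact: integral_ge0.
Qed.

End independent_factor.
End sub_sigma_algebra.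

Section discrete_expectation.
Variables (d : measure_display) (Omega : measurableType d) (R : realType).
Variable P : probability Omega R.
Variables (A : finType) (h : Omega -> A).
Hypothesis mh : forall a, measurable (h @^-1` [set a]).

Lemma integrable_finite_comp (phi : A -> R) :
  P.-integrable setT (EFin \o (fun o => phi (h o))).
Proof.
apply: measurable_bounded_integrable => //.
- by rewrite [X in (X < _)%E]probability_setT ltry.
- exact: measurable_finite_comp.
exists (\sum_a `|phi a|); split; first by rewrite num_real.
move=> r rM o _; apply: le_trans (ltW rM).
by rewrite (bigD1 (h o))//= lerDl sumr_ge0.
Qed.

Lemma Rintegral_finite_comp (phi : A -> R) :
  \int[P]_o phi (h o) = \sum_a Defs.pmf P h a * phi a.
Proof.
have ind a : P.-integrable setT (EFin \o (fun o => phi a * \1_(h @^-1` [set a]) o)).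
  have := integrable_finite_comp (fun a' => phi a * (a' == a)%:R).
  apply: eq_integrable => // o _ /=; rewrite indicE; congr (_ * _%:R)%:E.
  by congr nat_of_bool; apply/eqP/idP; rewrite inE.
transitivity (\int[P]_o (\sum_a phi a * \1_(h @^-1` [set a]) o)).
  apply: eq_Rintegral => o _; rewrite (bigD1 (h o))//= big1 ?addr0.
    by rewrite indicE mem_set ?mulr1.
  by move=> a ah; rewrite indicE memNset ?mulr0//= => /esym/eqP; exact/negP.
rewrite /Rintegral; under eq_integral do rewrite -sumEFin.
rewrite integral_sum; [|exact: measurableT|exact: ind].
rewrite -[RHS]/(fine (_%:E)) -sumEFin; congr fine; apply: eq_bigr => a _.
under eq_integral do rewrite EFinM.
rewrite integralZl//; last first.
  have := integrable_finite_comp (fun a' => (a' == a)%:R).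
  apply: eq_integrable => // o _ /=; rewrite indicE; congr (_%:R)%:E.
  by congr nat_of_bool; apply/eqP/idP; rewrite inE.
rewrite integral_indic//.
by rewrite setIT mulrC EFinM /Defs.pmf fineK//; exact: fin_num_measure.
Qed.

End discrete_expectation.

(** * Signed integrals and their positive and negative parts *)

Lemma max0_split (R : realDomainType) (r : R) : Num.max 0 r = r + Num.max 0 (- r).
Proof. by case: (leP 0 r) => ?; case: (leP 0 (- r)) => ?; lra. Qed.

Lemma integral_posneg d (V : measurableType d) (R : realType)
    (nu : {measure set V -> \bar R}) (psi : V -> R) : (\int[nu]_v (psi v)%:E =
  \int[nu]_v (Num.max 0 (psi v))%:E - \int[nu]_v (Num.max 0 (- psi v))%:E)%E.
Proof.
rewrite integralE; congr (_ - _)%E; apply: eq_integral => v _.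
  by rewrite funeposE -EFin_max maxC.
by rewrite funenegE -EFinN -EFin_max maxC.
Qed.

Section partial_expectation.
Local Open Scope ereal_scope.
Variables (d : measure_display) (V : measurableType d) (R : realType).
Variable nu : probability V R.
Variable psi : V -> R.
Hypothesis mpsi : measurable_fun setT psi.

Let mE (h : V -> R) : measurable_fun setT h -> measurable_fun setT (EFin \o h).
Proof. by move=> mh; apply/measurable_EFinP. Qed.

Let mpos : measurable_fun setT (fun v => (Num.max 0 (psi v))%R).
Proof. exact: measurable_maxr. Qed.

Let mneg : measurable_fun setT (fun v => (Num.max 0 (- psi v))%R).
Proof. by apply: measurable_maxr => //; exact: measurableT_comp. Qed.

Let posneg : \int[nu]_v (psi v)%:E =
  \int[nu]_v (Num.max 0 (psi v))%:E - \int[nu]_v (Num.max 0 (- psi v))%:E.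
Proof. exact: integral_posneg. Qed.

Let pos0 : 0 <= \int[nu]_v (Num.max 0 (psi v))%:E.
Proof. by apply: integral_ge0 => v _; rewrite lee_fin le_max lexx. Qed.

Let neg0 : 0 <= \int[nu]_v (Num.max 0 (- psi v))%:E.
Proof. by apply: integral_ge0 => v _; rewrite lee_fin le_max lexx. Qed.

(** An extended-real mean that is not [-oo] controls the negative part by the
    positive part; the convention [+oo - +oo = -oo] makes the bound unconditional. *)
Lemma neg_part_le : \int[nu]_v (Num.max 0 (- psi v))%:E <=
  maxe (- \int[nu]_v (psi v)%:E) 0 + \int[nu]_v (Num.max 0 (psi v))%:E.
Proof.
rewrite posneg; move: pos0 neg0.
set a := \int[nu]_v _; set b := \int[nu]_v _.
case: a => [a| |] // a0 b0; last by rewrite addey ?leey// gt_eqF// lt_max ltNy0 orbT.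
case: b b0 => [b| |] // b0.
move: a0 b0; rewrite -EFinB -EFinN -EFin_max -EFinD !lee_fin => a0 b0.
by case: (leP (- (a - b)) 0)%R => ?; lra.
Qed.

(** With [m] the mean of [psi]: [c - m^- <= c + m <= \int (c + psi)^+], where
    [psi] is allowed to be non-integrable. *)
Lemma shift_le (c : R) : c%:E <=
  \int[nu]_v (Num.max 0 (c + psi v))%:E + maxe (- \int[nu]_v (psi v)%:E) 0.
Proof.
have mcp : measurable_fun setT (fun v => (Num.max 0 (c + psi v))%R).
  by apply: measurable_maxr => //; exact: measurable_funD.
have c0 : 0 <= \int[nu]_v (Num.max 0 (c + psi v))%:E.
  by apply: integral_ge0 => v _; rewrite lee_fin le_max lexx.
have n0 : 0 <= maxe (- \int[nu]_v (psi v)%:E) 0 by rewrite le_max lexx orbT.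
have key : (Num.max 0 c)%R%:E + \int[nu]_v (Num.max 0 (psi v))%:E <=
    (Num.max 0 (- c))%R%:E + (\int[nu]_v (Num.max 0 (c + psi v))%:E +
    \int[nu]_v (Num.max 0 (- psi v))%:E).
  have cst_int (r : R) : r%:E = \int[nu]_v (cst r v)%:E.
    have := integral_cst nu measurableT r%:E.
    by rewrite [X in _ * X]probability_setT mule1.
  have max_ge0 (r : R) : (0 <= Num.max 0 r)%R by rewrite le_max lexx.
  rewrite (cst_int (Num.max 0 c)%R) (cst_int (Num.max 0 (- c))%R).
  rewrite -!ge0_integralD//;
    try (by move=> v _; rewrite ?adde_ge0 ?lee_fin; try exact: max_ge0);
    try (by apply: emeasurable_funD; exact: mE); try exact: mE.
  apply: ge0_le_integral => //.
  - by move=> v _; rewrite adde_ge0 ?lee_fin//; exact: max_ge0.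
  - by apply: emeasurable_funD; exact: mE.
  - by apply: emeasurable_funD; [exact: mE|apply: emeasurable_funD; exact: mE].
  move=> v _; rewrite -!EFinD lee_fin /=.
  have le_max0 : (c + psi v <= Num.max 0 (c + psi v))%R by rewrite le_max lexx orbT.
  by rewrite (max0_split c) (max0_split (psi v)); lra.
move: key c0 n0 pos0 neg0; rewrite posneg.
set A := \int[nu]_v (Num.max 0 (c + psi v))%:E.
set p := \int[nu]_v (Num.max 0 (psi v))%:E.
set n := \int[nu]_v (Num.max 0 (- psi v))%:E.
case: A => [a| |] //; last by move=> _ _ n0 _ _; rewrite addye ?leey// gt_eqF// (lt_le_trans _ n0).
case: n => [b| |] //; last first.
  by move=> _ _ _ p0 _; rewrite [X in maxe X _](_ : _ = +oo) ?maxye ?leey//; case: p p0.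
case: p => [p| |] //.
rewrite -!EFinD -EFinN -EFin_max -EFinD !lee_fin => key _ _ _ _.
have le_max0 : (- (p - b) <= Num.max (- (p - b)) 0)%R by rewrite le_max lexx.
by move: key; rewrite (max0_split c); lra.
Qed.

End partial_expectation.

Section integral_neqNy.
Local Open Scope ereal_scope.
Variables (d : measure_display) (T : measurableType d) (R : realType).
Variable mu : {measure set T -> \bar R}.

Lemma integral_neqNy (h : T -> \bar R) : measurable_fun setT h ->
  \int[mu]_x h x != -oo ->
  \int[mu]_x h^\- x < +oo /\ {ae mu, forall x, h x != -oo}.
Proof.
move=> mh hN.
have negfin : \int[mu]_x h^\- x < +oo.
  rewrite ltey; apply: contra_neq hN => hy.
  by rewrite integralE hy addeNy.
split => //.
have ineg : mu.-integrable setT h^\-.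
  apply/integrableP; split; first exact: measurable_funeneg.
  by under eq_integral do rewrite gee0_abs//.
have := integrable_ae measurableT ineg.
apply: filterS => x /(_ I); apply: contraTneq => hx.
by rewrite funenegE hx max_l ?leey.
Qed.

Lemma integral0_measure0 (h : T -> R) : measurable_fun setT h ->
  (forall x, (0 <= h x)%R) -> \int[mu]_x (h x)%:E = 0 ->
  {ae mu, forall x, h x = 0%R}.
Proof.
move=> mh h0 ih.
have : ae_eq mu setT (EFin \o h) (cst 0).
  apply/ae_eq_integral_abs => //; first exact/measurable_EFinP.
  by under eq_integral do rewrite gee0_abs ?lee_fin//.
by apply: filterS => x /(_ I) /= [].
Qed.

Lemma ae_notin (A : set T) : measurable A -> mu A = 0 ->
  {ae mu, forall x, ~ A x}.
Proof. by move=> mA A0; exists A; split => // x /contrapT. Qed.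

Lemma measure0_ae (A : set T) : measurable A -> {ae mu, forall x, ~ A x} ->
  mu A = 0.
Proof.
move=> mA [B [mB B0 AB]]; apply: (subset_measure0 mA mB _ B0).
by move=> x Ax; apply: AB => /=; exact.
Qed.

End integral_neqNy.

Lemma integral_distribution d (T : measurableType d) (R : realType)
    (P : probability T R) d' (V : measurableType d') (X : {RV P >-> V})
    (h : V -> \bar R) : measurable_fun setT h ->
  (\int[distribution P X]_y h y = \int[P]_o h (X o))%E.
Proof.
move=> mh; rewrite integralE [RHS]integralE; congr (_ - _)%E.
  rewrite /distribution ge0_integral_pushforward//; last exact: measurable_funepos.
  by rewrite preimage_setT; apply: eq_integral => o _; rewrite /= !funeposE.
rewrite /distribution ge0_integral_pushforward//; last exact: measurable_funeneg.
by rewrite preimage_setT; apply: eq_integral => o _; rewrite /= !funenegE.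
Qed.

(** * Densities, entropy and logarithms *)

Section density.
Variables (d : measure_display) (Omega : measurableType d) (R : realType) (N : nat).
Variables (P : probability Omega R) (X : {RV P >-> 'rV[R]_N}).

Lemma integral_density p (h : 'rV[R]_N -> \bar R) :
  is_density X p -> measurable_fun setT h -> (forall y, 0 <= h y)%E ->
  (\int[P]_o h (X o) = \int[lebesgue_rV R N]_y (h y * (p y)%:E))%E.
Proof.
move=> [mp pge0 pE] mh h0.
rewrite -(@eq_integral_weighted _ _ _ _ _ _ R P X (cst 1) _ id p)//; last first.
  move=> A mA; rewrite [LHS](integral_cst P _ 1%:E).
    by rewrite mul1e [LHS](_ : _ = distribution P X A)// pE.
  by rewrite -[X in measurable X]setTI; exact: measurable_funPT.
by apply: eq_integral => o _; rewrite mule1.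
Qed.

Lemma integral_density1 p : is_density X p ->
  (\int[lebesgue_rV R N]_y (p y)%:E = 1)%E.
Proof.
by move=> [_ _ pE]; rewrite -pE; [exact: probability_setT|exact: measurableT].
Qed.

Lemma density_gt0 p : is_density X p -> {ae P, forall o, 0 < p (X o)}.
Proof.
move=> [mp p0 pE]; pose A := [set y | p y = 0].
have mA : measurable A by have := mp measurableT _ (measurable_set1 (0 : R)); rewrite setTI.
have mXA : measurable (X @^-1` A).
  by rewrite -[X in measurable X]setTI; exact: measurable_funPT.
have PA : P (X @^-1` A) = 0%E.
  rewrite [LHS](_ : _ = distribution P X A)// pE// (eq_integral (cst 0%E)).
    exact: integral0.
  by move=> y /set_mem/= ->.
apply: filterS (ae_notin mXA PA) => o nA; rewrite lt0r p0 andbT.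
by apply/eqP.
Qed.

Lemma measurable_log2 : measurable_fun setT (@log2 R).
Proof. by apply: measurable_funM => //; exact: measurable_cst. Qed.

Lemma measurable_log2_density p : is_density X p ->
  measurable_fun setT (fun o => log2 (p (X o))).
Proof.
move=> [mp _ _]; apply: (measurableT_comp measurable_log2).
by apply: (measurableT_comp mp); exact: measurable_funPT.
Qed.

Let integral_density_part p (c : R) : is_density X p ->
  (\int[P]_o (Num.max 0 (c * log2 (p (X o))))%:E =
   \int[lebesgue_rV R N]_y (Num.max 0 (c * (p y * log2 (p y))))%:E)%E.
Proof.
move=> pX; have [mp p0 _] := pX.
pose h y : \bar R := (Num.max 0 (c * log2 (p y)))%:E.
rewrite [LHS](@integral_density p h pX).
- apply: eq_integral => y _; rewrite /h -EFinM maxr_pMl// mul0r.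
  by rewrite -mulrA [log2 _ * _]mulrC.
- apply/measurable_EFinP; apply: measurable_maxr => //.
  apply: measurable_funM => //; exact: (measurableT_comp measurable_log2 mp).
- by move=> y; rewrite lee_fin le_max lexx.
Qed.

(** Valid whether or not the entropy is finite, since both sides are split into
    the same positive and negative parts. *)
Lemma density_entropyE p : is_density X p ->
  (density_entropy p = - \int[P]_o (log2 (p (X o)))%:E)%E.
Proof.
move=> pX; rewrite /density_entropy [in LHS]integral_posneg [in RHS]integral_posneg.
congr (- (_ - _))%E.
  transitivity (\int[P]_o (Num.max 0 (1 * log2 (p (X o))))%:E)%E.
    by rewrite integral_density_part//; apply: eq_integral => y _; rewrite mul1r.
  by apply: eq_integral => y _; rewrite mul1r.
transitivity (\int[P]_o (Num.max 0 (-1 * log2 (p (X o))))%:E)%E.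
  by rewrite integral_density_part//; apply: eq_integral => y _; rewrite mulN1r.
by apply: eq_integral => y _; rewrite mulN1r.
Qed.

(** The negative part of [log2 (p X)] enters the entropy positively; were it to have
    an infinite mean, the convention [+oo - +oo = -oo] would make the entropy [+oo]. *)
Lemma density_entropy_lty p : is_density X p -> (density_entropy p < +oo)%E ->
  (\int[P]_o (Num.max 0 (- log2 (p (X o))))%:E < +oo)%E.
Proof.
move=> pX; rewrite density_entropyE// integral_posneg !ltey; apply: contra_neq.
by move=> ->; rewrite addeNy.
Qed.

Lemma diff_entropy_density : (exists p, is_density X p) ->
  exists2 p, is_density X p & diff_entropy X = density_entropy p.
Proof.
rewrite /diff_entropy; case: pselect => // ex _.
by exists (projT1 (cid ex)) => //; exact: projT2 (cid ex).
Qed.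

Lemma diff_entropy_neqNy : diff_entropy X != -oo%E -> exists p, is_density X p.
Proof. by rewrite /diff_entropy; case: pselect. Qed.

Lemma dominated_density : distribution P X `<< lebesgue_rV R N ->
  exists p, is_density X p.
Proof.
move=> /radon_nikodym_sigma_finite[p [p0 pfin pint pE]].
exists (fine \o p); split.
- by apply: measurableT_comp => //; exact: measurable_int pint.
- by move=> y; exact: fine_ge0.
- by move=> A mA; rewrite pE//; apply: eq_integral => y _ /=; rewrite fineK.
Qed.

End density.

Section integrability.
Variables (d : measure_display) (T : measurableType d) (R : realType).
Variable mu : {measure set T -> \bar R}.

Lemma ae_forall (I : finType) (Q : I -> T -> Prop) :
  (forall i, {ae mu, forall x, Q i x}) -> {ae mu, forall x, forall i, Q i x}.
Proof. by move=> h; have := @filter_forall _ _ Q _ _ h; exact. Qed.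

Lemma integrable_posneg (h : T -> R) : measurable_fun setT h ->
  (\int[mu]_x (Num.max 0 (h x))%:E < +oo)%E ->
  (\int[mu]_x (Num.max 0 (- h x))%:E < +oo)%E ->
  mu.-integrable setT (EFin \o h).
Proof.
move=> mh posfin negfin; apply/integrableP; split; first exact/measurable_EFinP.
rewrite (eq_integral (fun x => (Num.max 0 (h x))%:E + (Num.max 0 (- h x))%:E)%E); last first.
  move=> x _; rewrite /= -EFinD; congr (_%:E).
  by have [h0|h0] := leP 0 (h x); [rewrite ger0_norm//|rewrite ltr0_norm//];
    case: (leP 0 (- h x)) => ?; lra.
rewrite ge0_integralD//; first exact: lte_add_pinfty.
- by move=> x _; rewrite lee_fin le_max lexx.
- by apply/measurable_EFinP; exact: measurable_maxr.
- by move=> x _; rewrite lee_fin le_max lexx.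
- by apply/measurable_EFinP; apply: measurable_maxr => //; exact: measurableT_comp.
Qed.

Lemma integral_pos_lty (h : T -> R) (b : T -> \bar R) : measurable_fun setT h ->
  measurable_fun setT b -> (forall x, 0 <= b x)%E ->
  {ae mu, forall x, (h x)%:E <= b x}%E -> (\int[mu]_x b x < +oo)%E ->
  (\int[mu]_x (Num.max 0 (h x))%:E < +oo)%E.
Proof.
move=> mh mb b0 hb; apply: le_lt_trans; apply: ae_ge0_le_integral => //.
- by move=> x _; rewrite lee_fin le_max lexx.
- by apply/measurable_EFinP; exact: measurable_maxr.
- by apply: filterS hb => x hbx _; rewrite EFin_max ge_max b0.
Qed.

Lemma ae_le_integral (f g : T -> R) : mu.-integrable setT (EFin \o f) ->
  mu.-integrable setT (EFin \o g) -> {ae mu, forall x, f x <= g x} ->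
  (\int[mu]_x (f x)%:E <= \int[mu]_x (g x)%:E)%E.
Proof.
move=> intf intg fg.
have mf : measurable_fun setT f by apply/measurable_EFinP; exact: measurable_int intf.
have mg : measurable_fun setT g by apply/measurable_EFinP; exact: measurable_int intg.
have fin : (\int[mu]_x (f x)%:E)%E \is a fin_num by exact: integrable_fin_num intf.
rewrite -sube_ge0; last by rewrite fin.
rewrite -(integralB measurableT intg intf).
rewrite (ae_eq_integral (fun x => (Num.max 0 (g x - f x))%:E))//.
- by apply: integral_ge0 => x _; rewrite lee_fin le_max lexx.
- by apply/measurable_EFinP; exact: measurable_funB.
- by apply/measurable_EFinP; apply: measurable_maxr => //; exact: measurable_funB.
- by apply: filterS fg => x fgx _; rewrite /= -EFinB max_r// subr_ge0.
Qed.

End integrability.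

Section logarithm.
Variable R : realType.

Lemma ln2_gt0 : 0 < ln 2 :> R. Proof. by rewrite ln_gt0// ltr1n. Qed.

Lemma log2M (a b : R) : 0 < a -> 0 < b -> log2 (a * b) = log2 a + log2 b.
Proof. by move=> a0 b0; rewrite /log2 lnM ?posrE// mulrDl. Qed.

Lemma log2V (a : R) : 0 < a -> log2 a^-1 = - log2 a.
Proof. by move=> a0; rewrite /log2 lnV ?posrE// mulNr. Qed.

Lemma log2_prod (I : finType) (F : I -> R) : (forall i, 0 <= F i) ->
  0 < \prod_i F i -> log2 (\prod_i F i) = \sum_i log2 (F i).
Proof.
move=> F0 /lt0r_neq0/prodf_neq0 Fn0.
have [] // : 0 < \prod_i F i /\ log2 (\prod_i F i) = \sum_i log2 (F i).
apply: (big_ind2 (fun a b => 0 < a /\ log2 a = b)).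
- by rewrite /log2 ln1 mul0r.
- by move=> a b a' b' [a0 <-] [a'0 <-]; rewrite mulr_gt0// log2M.
- by move=> i _; rewrite lt0r F0 Fn0.
Qed.

Lemma log2_le_sub1 (a : R) : 0 < a -> log2 a <= (ln 2)^-1 * (a - 1).
Proof.
move=> a0; rewrite /log2 mulrC ler_pM2l ?invr_gt0 ?ln2_gt0//.
by rewrite -{1}[a](subrKC 1) le_ln1Dx// ltrBrDl addrN.
Qed.

(** Through [log2_le_sub1], this is the Gibbs inequality [E log2 Z <= 0], in a form
    that does not presuppose the integrability of [log2 Z]. *)
Lemma integral_log_bound d (T : measurableType d) (P : probability T R) (Z : T -> R) :
  measurable_fun setT Z -> (forall o, 0 <= Z o) -> (\int[P]_o (Z o)%:E <= 1)%E ->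
  let b o := (ln 2)^-1 * (Z o - 1) in
  P.-integrable setT (EFin \o b) /\ (\int[P]_o (b o)%:E <= 0)%E.
Proof.
move=> mZ Z0 Z1 b.
have iZ : P.-integrable setT (EFin \o Z).
  apply/integrableP; split; first exact/measurable_EFinP.
  rewrite (eq_integral (EFin \o Z)); last by move=> o _; rewrite /= ger0_norm.
  by apply: le_lt_trans Z1 _; exact: ltry.
have i1 : P.-integrable setT (EFin \o cst 1).
  by apply: finite_measure_integrable_cst.
have iB : P.-integrable setT (fun o => (Z o)%:E - 1%:E)%E by exact: integrableB.
have bE o : (b o)%:E = ((ln 2)^-1%:E * ((Z o)%:E - 1%:E))%E by [].
split.
  rewrite (_ : EFin \o b = (fun o => (ln 2)^-1%:E * ((Z o)%:E - 1%:E))%E)//.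
  exact: integrableZl.
under eq_integral do rewrite bE.
rewrite integralZl// integralB// (integral_cst P measurableT 1%E).
rewrite [X in (1 * X)%E]probability_setT mule1.
rewrite mule_ge0_le0 ?sube_le0//.
by rewrite lee_fin invr_ge0 ltW// ln2_gt0.
Qed.

End logarithm.

(** * Limits superior *)

Section limsup.
Local Open Scope ereal_scope.
Variable R : realType.
Implicit Types u v : (\bar R)^nat.

Lemma limn_esup_le_near u (c : \bar R) :
  (\forall n \near \oo, u n <= c) -> limn_esup u <= c.
Proof.
move=> [n0 _ uc]; rewrite limn_esup_lim; apply: lime_le; first exact: is_cvg_esups.
exists n0 => // n n0n; apply: ge_ereal_sup => _ [k /= nk <-].
by apply: uc => /=; exact: leq_trans n0n nk.
Qed.

Lemma near_lt_limn_esup u (c : \bar R) :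
  limn_esup u < c -> \forall n \near \oo, u n < c.
Proof.
rewrite limn_esup_lim (cvg_lim _ (@cvg_esups_inf _ u))//.
move=> /ereal_inf_lt[_ [n0 _ <-] uc]; exists n0 => // n n0n.
by apply: le_lt_trans uc; apply: ereal_sup_ubound; exists n.
Qed.

(** A real number [c] above the limit of [v] is eventually above [v n + e] for small
    [e], hence above [u n]; letting [c] vary also covers infinite limits. *)
Lemma limn_esup_le u v :
  (forall e : R, (0 < e)%R -> \forall n \near \oo, u n <= v n + e%:E) ->
  limn_esup u <= limn_esup v.
Proof.
move=> uv.
have below (c : R) : limn_esup v < c%:E -> limn_esup u <= c%:E.
  move=> vc; have [e e0 ve] : exists2 e : R, (0 < e)%R & limn_esup v < (c - e)%:E.
    move: vc; case: (limn_esup v) => [r| |]//.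
      rewrite lte_fin => rc; exists ((c - r) / 2)%R; first by rewrite divr_gt0// subr_gt0.
      by rewrite lte_fin; lra.
    by exists 1%R => //; rewrite ltNyr.
  apply: limn_esup_le_near.
  apply: filterS2 (uv e e0) (near_lt_limn_esup ve) => n un vn.
  apply: le_trans un _; rewrite -[leRHS](@subeK _ _ e%:E)// leeD2r//.
  by rewrite -EFinB ltW.
case vE : (limn_esup v) below => [r| |] below; last 2 first.
- exact: leey.
- apply: contraT; rewrite -ltNge; case uE : (limn_esup u) => [r| |]// _.
    by have := below (r - 1)%R (ltNyr _); rewrite uE lee_fin; lra.
  by have := below 0%R (ltNyr _); rewrite uE.
apply/lee_addgt0Pr => e e0; rewrite -EFinD; apply: below.
by rewrite lte_fin ltrDl.
Qed.

End limsup.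

(** * The past of the closed loop *)

Section filtration.
Variables (d : measure_display) (Omega : measurableType d) (R : realType).
Variable P : probability Omega R.
Variables (N s : nat) (M M' : finType).
Variables (f : 'rV[R]_N -> 'rV[R]_N -> 'rV[R]_N) (B : 'M[R]_(N, s)).
Variable nu : probability 'rV[R]_N R.
Variables (K : channel R M M') (gamma : policy R N s M M').
Variables (x w : nat -> {RV P >-> 'rV[R]_N}) (u : nat -> Omega -> 'rV[R]_s).
Variables (q : nat -> Omega -> M) (q' : nat -> Omega -> M').
Hypothesis f_borel : measurable_fun [set: 'rV[R]_N * 'rV[R]_N] (fun z => f z.1 z.2).
Hypothesis noise : iid_noise (x 0%N) w nu.
Hypothesis loop : closed_loop f B K gamma x w u q q'.

(** The past before time [t] is generated by [x 0], the [w i] and the [q' i]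
    with [i < t].  The recursion makes each generating family a pi-system, on which
    the independence of the future noise is proved by induction. *)
Fixpoint past_gen (t : nat) : set (set Omega) :=
  if t is t'.+1 then
    [set E | exists E0 C D, [/\ <<s past_gen t' >> E0, measurable C &
      E = E0 `&` w t' @^-1` C `&` q' t' @^-1` D]]
  else [set E | exists2 A, measurable A & E = x 0%N @^-1` A].

Notation past t := (g_sigma_algebraType (past_gen t)).

Lemma measurable_q' t D : measurable (q' t @^-1` D).
Proof. by apply: measurable_finite_preimage => a; exact: measurable_output loop _ _. Qed.

Lemma past_gen_measurable t : past_gen t `<=` measurable.
Proof.
elim: t => [|t IH] E /=.
  by move=> [A mA ->]; rewrite -[X in measurable X]setTI; exact: measurable_funPT.
move=> [E0 [C [D [sE0 mC ->]]]]; apply: measurableI; last exact: measurable_q'.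
apply: measurableI; first exact: (smallest_sub (@sigma_algebra_measurable _ _) IH).
by rewrite -[X in measurable X]setTI; exact: measurable_funPT.
Qed.

Lemma past_measurable t (E : set (past t)) :
  measurable E -> measurable (E : set Omega).
Proof.
exact: (smallest_sub (@sigma_algebra_measurable _ _) (@past_gen_measurable t)).
Qed.

Lemma past_gen_setT t : past_gen t setT.
Proof.
case: t => [|t] /=; first by exists setT; rewrite ?preimage_setT.
exists setT, setT, setT; rewrite !preimage_setT !setIT; split => //.
exact: (@measurableT _ (past t)).
Qed.

Lemma past_gen_setI t : setI_closed (past_gen t).
Proof.
case: t => [|t] E F /=.
  move=> [A mA ->] [A' mA' ->]; exists (A `&` A'); first exact: measurableI.
  by rewrite preimage_setI.
move=> [E0 [C [D [sE0 mC ->]]]] [F0 [C' [D' [sF0 mC' ->]]]].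
exists (E0 `&` F0), (C `&` C'), (D `&` D'); split.
- exact: (@measurableI _ (past t)).
- exact: measurableI.
- by rewrite !preimage_setI; apply/seteqP; split => o /=; tauto.
Qed.

Lemma past_S t (E : set (past t)) : measurable E -> measurable (E : set (past t.+1)).
Proof.
move=> mE; apply: sub_sigma_algebra; exists E, setT, setT; split => //.
by rewrite !preimage_setT !setIT.
Qed.

Lemma past_w t C : measurable C -> measurable (w t @^-1` C : set (past t.+1)).
Proof.
move=> mC; apply: sub_sigma_algebra; exists setT, C, setT; split => //.
  exact: (@measurableT _ (past t)).
by rewrite preimage_setT setIT setTI.
Qed.

Lemma past_q' t D : measurable (q' t @^-1` D : set (past t.+1)).
Proof.
apply: sub_sigma_algebra; exists setT, setT, D; split => //.
  exact: (@measurableT _ (past t)).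
by rewrite preimage_setT setIT setTI.
Qed.

Lemma past_le t t' (E : set Omega) : (t <= t')%N ->
  measurable (E : set (past t)) -> measurable (E : set (past t')).
Proof.
move=> /subnK <-; elim: (t' - t)%N => // k IH mE; rewrite addSn.
by apply: past_S; exact: IH.
Qed.

Lemma measurable_past_le t t' d' (T' : measurableType d') (h : Omega -> T') :
  (t <= t')%N -> measurable_fun [set: past t] h -> measurable_fun [set: past t'] h.
Proof.
move=> tt' mh _ A mA; rewrite setTI; apply: (past_le tt').
by rewrite -[X in measurable X](@setTI (past t)); exact: mh.
Qed.

Lemma measurable_past d' (T' : measurableType d') (h : Omega -> T') t :
  measurable_fun [set: past t] h -> measurable_fun [set: Omega] h.
Proof.
move=> mh _ A mA; rewrite setTI; apply: (@past_measurable t).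
by rewrite -[X in measurable X](@setTI (past t)); exact: mh.
Qed.

Lemma past_history_q' t t' (b : t.-tuple M') : (t <= t')%N ->
  measurable (history q' t @^-1` [set b] : set (past t')).
Proof.
move=> tt'; apply: (@measurable_history _ (past t')) => i it c.
by apply: (@past_le i.+1 t' _ (leq_trans it tt')); exact: past_q'.
Qed.

Lemma measurable_past_w i t : (i < t)%N -> measurable_fun [set: past t] (w i).
Proof.
move=> it; apply: (measurable_past_le it) => _ C mC; rewrite setTI.
exact: past_w.
Qed.

Lemma measurable_past_x t : measurable_fun [set: past t] (x t).
Proof.
elim: t => [|t IH].
  by move=> _ A mA; rewrite setTI; apply: sub_sigma_algebra; exists A.
have -> : (x t.+1 : Omega -> _) = (fun o =>
    (f (x t o) (w t o) + controller gamma (history q' t.+1 o) *m B^T)).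
  by apply/funext => o; rewrite (state_eq loop) (control_eq loop).
have m1 : measurable_fun [set: past t.+1] (fun o => f (x t o) (w t o)).
  have mp : measurable_fun [set: past t.+1] (fun o => (x t o, w t o)).
    apply/measurable_fun_pairP; split; last exact: measurable_past_w.
    exact: (measurable_past_le (leqnSn t) IH).
  exact: (measurableT_comp f_borel mp).
apply: measurable_fun_mx => i j; under eq_fun do rewrite mxE.
apply: measurable_funD; first exact: (measurableT_comp (measurable_coord i j) m1).
apply: (@measurable_finite_comp _ (past t.+1) _ (history q' t.+1) _ _
  (fun b => (controller gamma b *m B^T) i j)) => b.
exact: past_history_q'.
Qed.

(** The input [q t] belongs to the past, as the encoder is a measurable
    function of the states and outputs up to then. *)
Lemma past_q t t' D : (t <= t')%N -> measurable (q t @^-1` D : set (past t')).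
Proof.
move=> tt'; apply: (@measurable_finite_preimage _ (past t')) => m.
apply: (past_le tt').
rewrite (_ : _ @^-1` _ = \bigcup_(b in [set: t.-tuple M'])
    (history q' t @^-1` [set b] `&`
     history x t.+1 @^-1` [set a | encoder gamma a b = m])).
  apply: (@fin_bigcup_measurable _ (past t)) => [|b _]; first exact: finite_finset.
  apply: (@measurableI _ (past t)); first exact: past_history_q'.
  rewrite -[X in measurable X](@setTI (past t)).
  apply: (_ : measurable_fun [set: past t] (history x t.+1)) => //; last first.
    exact: measurable_encoder.
  apply/measurable_fun_tnthP => i.
  rewrite (_ : _ \o _ = x i); last by apply/funext => o; exact: tnth_history.
  by apply: (@measurable_past_le i t); [rewrite -ltnS|exact: measurable_past_x].
apply/seteqP; split => [om /= qo|o [b _ [/= hb hq]]]; last first.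
  by rewrite (input_eq loop) hb.
by exists (history q' t om) => //; split => //=; rewrite -(input_eq loop).
Qed.

Lemma past_history_q t t' (a : t.-tuple M) : (t <= t'.+1)%N ->
  measurable (history q t @^-1` [set a] : set (past t')).
Proof.
move=> tt'; apply: (@measurable_history _ (past t')) => i it m.
by apply: past_q; rewrite -ltnS (leq_trans it).
Qed.

(** The probability that the channel assigns to the output [c] given the past. *)
Definition kernel t (c : M') (o : Omega) : R :=
  chan_prob K (history q t.+1 o) (history q' t o) c.

Lemma kernel_ge0 t c o : 0 <= kernel t c o. Proof. exact: chan_prob_ge0. Qed.

Lemma measurable_past_kernel t c : measurable_fun [set: past t] (kernel t c).
Proof.
apply: (@measurable_finite_comp _ (past t) _
  (fun o => (history q t.+1 o, history q' t o)) _ _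
  (fun ab => chan_prob K ab.1 ab.2 c)) => -[a b].
rewrite (_ : _ @^-1` _ = history q t.+1 @^-1` [set a] `&` history q' t @^-1` [set b]).
  by apply: (@measurableI _ (past t)); [exact: past_history_q|exact: past_history_q'].
by apply/seteqP; split => om /= [ha hb]; rewrite ?ha ?hb.
Qed.

(** The generators of [channel_sigma]: besides the histories and [x 0], all of the
    noise, future included. *)
Definition channel_gen t : set (set Omega) := [set E |
    [\/ exists A : set (t.+1.-tuple M), E = history q t.+1 @^-1` A,
        exists A : set (t.-tuple M'), E = history q' t @^-1` A,
        exists2 A : set 'rV[R]_N, measurable A & E = x 0%N @^-1` A |
        exists i, exists2 A : set 'rV[R]_N, measurable A &
          E = w i @^-1` A]].

Notation chan t := (g_sigma_algebraType (channel_gen t)).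

Lemma channel_gen_measurable t : channel_gen t `<=` measurable.
Proof.
move=> E [[A ->]|[A ->]|[A mA ->]|[i [A mA ->]]].
- apply: measurable_finite_preimage => a.
  by apply: (@past_measurable t); exact: past_history_q.
- apply: measurable_finite_preimage => a.
  by apply: (@past_measurable t); exact: past_history_q'.
- by rewrite -[X in measurable X]setTI; exact: measurable_funPT.
- by rewrite -[X in measurable X]setTI; exact: measurable_funPT.
Qed.

Lemma chan_w t i C : measurable C -> measurable (w i @^-1` C : set (chan t)).
Proof. by move=> mC; apply: sub_sigma_algebra; constructor 4; exists i, C. Qed.

Lemma past_chan t n : (t <= n)%N -> (<<s past_gen t >> `<=` <<s channel_gen n >>).
Proof.
move=> tn; apply: smallest_sub; first exact: smallest_sigma_algebra.
elim: t tn => [|t IH] tn E /=.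
  by move=> [A mA ->]; apply: sub_sigma_algebra; constructor 3; exists A.
move=> [E0 [C [D [sE0 mC ->]]]].
apply: (@measurableI _ (chan n)); last first.
  apply: sub_sigma_algebra; constructor 2.
  exists [set b | D (tnth b (Ordinal tn))].
  by apply/seteqP; split => o /=; rewrite tnth_history.
apply: (@measurableI _ (chan n)); last exact: chan_w.
apply: (smallest_sub _ (IH (ltnW tn)) sE0); exact: smallest_sigma_algebra.
Qed.

Lemma measurable_chan t n d' (T' : measurableType d') (h : Omega -> T') :
  (t <= n)%N -> measurable_fun [set: past t] h -> measurable_fun [set: chan n] h.
Proof.
move=> tn mh _ A mA; rewrite setTI; apply: (past_chan tn).
have := mh (@measurableT _ (past t)) A mA; by rewrite setTI.
Qed.

Lemma measurable_kernel t c : measurable_fun setT (kernel t c).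
Proof. exact: measurable_past (@measurable_past_kernel t c). Qed.

Definition kernel_on t (D : set M') (o : Omega) : R :=
  \sum_(c | `[< D c >]) kernel t c o.

Lemma channel_set t D E : <<s channel_gen t >> E ->
  (\int[P]_(o in E) (kernel_on t D o)%:E = P (E `&` q' t @^-1` D))%E.
Proof.
move=> sE; have [_ _ /(_ _ sE)] := channel_eq loop t [set c | `[< D c >]]%SET.
rewrite (_ : [set o | q' t o \in _] = q' t @^-1` D); last first.
  by apply/seteqP; split => om /=; rewrite inE => /asboolP.
move=> <-; apply: eq_integral => o _; congr (_%:E).
by apply: eq_bigl => c; rewrite inE.
Qed.

Lemma kernel_on_ge0 t D o : 0 <= kernel_on t D o.
Proof. by apply: sumr_ge0 => c _; exact: kernel_ge0. Qed.

Lemma measurable_past_kernel_on t D : measurable_fun [set: past t] (kernel_on t D).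
Proof.
rewrite /kernel_on; under eq_fun do rewrite big_mkcond.
apply: (@measurable_sum _ (past t)) => c.
by case: `[< D c >] => //; exact: measurable_past_kernel.
Qed.

Lemma channel_set1 t c E : <<s channel_gen t >> E ->
  (\int[P]_(o in E) (kernel t c o)%:E = P (E `&` q' t @^-1` [set c]))%E.
Proof.
move=> sE; rewrite -channel_set//; apply: eq_integral => o _; congr (_%:E).
by rewrite /kernel_on (big_pred1 c)// => c'; apply/asboolP/eqP.
Qed.

Lemma measurable_ind_q' t c : measurable_fun setT (\1_(q' t @^-1` [set c]) : Omega -> R).
Proof. by apply: measurable_indic; exact: measurable_q'. Qed.

(** The defining property of the conditional probability, extended from
    events to nonnegative functions. *)
Lemma integral_channel t c (psi : chan t -> \bar R) :
  measurable_fun [set: chan t] psi -> (forall o, 0 <= psi o)%E ->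
  (\int[P]_o (psi o * (\1_(q' t @^-1` [set c]) o)%:E) =
   \int[P]_o (psi o * (kernel t c o)%:E))%E.
Proof.
apply: (eq_integral_sub_sigma (@channel_gen_measurable t)).
- exact: measurable_ind_q'.
- by move=> o; rewrite indicE.
- exact: measurable_kernel.
- exact: kernel_ge0.
move=> E sE; rewrite channel_set1// integral_indic; last exact: measurable_q'.
  by rewrite setIC.
exact: (smallest_sub (@sigma_algebra_measurable _ _) (@channel_gen_measurable t)).
Qed.

Lemma sub_sigma_indep_ext (G : set (set Omega)) (D : set Omega) (c : R) :
  G `<=` measurable -> setI_closed G -> G setT -> measurable D -> 0 <= c ->
  (forall E, G E -> P (E `&` D) = (P E * c%:E)%E) ->
  forall E, <<s G >> E -> P (E `&` D) = (P E * c%:E)%E.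
Proof.
move=> Gm GI GT mD c0 GE E sE.
have -> : (P E * c%:E = mscale (NngNum c0) P E)%E by rewrite muleC.
apply: (@g_sigma_algebra_measure_unique _ R _ G Gm (fun=> setT) _ _ (mrestr P mD)
  (mscale (NngNum c0) P)) => //.
- by rewrite bigcup_const//; exists 0%N.
- by move=> A GA; rewrite [LHS]GE// muleC.
- move=> _; suff : (P (setT `&` D) < +oo)%E by []; rewrite setTI.
  by apply: le_lt_trans (probability_le1 P mD) _; exact: ltry.
Qed.

Definition future t n (C : nat -> set 'rV[R]_N) : set Omega :=
  \bigcap_(i < n) (w (t + i)%N @^-1` C i).

Lemma measurable_preim_w i C : measurable C -> measurable (w i @^-1` C).
Proof. by move=> mC; rewrite -[X in measurable X]setTI; exact: measurable_funPT. Qed.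

Lemma law_w n A : measurable A -> P (w n @^-1` A) = nu A.
Proof. by case: noise => law _; exact: law. Qed.

Lemma futureS t n C C0 : future t n.+1 (fun i => if i is i'.+1 then C i' else C0) =
  w t @^-1` C0 `&` future t.+1 n C.
Proof.
rewrite /future; apply/seteqP; split => [om h|om [h0 h]].
  split; first by have := h 0%N isT; rewrite /= addn0.
  by move=> i /= iN; have := h i.+1 iN; rewrite /= addnS addSn.
by case=> [_|i iN] /=; rewrite ?addn0// addnS -addSn; exact: h.
Qed.

(** The noise from time [t] on is independent of the past.  Passing from [t] to
    [t + 1] adds [w t] and [q' t] to the past: [w t] is independent of the rest by the
    induction hypothesis, and [q' t] is replaced by its conditional probability
    given the past and the whole noise, which is a function of the past alone. *)
Lemma past_future_indep t n C E : (forall i, measurable (C i)) ->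
  <<s past_gen t >> E ->
  (P (E `&` future t n C) = P E * (\prod_(i < n) fine (nu (C i)))%:E)%E.
Proof.
have nuf (A : set 'rV[R]_N) : measurable A -> nu A = (fine (nu A))%:E.
  by move=> mA; rewrite fineK// fin_num_measure.
elim: t n C E => [|t IH] n C E mC.
all: have mfut k : measurable (future k n C) by
  apply: fin_bigcap_measurable => [|i _]; [exact: finite_II|exact: measurable_preim_w].
all: have pr0 : 0 <= \prod_(i < n) fine (nu (C i)) by
  apply: prodr_ge0 => i _; exact: fine_ge0.
all: apply: sub_sigma_indep_ext => //;
  [exact: past_gen_measurable|exact: past_gen_setI|exact: past_gen_setT|].
  move=> {}E [A mA ->]; case: noise => _ /(_ n A C mA mC) ->; congr (_ * _)%E.
  rewrite (big_morph EFin (@EFinM R) erefl); apply: eq_bigr => i _.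
  by rewrite law_w// -nuf.
move=> {}E [E0 [C0 [D [sE0 mC0 ->]]]].
have mE0 : measurable (E0 : set (past t)) by [].
have chanE0 := past_chan (leqnn t) sE0.
pose g o : \bar R := (kernel_on t D o * \1_E0 o)%:E.
have mg : measurable_fun [set: past t] g.
  apply/measurable_EFinP; apply: measurable_funM.
    exact: measurable_past_kernel_on.
  exact: (@measurable_indic _ (past t) R).
have g0 o : (0 <= g o)%E by rewrite lee_fin mulr_ge0 ?kernel_on_ge0.
have key n' C' : (forall i, measurable (C' i)) ->
    (P (E0 `&` w t @^-1` C0 `&` q' t @^-1` D `&` future t.+1 n' C') =
    \int[P]_o (g o) * (fine (nu C0) * \prod_(i < n') fine (nu (C' i)))%:E)%E.
  move=> mC'; set c := _ * _.
  pose C1 i := if i is i'.+1 then C' i' else C0.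
  have mC1 i : measurable (C1 i) by case: i.
  have c0 : 0 <= c.
    by rewrite mulr_ge0 ?fine_ge0//; apply: prodr_ge0 => i _; exact: fine_ge0.
  have mF : measurable (future t n'.+1 C1).
    apply: fin_bigcap_measurable => [|i _]; first exact: finite_II.
    by apply: measurable_preim_w; exact: mC1.
  have chF : <<s channel_gen t >> (future t n'.+1 C1).
    apply: (@fin_bigcap_measurable _ (chan t)) => [|i _]; first exact: finite_II.
    by apply: chan_w; exact: mC1.
  have IH' A : <<s past_gen t >> A -> (P (A `&` future t n'.+1 C1) = P A * c%:E)%E.
    by move=> sA; rewrite IH// big_ord_recl.
  transitivity (\int[P]_o (g o * (\1_(future t n'.+1 C1) o)%:E))%E.
    rewrite (_ : _ `&` _ = (E0 `&` future t n'.+1 C1) `&` q' t @^-1` D); last first.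
      by rewrite futureS; apply/seteqP; split => om /=; tauto.
    rewrite -channel_set; last exact: (@measurableI _ (chan t)).
    rewrite integral_mkcond; apply: eq_integral => o _.
    rewrite patchE /g -EFinM -mulrA !indicE in_setI; case: (o \in E0); case: (o \in future _ _ _);
      by rewrite /= ?mulr1 ?mulr0 ?mul0r ?mul1r ?mulr0.
  rewrite (@eq_integral_sub_sigma _ _ _ P _ (@past_gen_measurable t)
     \1_(future t n'.+1 C1) (cst c) _ _ _ _ _ g mg g0)//; last first.
    move=> A sA; rewrite [RHS](integral_cst P _ c%:E); last exact: past_measurable sA.
    rewrite integral_indic//; last exact: past_measurable sA.
    by have := IH' A sA; rewrite muleC => <-; congr (P _); exact: setIC.
  rewrite -ge0_integralZr//; first exact: measurable_past mg.
have := key 0%N C mC; rewrite /future /= big_ord0 mulr1.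
rewrite bigcap_mkord big_ord0 setIT => ->.
by rewrite key// EFinM muleA.
Qed.

Lemma past_w_indep t E A : <<s past_gen t >> E -> measurable A ->
  (P (E `&` w t @^-1` A) = P E * nu A)%E.
Proof.
move=> sE mA; have := @past_future_indep t 1 (fun=> A) E (fun=> mA) sE.
rewrite big_ord1 fineK ?fin_num_measure// => <-; congr (P (_ `&` _)).
rewrite /future; apply/seteqP; split => [om h i /= |om /(_ 0%N isT)].
  by rewrite ltnS leqn0 => /eqP ->; rewrite addn0.
by rewrite addn0.
Qed.

Lemma measurable_w t : measurable_fun setT (w t).
Proof. exact: measurable_funPT. Qed.

Lemma integral_past_w t (psi : past t * 'rV[R]_N -> \bar R) :
  measurable_fun [set: past t * 'rV[R]_N] psi -> (forall z, 0 <= psi z)%E ->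
  (\int[P]_o psi (o, w t o) = \int[P]_o \int[nu]_v psi (o, v))%E.
Proof.
move=> mpsi psi0.
exact: (integral_independent (@past_gen_measurable t) (measurable_w t)
  (@past_w_indep t) mpsi psi0).
Qed.

(** * Directed information as an expectation *)

Definition output_prob t (b : t.-tuple M') : R := Defs.pmf P (history q' t) b.

Definition output_logprob t (o : Omega) : R := log2 (output_prob (history q' t o)).

(** The directed information density
    [log2 (\prod_t K_t(q'_t | q_[0,t], q'_[0,t-1]) / P(q'_[0,T-1]))]. *)
Definition info_density T (o : Omega) : R :=
  \sum_(t < T) log2 (kernel t (q' t o) o) - output_logprob T o.

Lemma pmf_ge0 (A : finType) (h : Omega -> A) a : 0 <= Defs.pmf P h a.
Proof. by rewrite /Defs.pmf fine_ge0. Qed.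

Lemma le_pmf (A A' : finType) (h : Omega -> A) (h' : Omega -> A') a a' :
  measurable (h @^-1` [set a]) -> measurable (h' @^-1` [set a']) ->
  h @^-1` [set a] `<=` h' @^-1` [set a'] -> Defs.pmf P h a <= Defs.pmf P h' a'.
Proof.
move=> mh mh' sub; apply: fine_le; rewrite ?fin_num_measure//.
by apply: le_measure; rewrite ?inE.
Qed.

(** One term of the conditional mutual information, where the joint
    probability factors through the channel [k].  The bounds by [pZ] and [pYZ] rule
    out vanishing denominators when [pXYZ] is nonzero. *)
Lemma mutual_info_term (pXYZ pXZ k pZ pYZ : R) :
  pXYZ = pXZ * k -> 0 <= pXYZ -> 0 <= pXZ -> 0 <= k -> pXYZ <= pZ -> pXYZ <= pYZ ->
  pXYZ * log2 (pXYZ * pZ / (pXZ * pYZ)) = pXYZ * (log2 k + log2 pZ - log2 pYZ).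
Proof.
move=> pE p_ge0 pXZ_ge0 k_ge0 pZ_ge pYZ_ge.
have [->|p_neq0] := eqVneq pXYZ 0; first by rewrite !mul0r.
have p0 : 0 < pXYZ by rewrite lt0r p_neq0.
have pXZ0 : 0 < pXZ.
  by rewrite lt0r pXZ_ge0 andbT; apply: contra_neq p_neq0 => z; rewrite pE z mul0r.
have k0 : 0 < k.
  by rewrite lt0r k_ge0 andbT; apply: contra_neq p_neq0 => z; rewrite pE z mulr0.
have pZ0 : 0 < pZ by exact: lt_le_trans pZ_ge.
have pYZ0 : 0 < pYZ by exact: lt_le_trans pYZ_ge.
congr (_ * _); rewrite (_ : _ / _ = k * (pZ * pYZ^-1)).
  by rewrite !log2M ?log2V ?mulr_gt0 ?invr_gt0// addrA.
by rewrite pE; field; rewrite !gt_eqF.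
Qed.

Lemma measurable_histories t a b c :
  measurable ((fun o => (history q t.+1 o, q' t o, history q' t o)) @^-1` [set (a, b, c)]).
Proof.
rewrite (_ : _ @^-1` _ = history q t.+1 @^-1` [set a] `&` history q' t @^-1` [set c] `&` q' t @^-1` [set b]).
  apply: measurableI; last exact: measurable_q'.
  apply: (@past_measurable t); apply: (@measurableI _ (past t)).
    exact: past_history_q.
  exact: past_history_q'.
apply/seteqP; split => om; first by move=> [ha hb hc].
by move=> [[ha hc] hb]; congr (_, _, _).
Qed.

Lemma pmf_histories t a b c :
  Defs.pmf P (fun o => (history q t.+1 o, q' t o, history q' t o)) (a, b, c) =
  Defs.pmf P (fun o => (history q t.+1 o, history q' t o)) (a, c) * chan_prob K a c b.
Proof.
have -> : Defs.pmf P (fun o => (history q t.+1 o, history q' t o)) (a, c) =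
    fine (P (history q t.+1 @^-1` [set a] `&` history q' t @^-1` [set c])).
  congr (fine (P _)); apply/seteqP; split => om; first by move=> [ha hc].
  by move=> [ha hc]; congr (_, _).
set E := _ `&` _.
have sE : <<s past_gen t >> E.
  by apply: (@measurableI _ (past t)); [exact: past_history_q|exact: past_history_q'].
rewrite -[LHS]/(fine _) (_ : _ @^-1` _ = E `&` q' t @^-1` [set b]); last first.
  apply/seteqP; split => om; first by move=> [ha hb hc].
  by move=> [[ha hc] hb]; congr (_, _, _).
rewrite -channel_set1; last exact: past_chan sE.
have mE := past_measurable sE.
rewrite (eq_integral (cst (chan_prob K a c b)%:E)); last first.
  by move=> o /set_mem [/= ha hc]; rewrite /kernel ha hc.
by rewrite integral_cst// fineM ?fin_num_measure// mulrC.
Qed.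

Lemma output_prob_rcons t b (c : t.-tuple M') :
  Defs.pmf P (fun o => (q' t o, history q' t o)) (b, c) =
  output_prob [tuple of rcons c b].
Proof.
congr (fine (P _)); apply/seteqP; split => om.
  by move=> [hb hc]; rewrite /= history_rcons hb hc.
rewrite /preimage/= history_rcons => /(congr1 val) /= /rcons_inj [hc hb].
by congr (_, _) => //; exact: val_inj.
Qed.

Lemma measurable_history_q' t a : measurable (history q' t @^-1` [set a]).
Proof. by apply: (@past_measurable t); exact: past_history_q'. Qed.

Lemma integrable_log_kernel t :
  P.-integrable setT (EFin \o (fun o => log2 (kernel t (q' t o) o))).
Proof.
apply: (@integrable_finite_comp _ _ _ P _
  (fun o => (history q t.+1 o, q' t o, history q' t o)) _
  (fun abc => log2 (chan_prob K abc.1.1 abc.2 abc.1.2))) => -[[a b] c].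
exact: measurable_histories.
Qed.

Lemma integrable_output_logprob t : P.-integrable setT (EFin \o output_logprob t).
Proof.
by apply: (@integrable_finite_comp _ _ _ P _ (history q' t) _
  (fun b => log2 (output_prob b))) => b; exact: measurable_history_q'.
Qed.

Lemma cond_mutual_infoE t :
  cond_mutual_info P (history q t.+1) (q' t) (history q' t) =
  \int[P]_o (log2 (kernel t (q' t o) o) + output_logprob t o - output_logprob t.+1 o).
Proof.
set h := fun o => (history q t.+1 o, q' t o, history q' t o).
pose phi (abc : t.+1.-tuple M * M' * t.-tuple M') : R :=
  log2 (chan_prob K abc.1.1 abc.2 abc.1.2) + log2 (output_prob abc.2) -
  log2 (output_prob [tuple of rcons abc.2 abc.1.2]).
have mh abc : measurable (h @^-1` [set abc]).
  by case: abc => -[a b] c; exact: measurable_histories.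
transitivity (\int[P]_o phi (h o)); last first.
  by apply: eq_Rintegral => o _; rewrite /phi /output_logprob history_rcons.
rewrite (Rintegral_finite_comp P mh) /cond_mutual_info.
rewrite pair_big/= pair_big/=; apply: eq_bigr => -[[a b] c] _ /=.
rewrite /phi output_prob_rcons; apply: mutual_info_term.
- exact: pmf_histories.
- exact: pmf_ge0.
- exact: pmf_ge0.
- exact: chan_prob_ge0.
- apply: le_pmf; [exact: mh|exact: measurable_history_q'|].
  by move=> om [_ _].
- apply: le_pmf; [exact: mh|exact: measurable_history_q'|].
  by move=> om [_ hb hc]; rewrite /= history_rcons hb hc.
Qed.

Lemma output_logprob0 o : output_logprob 0 o = 0.
Proof.
rewrite /output_logprob /output_prob /Defs.pmf (_ : _ @^-1` _ = setT).
  by rewrite probability_setT /log2 ln1 mul0r.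
by apply/seteqP; split => // om _; rewrite /preimage/= [LHS]tuple0 [RHS]tuple0.
Qed.

Lemma mutual_info0E :
  mutual_info P (q 0%N) (q' 0%N) =
  \int[P]_o (log2 (kernel 0 (q' 0%N o) o) + output_logprob 0 o - output_logprob 1 o).
Proof.
have hist1 (T : Type) (X : nat -> Omega -> T) o : history X 1 o = [tuple X 0%N o].
  by apply: val_inj; change (tval (history X 1 o) = [:: X 0%N o]); rewrite val_history.
set h := fun o => (q 0%N o, q' 0%N o).
pose phi (ab : M * M') : R :=
  log2 (chan_prob K [tuple ab.1] [tuple] ab.2) + log2 1 -
  log2 (output_prob [tuple ab.2]).
have hE a b : h @^-1` [set (a, b)] =
    (fun o => (history q 1 o, q' 0%N o, history q' 0 o)) @^-1` [set ([tuple a], b, [tuple])].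
  apply/seteqP; split => om.
    move=> [ha hb]; rewrite /preimage/= hist1 ha hb; congr (_, _, _).
    exact: tuple0.
  move=> E; have := congr1 (fun z => thead z.1.1) E.
  have := congr1 (fun z => z.1.2) E; rewrite /= hist1 !theadE => hb ha.
  by congr (_, _).
have mh ab : measurable (h @^-1` [set ab]).
  by case: ab => a b; rewrite hE; exact: measurable_histories.
have q'E b : q' 0%N @^-1` [set b] = history q' 1 @^-1` [set [tuple b]].
  apply/seteqP; split => om; first by rewrite /preimage/= hist1 => ->.
  by move=> /(congr1 (fun z => thead z)); rewrite hist1 !theadE.
transitivity (\int[P]_o phi (h o)); last first.
  apply: eq_Rintegral => o _; rewrite /phi output_logprob0 /output_logprob /kernel/= !hist1.
  rewrite /log2 ln1 mul0r (_ : history q' 0 o = [tuple])//; exact: tuple0.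
rewrite (Rintegral_finite_comp P mh) /mutual_info.
rewrite pair_big/=; apply: eq_bigr => -[a b] _ /=.
have pYE : Defs.pmf P (q' 0%N) b = output_prob [tuple b].
  by rewrite /output_prob /Defs.pmf -q'E.
have pE : Defs.pmf P h (a, b) = Defs.pmf P (q 0%N) a * chan_prob K [tuple a] [tuple] b.
  rewrite -[LHS]/(fine (P (h @^-1` _))) hE [LHS]pmf_histories; congr (_ * _).
  congr (fine (P _)); apply/seteqP; split => om.
    by move=> /(congr1 (fun z => thead z.1)); rewrite /= hist1 !theadE.
  by rewrite /preimage/= => <-; congr (_, _); [rewrite hist1|exact: tuple0].
have ple1 : Defs.pmf P h (a, b) <= 1.
  by rewrite -lee_fin /Defs.pmf fineK ?fin_num_measure//; exact: probability_le1.
have pleY : Defs.pmf P h (a, b) <= output_prob [tuple b].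
  apply: le_pmf; [exact: mh|exact: measurable_history_q'|].
  by move=> om [_ hb]; rewrite /preimage/= hist1 hb.
have := mutual_info_term pE (pmf_ge0 _ _) (pmf_ge0 _ _) (chan_prob_ge0 _ _ _ _) ple1 pleY.
by rewrite mulr1 pYE => ->.
Qed.

Lemma integrable_info_density T : P.-integrable setT (EFin \o info_density T).
Proof.
apply: (@integrableB _ _ _ P setT _ (EFin \o
  (fun o => \sum_(t < T) log2 (kernel t (q' t o) o))) (EFin \o output_logprob T)) => //.
  rewrite (_ : EFin \o _ =
      (fun o => \sum_(t < T) (log2 (kernel t (q' t o) o))%:E)%E); last first.
    by apply/funext => o /=; rewrite sumEFin.
  by apply: integrable_sum => // t _; exact: integrable_log_kernel.
exact: integrable_output_logprob.
Qed.

(** The outputs contribute [log2 P(q'_[0,t-1]) - log2 P(q'_[0,t])] to the term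
    of index [t], and these differences telescope. *)
Lemma directed_infoE T :
  directed_info P q q' T.+1 = \int[P]_o info_density T.+1 o.
Proof.
pose I t := \int[P]_o (log2 (kernel t (q' t o) o) + output_logprob t o - output_logprob t.+1 o).
have iI t : P.-integrable setT (EFin \o (fun o =>
    log2 (kernel t (q' t o) o) + output_logprob t o - output_logprob t.+1 o)).
  apply: (@integrableB _ _ _ P setT _
    (EFin \o (fun o => log2 (kernel t (q' t o) o) + output_logprob t o))
    (EFin \o output_logprob t.+1)) => //.
    apply: (@integrableD _ _ _ P setT _
      (EFin \o (fun o => log2 (kernel t (q' t o) o))) (EFin \o output_logprob t)) => //.
      exact: integrable_log_kernel.
    exact: integrable_output_logprob.
  exact: integrable_output_logprob.
transitivity (\sum_(t < T.+1) I t).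
  rewrite /directed_info mutual_info0E big_ord_recl addrC; congr (_ + _).
  rewrite big_add1/= big_mkord; apply: eq_bigr => t _.
  exact: cond_mutual_infoE.
elim: T => [|T IH].
  by rewrite big_ord1; apply: eq_Rintegral => o _; rewrite /info_density big_ord1 output_logprob0 addr0.
rewrite big_ord_recr IH /I/= -RintegralD; first last.
- exact: iI.
- exact: integrable_info_density.
- exact: measurableT.
by apply: eq_Rintegral => o _; rewrite /info_density [in RHS]big_ord_recr/=; ring.
Qed.

(** * The change of measure *)

Section unfolding.
Hypothesis f_C1 : C1_in_state f.
Hypothesis f_bij : forall v, bijective (f ^~ v).
Variable p0 : 'rV[R]_N -> R.
Hypothesis p0_density : is_density (x 0%N) p0.

Definition growth t (o : Omega) : R := \prod_(i < t) absjac f (x i o) (w i o).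

Definition likelihood t (o : Omega) : R := \prod_(i < t) kernel i (q' i o) o.

(** The density that turns the law of the closed loop on a fixed output string
    into Lebesgue measure of the final state, up to loss of mass. *)
Definition ratio t (o : Omega) : R := growth t o * (p0 (x 0%N o) * likelihood t o)^-1.

Let mp0 : measurable_fun setT p0. Proof. by case: p0_density. Qed.
Let p0_ge0 y : 0 <= p0 y. Proof. by case: p0_density. Qed.

Lemma growth_ge0 t o : 0 <= growth t o.
Proof. by apply: prodr_ge0 => i _; exact: absjac_ge0. Qed.

Lemma likelihood_ge0 t o : 0 <= likelihood t o.
Proof. by apply: prodr_ge0 => i _; exact: kernel_ge0. Qed.

Lemma ratio_ge0 t o : 0 <= ratio t o.
Proof. by rewrite mulr_ge0 ?growth_ge0// invr_ge0 mulr_ge0// likelihood_ge0. Qed.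

Lemma measurable_past_absjac i t : (i < t)%N ->
  measurable_fun [set: past t] (fun o => absjac f (x i o) (w i o)).
Proof.
move=> it.
have mp : measurable_fun [set: past t] (fun o => (x i o, w i o)).
  apply/measurable_fun_pairP; split; last exact: measurable_past_w.
  exact: (measurable_past_le (ltnW it) (@measurable_past_x i)).
exact: (measurableT_comp (measurable_absjac f_borel f_C1) mp).
Qed.

Lemma measurable_past_growth t : measurable_fun [set: past t] (growth t).
Proof.
apply: (@measurable_prod _ (past t)) => i _.
exact: measurable_past_absjac.
Qed.

Lemma measurable_past_likelihood t : measurable_fun [set: past t] (likelihood t).
Proof.
apply: (@measurable_prod _ (past t)) => i _.
apply: (@measurable_past_le i.+1); first by [].
apply: (@measurable_finite_comp _ (past i.+1) _
  (fun o => (history q i.+1 o, history q' i o, q' i o)) _ _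
  (fun abc => chan_prob K abc.1.1 abc.1.2 abc.2)) => -[[a b] c].
rewrite (_ : _ @^-1` _ = history q i.+1 @^-1` [set a] `&`
   history q' i @^-1` [set b] `&` q' i @^-1` [set c]).
  apply: (@measurableI _ (past i.+1)); last exact: past_q'.
  by apply: (@measurableI _ (past i.+1)); [exact: past_history_q|exact: past_history_q'].
apply/seteqP; split => om /=; first by case=> -> -> ->.
by case=> -[-> ->] ->.
Qed.

Lemma measurable_past_ratio t : measurable_fun [set: past t] (ratio t).
Proof.
apply: measurable_funM; first exact: measurable_past_growth.
apply: measurable_funV; apply: measurable_funM; last exact: measurable_past_likelihood.
apply: (measurableT_comp mp0); exact: (measurable_past_le (leq0n t) (@measurable_past_x 0)).
Qed.

(** Induction on the horizon.  On the event that the outputs are [b], the last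
    control is a constant; the last output is averaged out against its channel
    probability, which cancels the last factor of the likelihood, then the last
    noise is integrated out, and [integral_step_le] bounds the resulting function of
    the previous state. *)
Lemma integral_ratio_le T (b : T.-tuple M') (g : 'rV[R]_N -> \bar R) :
  measurable_fun setT g -> (forall y, 0 <= g y)%E ->
  (\int[P]_o (g (x T o) * (\1_(history q' T @^-1` [set b]) o * ratio T o)%:E) <=
   \int[lebesgue_rV R N]_y g y)%E.
Proof.
elim: T b g => [|T IH] b g mg g0.
  have mi : measurable_fun setT (fun y => ((p0 y)^-1)%:E : \bar R).
    by apply/measurable_EFinP; exact: measurable_funV.
  have gi0 y : (0 <= g y * ((p0 y)^-1)%:E)%E by rewrite mule_ge0// lee_fin invr_ge0.
  have mgi : measurable_fun setT (fun y => g y * ((p0 y)^-1)%:E)%E.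
    exact: emeasurable_funM.
  apply: (@le_trans _ _ (\int[P]_o (g (x 0%N o) * ((p0 (x 0%N o))^-1)%:E))%E).
    apply: ge0_le_integral; first exact: measurableT.
    - by move=> o _; rewrite mule_ge0// lee_fin mulr_ge0// ratio_ge0.
    - apply: emeasurable_funM; first exact: measurableT_comp.
      apply/measurable_EFinP; apply: measurable_funM.
        apply: measurable_indic; apply: (@past_measurable 0).
        exact: past_history_q'.
      exact: measurable_past (@measurable_past_ratio 0).
    - exact: (measurableT_comp mgi).
    - move=> o _; apply: lee_wpmul2l => //; rewrite lee_fin.
      rewrite /ratio /growth /likelihood !big_ord0 mulr1 mul1r indicE.
      by case: (_ \in _); rewrite ?mul1r// mul0r invr_ge0.
  rewrite (integral_density p0_density mgi gi0).
  apply: ge0_le_integral; first exact: measurableT.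
  - by move=> y _; rewrite mule_ge0// lee_fin.
  - by apply: emeasurable_funM => //; exact/measurable_EFinP.
  - exact: mg.
  - move=> y _; rewrite -muleA -EFinM -[leRHS]mule1; apply: lee_wpmul2l => //.
    rewrite lee_fin; have [->|p00] := eqVneq (p0 y) 0; first by rewrite mulr0.
    by rewrite mulVf.
have [/eqP|/set0P[om0 hb]] := boolP (history q' T.+1 @^-1` [set b] == set0).
  move=> b0; under eq_integral do rewrite b0 indic0 mul0r mule0.
  by rewrite integral0; exact: integral_ge0.
set b' := history q' T om0; set c := q' T om0.
have bE : b = [tuple of rcons b' c] by rewrite -hb history_rcons.
have hist_b o : (o \in history q' T.+1 @^-1` [set b]) =
    (o \in history q' T @^-1` [set b']) && (o \in q' T @^-1` [set c]).
  apply/idP/andP; rewrite !inE /= history_rcons bE.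
    by move=> /(congr1 val) /= /rcons_inj [hv ->]; split=> //; exact: val_inj.
  by move=> [-> ->].
pose beta := controller gamma b *m B^T.
pose G (z : 'rV[R]_N * 'rV[R]_N) : \bar R :=
  (g (beta + f z.1 z.2)%R * (absjac f z.1 z.2)%:E)%E.
have mG : measurable_fun setT G.
  apply: emeasurable_funM.
    exact: (measurableT_comp mg (measurable_step f_borel beta)).
  by apply/measurable_EFinP; exact: measurable_absjac.
have G0 z : (0 <= G z)%E by rewrite mule_ge0// lee_fin absjac_ge0.
pose r o := \1_(history q' T @^-1` [set b']) o * ratio T o.
have r0 o : 0 <= r o by rewrite mulr_ge0// ratio_ge0.
have mr : measurable_fun [set: past T] r.
  apply: measurable_funM; last exact: measurable_past_ratio.
  by apply: (@measurable_indic _ (past T) R); exact: past_history_q'.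
(* Everything but the last output; a null channel probability makes this 0. *)
pose psi o := (G (x T o, w T o) * (r o * (kernel T c o)^-1)%:E)%E.
have psi0 o : (0 <= psi o)%E.
  by rewrite mule_ge0// lee_fin mulr_ge0// invr_ge0 kernel_ge0.
have mxw : measurable_fun [set: chan T] (fun o => (x T o, w T o)).
  apply/measurable_fun_pairP; split.
    exact: (measurable_chan (leqnn T) (@measurable_past_x T)).
  by move=> _ A mA; rewrite setTI; exact: chan_w.
have mpsi : measurable_fun [set: chan T] psi.
  apply: emeasurable_funM; first exact: (measurableT_comp mG mxw).
  apply/measurable_EFinP; apply: (measurable_chan (leqnn T)).
  apply: measurable_funM => //; apply: measurable_funV.
  exact: measurable_past_kernel.
have mchan d' (T' : measurableType d') (h : Omega -> T') :
    measurable_fun [set: chan T] h -> measurable_fun setT h.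
  move=> mh _ A mA; rewrite setTI.
  apply: (smallest_sub (@sigma_algebra_measurable _ _) (@channel_gen_measurable T)).
  by have := mh (@measurableT _ (chan T)) A mA; rewrite setTI.
(* Isolate the indicator of the last output, on which the channel law acts. *)
have -> : (\int[P]_o (g (x T.+1 o) * (\1_(history q' T.+1 @^-1` [set b]) o * ratio T.+1 o)%:E) =
    \int[P]_o (psi o * (\1_(q' T @^-1` [set c]) o)%:E))%E.
  apply: eq_integral => o _; rewrite !indicE hist_b /psi /G /r !indicE.
  case: (boolP (o \in _ @^-1` [set b'])) => [/set_mem hob'|_]; last first.
    by rewrite !mul0r mule0 mule0 mul0e.
  case: (boolP (o \in _ @^-1` [set c])) => [/set_mem qc|_]; last first.
    by rewrite mul0r mule0 mule0.
  rewrite /= !mul1r mule1.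
  have -> : x T.+1 o = beta + f (x T o) (w T o).
    rewrite (state_eq loop) (control_eq loop) addrC /beta bE history_rcons.
    by congr (controller _ _ *m _ + _); rewrite -hob' -qc.
  rewrite -muleA -EFinM; congr (_ * _%:E)%E.
  rewrite /ratio /growth /likelihood !big_ord_recr/= qc !invfM.
  by rewrite -!mulrA mulrCA [absjac _ _ _ * _]mulrC -!mulrA.
rewrite integral_channel//.
apply: (@le_trans _ _ (\int[P]_o (G (x T o, w T o) * (r o)%:E))%E).
  apply: ge0_le_integral; first exact: measurableT.
  - by move=> o _; rewrite mule_ge0// lee_fin kernel_ge0.
  - apply: emeasurable_funM; first exact: mchan.
    by apply/measurable_EFinP; exact: measurable_kernel.
  - apply: emeasurable_funM.
      by apply: mchan; exact: (measurableT_comp mG mxw).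
    by apply/measurable_EFinP; exact: measurable_past mr.
  - move=> o _; rewrite /psi -muleA -EFinM; apply: lee_wpmul2l => //.
    rewrite lee_fin -mulrA ler_piMr//.
    have [->|k0] := eqVneq (kernel T c o) 0; first by rewrite mulr0.
    by rewrite mulVf.
pose chi (z : past T * 'rV[R]_N) := (G (x T z.1, z.2) * (r z.1)%:E)%E.
have mchi : measurable_fun [set: past T * 'rV[R]_N] chi.
  apply: emeasurable_funM.
    have mp : measurable_fun [set: past T * 'rV[R]_N] (fun z => (x T z.1, z.2)).
      apply/measurable_fun_pairP; split; last exact: measurable_snd.
      exact: (measurableT_comp (@measurable_past_x T) measurable_fst).
    exact: (measurableT_comp mG mp).
  apply/measurable_EFinP; exact: (measurableT_comp mr measurable_fst).
have chi0 z : (0 <= chi z)%E by rewrite mule_ge0// lee_fin.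
rewrite [leLHS](_ : _ = \int[P]_o chi (o, w T o))%E // integral_past_w//.
pose g' y := (\int[nu]_v G (y, v))%E.
have mg' : measurable_fun setT g' by exact: measurable_fun_fubini_tonelli_F.
have g'0 y : (0 <= g' y)%E by exact: integral_ge0.
have -> : (\int[P]_o \int[nu]_v chi (o, v) = \int[P]_o (g' (x T o) * (r o)%:E))%E.
  apply: eq_integral => o _.
  have mGo : measurable_fun setT (fun v => G (x T o, v)).
    apply: (measurableT_comp mG); exact: measurable_pair1.
  have r0o : (0 <= (r o)%:E)%E by rewrite lee_fin.
  exact: (ge0_integralZr nu measurableT mGo (fun v _ => G0 _) r0o).
apply: (le_trans (IH b' g' mg' g'0)).
exact: (integral_step_le f_borel f_C1 f_bij nu beta mg g0).
Qed.

(** * Integrability of the log-growth *)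

Definition logjac (y v : 'rV[R]_N) : R := log2 (absjac f y v).

(** With [log2] in place of [log2e]: the value at vanishing Jacobians differs, but
    all functions stay real-valued. *)
Definition mean_logjac (y : 'rV[R]_N) : \bar R := (\int[nu]_v (logjac y v)%:E)%E.

Definition log_growth t (o : Omega) : R := \sum_(i < t) logjac (x i o) (w i o).

Lemma measurable_logjac :
  measurable_fun setT (fun z : 'rV[R]_N * 'rV[R]_N => logjac z.1 z.2).
Proof. exact: (measurableT_comp (@measurable_log2 R) (measurable_absjac f_borel f_C1)). Qed.

Let part (sgn : R) (y : 'rV[R]_N) : \bar R :=
  (\int[nu]_v (Num.max 0 (sgn * logjac y v))%:E)%E.

Let measurable_part sgn : measurable_fun setT (part sgn).
Proof.
apply: (measurable_fun_fubini_tonelli_F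
  (fun z : 'rV[R]_N * 'rV[R]_N => (Num.max 0 (sgn * logjac z.1 z.2))%:E)).
  apply/measurable_EFinP; apply: measurable_maxr; first exact: measurable_cst.
  apply: measurable_funM; first exact: measurable_cst.
  exact: measurable_logjac.
by move=> z; rewrite lee_fin le_max lexx.
Qed.

Let mlogjac1 y : measurable_fun setT (logjac y).
Proof.
have mp : measurable_fun setT (fun v : 'rV[R]_N => (y, v)) by exact: measurable_pair1.
exact: (measurableT_comp measurable_logjac mp).
Qed.

Let mean_parts y : (mean_logjac y = part 1 y - part (-1) y)%E.
Proof.
rewrite /mean_logjac integral_posneg.
by congr (_ - _)%E; apply: eq_integral => v _; rewrite ?mul1r ?mulN1r.
Qed.

Lemma measurable_mean_logjac : measurable_fun setT mean_logjac.
Proof.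
rewrite (_ : mean_logjac = (fun y => part 1 y - part (-1) y)%E).
  exact: emeasurable_funB.
by apply/funext => y; exact: mean_parts.
Qed.

Lemma measurable_x t : measurable_fun setT (x t).
Proof. exact: measurable_funPT. Qed.

Lemma measurable_past_log_growth t : measurable_fun [set: past t] (log_growth t).
Proof.
apply: (@measurable_sum _ (past t)) => i.
exact: (measurableT_comp (@measurable_log2 R) (@measurable_past_absjac i t (ltn_ord i))).
Qed.

Lemma log_growthS t o :
  log_growth t.+1 o = log_growth t o + logjac (x t o) (w t o).
Proof. by rewrite /log_growth big_ord_recr. Qed.

Lemma integral_increment t (a : past t -> R) (F : R -> R -> R) :
  measurable_fun [set: past t] a -> measurable_fun setT (fun p : R * R => F p.1 p.2) ->
  (forall r r', 0 <= F r r') ->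
  (\int[P]_o (F (a o) (logjac (x t o) (w t o)))%:E =
   \int[P]_o \int[nu]_v (F (a o) (logjac (x t o) v))%:E)%E.
Proof.
move=> ma mF F0.
pose chi (z : past t * 'rV[R]_N) : \bar R := (F (a z.1) (logjac (x t z.1) z.2))%:E.
apply: (@integral_past_w t chi) => [|z]; last by rewrite lee_fin.
have m1 : measurable_fun [set: past t * 'rV[R]_N] (fun z => (x t z.1, z.2)).
  apply/measurable_fun_pairP; split; last exact: measurable_snd.
  exact: (measurableT_comp (@measurable_past_x t) measurable_fst).
have m2 : measurable_fun [set: past t * 'rV[R]_N] (fun z => (a z.1, logjac (x t z.1) z.2)).
  apply/measurable_fun_pairP; split.
    exact: (measurableT_comp ma measurable_fst).
  exact: (measurableT_comp measurable_logjac m1).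
by apply/measurable_EFinP; exact: (measurableT_comp mF m2).
Qed.

(** Finite as soon as the iterated integral at time [t] is not [-oo]. *)
Definition neg_mean t : \bar R := (\int[P]_o maxe (- mean_logjac (x t o)) 0)%E.

Let mnegmean t : measurable_fun setT (fun o => maxe (- mean_logjac (x t o)) 0)%E.
Proof.
apply: measurable_maxe => //; apply: measurableT_comp => //.
exact: (measurableT_comp measurable_mean_logjac (measurable_x t)).
Qed.

Let mcomp (h : Omega -> R) : measurable_fun setT h ->
  measurable_fun setT (fun o => (Num.max 0 (h o))%:E).
Proof. by move=> mh; apply/measurable_EFinP; exact: measurable_maxr. Qed.

Let max0_ge0 (r : R) : (0 <= (Num.max 0 r)%:E)%E.
Proof. by rewrite lee_fin le_max lexx. Qed.

Let mFplus : measurable_fun setT (fun p : R * R => Num.max 0 (p.1 + p.2)).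
Proof. by apply: measurable_maxr => //; exact: measurable_funD. Qed.

(** [shift_le] with [c] the growth so far and [psi] the next increment. *)
Lemma log_growth_pos_backward t : (neg_mean t < +oo)%E ->
  (\int[P]_o (Num.max 0 (log_growth t.+1 o))%:E < +oo)%E ->
  (\int[P]_o (Num.max 0 (log_growth t o))%:E < +oo)%E.
Proof.
move=> negfin.
under eq_integral do rewrite log_growthS.
have -> : (\int[P]_o (Num.max 0 (log_growth t o + logjac (x t o) (w t o)))%:E =
    \int[P]_o \int[nu]_v (Num.max 0 (log_growth t o + logjac (x t o) v))%:E)%E.
  apply: (@integral_increment t (log_growth t) (fun r r' => Num.max 0 (r + r'))) => //.
    exact: measurable_past_log_growth.
  by move=> r r'; rewrite le_max lexx.
pose G o := (\int[nu]_v (Num.max 0 (log_growth t o + logjac (x t o) v))%:E)%E.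
have mG : measurable_fun setT G.
  apply: (measurable_fun_fubini_tonelli_F (fun z : Omega * 'rV[R]_N =>
    (Num.max 0 (log_growth t z.1 + logjac (x t z.1) z.2))%:E)) => //.
  apply/measurable_EFinP; apply: measurable_maxr => //; apply: measurable_funD.
    exact: (measurableT_comp (measurable_past (@measurable_past_log_growth t)) measurable_fst).
  have mp : measurable_fun [set: Omega * 'rV[R]_N] (fun z => (x t z.1, z.2)).
    apply/measurable_fun_pairP; split; last exact: measurable_snd.
    exact: (measurableT_comp (measurable_x t) measurable_fst).
  exact: (measurableT_comp measurable_logjac mp).
have G0 o : (0 <= G o)%E by apply: integral_ge0.
move=> Gfin.
apply: (@le_lt_trans _ _ (\int[P]_o (G o + maxe (- mean_logjac (x t o)) 0))%E).
  apply: ge0_le_integral; first exact: measurableT.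
  - by move=> o _; exact: max0_ge0.
  - exact/mcomp/(measurable_past (@measurable_past_log_growth t)).
  - by apply: emeasurable_funD.
  - move=> o _; rewrite EFin_max ge_max; apply/andP; split.
      by rewrite adde_ge0// le_max lexx orbT.
    exact: shift_le.
rewrite ge0_integralD//; first exact: lte_add_pinfty.
by move=> o _; rewrite le_max lexx orbT.
Qed.

(** The positive part of the increment is at most that of the new sum plus the
    absolute value of the old one, and [neg_part_le] then bounds its negative part. *)
Lemma integrable_logjac t : P.-integrable setT (EFin \o log_growth t) ->
  (neg_mean t < +oo)%E ->
  (\int[P]_o (Num.max 0 (log_growth t.+1 o))%:E < +oo)%E ->
  P.-integrable setT (EFin \o (fun o => logjac (x t o) (w t o))) /\
  (\int[P]_o (logjac (x t o) (w t o))%:E = \int[P]_o mean_logjac (x t o))%E.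
Proof.
move=> ig negfin posfin.
set Y := fun o => logjac (x t o) (w t o).
have mY : measurable_fun setT Y.
  have mp : measurable_fun setT (fun o => (x t o, w t o)).
    by apply/measurable_fun_pairP; split; [exact: measurable_x|exact: measurable_w].
  exact: (measurableT_comp measurable_logjac mp).
have mg := measurable_past (@measurable_past_log_growth t).
have partE sgn : (\int[P]_o (Num.max 0 (sgn * Y o))%:E = \int[P]_o part sgn (x t o))%E.
  apply: (@integral_increment t (cst 0) (fun _ r' => Num.max 0 (sgn * r'))) => //.
    by apply: measurable_maxr => //; exact: measurable_funM.
  by move=> _ r'; rewrite le_max lexx.
have part0 sgn y : (0 <= part sgn y)%E by exact: integral_ge0.
have mpart sgn : measurable_fun setT (fun o => part sgn (x t o)).
  exact: (measurableT_comp (@measurable_part sgn) (measurable_x t)).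
have pos_fin : (\int[P]_o part 1 (x t o) < +oo)%E.
  rewrite -partE.
  apply: (@le_lt_trans _ _ (\int[P]_o ((Num.max 0 (log_growth t.+1 o))%:E + `|(log_growth t o)%:E|))%E).
    apply: ge0_le_integral; first exact: measurableT.
    - by move=> o _; exact: max0_ge0.
    - by apply: mcomp; exact: measurable_funM.
    - apply: emeasurable_funD.
        by apply: mcomp; exact: measurable_past (@measurable_past_log_growth t.+1).
      by apply: measurableT_comp => //; exact/measurable_EFinP.
    - move=> o _; rewrite mul1r log_growthS -/(Y o) -EFinD lee_fin ge_max.
      have := ler_norm (- log_growth t o); rewrite normrN => h.
      rewrite addr_ge0 ?le_max ?lexx//=.
      by case: (leP 0 (log_growth t o + Y o)) => ?; lra.
  rewrite ge0_integralD//; last first.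
  - by apply: measurableT_comp => //; exact/measurable_EFinP.
  - by apply: mcomp; exact: measurable_past (@measurable_past_log_growth t.+1).
  by apply: lte_add_pinfty => //; move/integrableP : ig => [].
have neg_fin : (\int[P]_o part (-1) (x t o) < +oo)%E.
  apply: (@le_lt_trans _ _ (\int[P]_o (maxe (- mean_logjac (x t o)) 0 + part 1 (x t o)))%E).
    apply: ge0_le_integral => //.
    - by apply: emeasurable_funD.
    - move=> o _; rewrite /part; under eq_integral do rewrite mulN1r.
      under [X in (_ <= _ + X)%E]eq_integral do rewrite mul1r.
      exact: neg_part_le.
  rewrite ge0_integralD//; first exact: lte_add_pinfty.
  by move=> o _; rewrite le_max lexx orbT.
have ipart sgn : (\int[P]_o part sgn (x t o) < +oo)%E ->
    P.-integrable setT (fun o => part sgn (x t o)).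
  move=> h; apply/integrableP; split => //.
  by under eq_integral do rewrite gee0_abs//.
have YE : (\int[P]_o (Y o)%:E = \int[P]_o part 1 (x t o) - \int[P]_o part (-1) (x t o))%E.
  rewrite integral_posneg// -!partE; congr (_ - _)%E; apply: eq_integral => o _.
    by rewrite mul1r.
  by rewrite mulN1r.
split; last first.
  rewrite YE -integralB//; [|exact: ipart|exact: ipart].
  by apply: eq_integral => o _; rewrite mean_parts.
apply/integrableP; split; first exact/measurable_EFinP.
apply: (@le_lt_trans _ _ (\int[P]_o ((Num.max 0 (1 * Y o))%:E + (Num.max 0 (-1 * Y o))%:E))%E).
  apply: ge0_le_integral => //.
  - by apply: measurableT_comp => //; exact/measurable_EFinP.
  - by apply: emeasurable_funD; apply: mcomp; exact: measurable_funM.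
  - move=> o _; rewrite -EFinD lee_fin mul1r mulN1r ler_norml.
    by case: (leP 0 (Y o)) => ?; case: (leP 0 (- Y o)) => ?; apply/andP; split; lra.
have mp sgn : measurable_fun setT (fun o => (Num.max 0 (sgn * Y o))%:E).
  by apply: mcomp; exact: measurable_funM.
rewrite (ge0_integralD P measurableT (fun o _ => max0_ge0 _) (mp 1)
  (fun o _ => max0_ge0 _) (mp (-1))) !partE.
exact: (lte_add_pinfty pos_fin neg_fin).
Qed.

(** The bound on the positive part goes backwards in time; from [log_growth 0 = 0],
    the increments are then integrable one after the other. *)
Lemma integral_log_growth T : (forall t, (t < T)%N -> (neg_mean t < +oo)%E) ->
  (\int[P]_o (Num.max 0 (log_growth T o))%:E < +oo)%E ->
  P.-integrable setT (EFin \o log_growth T) /\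
  (\int[P]_o (log_growth T o)%:E = \sum_(t < T) \int[P]_o mean_logjac (x t o))%E.
Proof.
move=> negfin posT.
have pos k : (k <= T)%N ->
    (\int[P]_o (Num.max 0 (log_growth (T - k)%N o))%:E < +oo)%E.
  elim: k => [|k IH] kT; first by rewrite subn0.
  have kT' : (T - k.+1 < T)%N by lia.
  apply: log_growth_pos_backward; first exact: negfin.
  by rewrite -subSn// subSS; apply: IH; exact: ltnW.
have {}pos t : (t <= T)%N -> (\int[P]_o (Num.max 0 (log_growth t o))%:E < +oo)%E.
  by move=> tT; have := pos (T - t)%N (leq_subr _ _); rewrite subKn.
suff H t : (t <= T)%N -> P.-integrable setT (EFin \o log_growth t) /\
  (\int[P]_o (log_growth t o)%:E = \sum_(i < t) \int[P]_o mean_logjac (x i o))%E.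
  exact: H.
elim: t => [|t IH] tT.
  rewrite big_ord0; have z o : log_growth 0 o = 0 by rewrite /log_growth big_ord0.
  split; last by under eq_integral do rewrite z; rewrite integral0.
  by rewrite (_ : _ \o _ = cst 0%E); [exact: integrable0|apply/funext => o /=; rewrite z].
have [ig gE] := IH (ltnW tT).
have [iY YE] := integrable_logjac ig (negfin t tT) (pos t.+1 tT).
have E : EFin \o log_growth t.+1 =
    ((EFin \o log_growth t) \+ (EFin \o (fun o => logjac (x t o) (w t o))))%E.
  by apply/funext => o /=; rewrite log_growthS EFinD.
split; first by rewrite E; exact: integrableD.
rewrite big_ord_recr/= -gE -YE -integralD//.
by apply: eq_integral => o _; rewrite log_growthS EFinD.
Qed.

Definition mean_log2e (y : 'rV[R]_N) : \bar R :=
  (\int[nu]_v log2e (absjac f y v)%:E)%E.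

Let singular (y : 'rV[R]_N) : set 'rV[R]_N := [set v | absjac f y v = 0].

Lemma log2eE (r : R) : 0 <= r -> log2e r%:E = if r == 0 then -oo%E else (log2 r)%:E.
Proof.
move=> r0; rewrite /log2e; have [->|rn0] := eqVneq r 0.
  by rewrite le0_lneNy// mulNyr gtr0_sg ?mul1e// invr_gt0 ln_gt0// ltr1n.
by rewrite lne_EFin ?EFinM// lt0r rn0.
Qed.

Lemma measurable_log2e_absjac : measurable_fun setT
  (fun z : 'rV[R]_N * 'rV[R]_N => log2e (absjac f z.1 z.2)%:E).
Proof.
rewrite (_ : (fun z => _) = (fun z => if absjac f z.1 z.2 == 0 then -oo%E
    else (logjac z.1 z.2)%:E)); last first.
  by apply/funext => z; rewrite log2eE// absjac_ge0.
apply: measurable_fun_ifT.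
- by apply: measurable_fun_eqr; [exact: measurable_absjac|exact: measurable_cst].
- exact: measurable_cst.
- by apply/measurable_EFinP; exact: measurable_logjac.
Qed.

Let mpair (y : 'rV[R]_N) : measurable_fun setT (fun v : 'rV[R]_N => (y, v)).
Proof. exact: measurable_pair1. Qed.

Lemma measurable_log2e_absjac1 y : measurable_fun setT (fun v => log2e (absjac f y v)%:E).
Proof. exact: (measurableT_comp measurable_log2e_absjac (mpair y)). Qed.

Lemma measurable_mean_log2e : measurable_fun setT mean_log2e.
Proof.
have mpos := measurable_funepos measurable_log2e_absjac.
have mneg := measurable_funeneg measurable_log2e_absjac.
rewrite (_ : mean_log2e = (fun y =>
    (\int[nu]_v ((fun z => log2e (absjac f z.1 z.2)%:E)^\+ (y, v))) -
    (\int[nu]_v ((fun z => log2e (absjac f z.1 z.2)%:E)^\- (y, v))))%E); last first.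
  apply/funext => y; rewrite /mean_log2e integralE; congr (_ - _)%E.
    by apply: eq_integral => v _; rewrite !funeposE.
  by apply: eq_integral => v _; rewrite !funenegE.
apply: emeasurable_funB.
  exact: (measurable_fun_fubini_tonelli_F _ mpos).
exact: (measurable_fun_fubini_tonelli_F _ mneg).
Qed.

Let msingular y : measurable (singular y).
Proof.
have := measurableT_comp (measurable_absjac f_borel f_C1) (mpair y).
move=> /(_ measurableT [set 0] (measurable_set1 _)); by rewrite setTI.
Qed.

Lemma mean_log2e_neqNy y : mean_log2e y != -oo%E ->
  nu (singular y) = 0%E /\ mean_log2e y = mean_logjac y.
Proof.
move=> /(integral_neqNy (measurable_log2e_absjac1 y))[_ aeN].
have ae0 : {ae nu, forall v, absjac f y v != 0}.
  apply: filterS aeN => v; apply: contra_neq => v0.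
  by rewrite v0 log2eE// eqxx.
split.
  by apply: measure0_ae => //; apply: filterS ae0 => v /eqP.
apply: ae_eq_integral => //.
- exact: measurable_log2e_absjac1.
- by apply/measurable_EFinP; exact: (measurableT_comp measurable_logjac (mpair y)).
apply: filterS ae0 => v vn0 _ /=.
by rewrite log2eE ?absjac_ge0// (negbTE vn0).
Qed.

(** The summand of index [t] in the right-hand side of the theorem. *)
Definition rate t : \bar R := (\int[distribution P (x t)]_y mean_log2e y)%E.

(** Where the Jacobian vanishes, the logarithm is [-oo]; so a mean that is not
    [-oo] excludes this almost surely, and [log2e] may be replaced by [log2]. *)
Lemma rate_neqNy t : rate t != -oo%E ->
  [/\ {ae P, forall o, absjac f (x t o) (w t o) != 0},
      (neg_mean t < +oo)%E &
      rate t = (\int[P]_o mean_logjac (x t o))%E].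
Proof.
rewrite /rate integral_distribution; last exact: measurable_mean_log2e.
have mm : measurable_fun setT (fun o => mean_log2e (x t o)).
  exact: (measurableT_comp measurable_mean_log2e (measurable_x t)).
move=> /(integral_neqNy mm)[negfin aeN].
have aeE : {ae P, forall o, mean_log2e (x t o) = mean_logjac (x t o)}.
  by apply: filterS aeN => o /mean_log2e_neqNy[].
have mm' : measurable_fun setT (fun o => mean_logjac (x t o)).
  exact: (measurableT_comp measurable_mean_logjac (measurable_x t)).
split; last 2 first.
- rewrite /neg_mean; apply: le_lt_trans negfin.
  apply: ae_ge0_le_integral => //.
  + by move=> o _; rewrite le_max lexx orbT.
  + exact: measurable_funeneg.
  + by apply: filterS aeE => o oE _; rewrite funenegE oE.
- apply: ae_eq_integral => //; by apply: filterS aeE => o oE _.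
have mxw : measurable_fun setT (fun o => (x t o, w t o)).
  by apply/measurable_fun_pairP; split; [exact: measurable_x|exact: measurable_w].
pose Z := [set z : 'rV[R]_N * 'rV[R]_N | absjac f z.1 z.2 = 0].
have mZ : measurable Z.
  have := measurable_absjac f_borel f_C1 measurableT (measurable_set1 (0 : R)).
  by rewrite setTI.
have mind : measurable_fun setT (fun z => (\1_Z z)%:E : \bar R).
  by apply/measurable_EFinP; exact: measurable_indic.
have int0 : (\int[P]_o (\1_Z (x t o, w t o))%:E = 0)%E.
  pose chi (z : past t * 'rV[R]_N) : \bar R := (\1_Z (x t z.1, z.2))%:E.
  have mchi : measurable_fun [set: past t * 'rV[R]_N] chi.
    have mp : measurable_fun [set: past t * 'rV[R]_N] (fun z => (x t z.1, z.2)).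
      apply/measurable_fun_pairP; split; last exact: measurable_snd.
      exact: (measurableT_comp (@measurable_past_x t) measurable_fst).
    exact: (measurableT_comp mind mp).
  rewrite [LHS](@integral_past_w t chi mchi); last by move=> z; rewrite lee_fin indicE.
  have sing_ae : {ae P, forall o, nu (singular (x t o)) = 0%E}.
    by apply: filterS aeN => o /mean_log2e_neqNy[].
  have mO : measurable_fun [set: Omega * 'rV[R]_N] (fun z => (\1_Z (x t z.1, z.2))%:E : \bar R).
    have mp : measurable_fun [set: Omega * 'rV[R]_N] (fun z => (x t z.1, z.2)).
      apply/measurable_fun_pairP; split; last exact: measurable_snd.
      exact: (measurableT_comp (measurable_x t) measurable_fst).
    exact: (measurableT_comp mind mp).
  have O0 (z : Omega * 'rV[R]_N) : (0 <= (\1_Z (x t z.1, z.2))%:E :> \bar R)%E.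
    by rewrite lee_fin indicE.
  have mI : measurable_fun setT (fun o => \int[nu]_v (\1_Z (x t o, v))%:E)%E.
    exact: (measurable_fun_fubini_tonelli_F _ mO O0).
  transitivity (\int[P]_o (\int[nu]_v (\1_Z (x t o, v))%:E))%E; first by [].
  transitivity (\int[P]_o (cst 0%E o : \bar R))%E; last exact: integral0.
  apply: (ge0_ae_eq_integral measurableT mI) => //.
  - by move=> o _; apply: integral_ge0 => v _; exact: (O0 (o, v)).
  - apply: filterS sing_ae => o o0 _ /=.
    transitivity (nu (singular (x t o) `&` setT)); last by rewrite setIT.
    by rewrite -(integral_indic nu measurableT (msingular (x t o))).
have mhx : measurable_fun setT (fun o => \1_Z (x t o, w t o) : R).
  exact: (measurableT_comp (measurable_indic mZ) mxw).
have ind0 o : 0 <= \1_Z (x t o, w t o) :> R by rewrite indicE.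
have := integral0_measure0 mhx ind0 int0.
apply: filterS => o; rewrite indicE => h; apply/eqP => z0; move: h.
by rewrite mem_set// => /eqP; rewrite oner_eq0.
Qed.

(** * The entropy balance *)

(** The probability that [q' t = c] while [kernel t c = 0] is the integral of
    [kernel t c] over the set where it vanishes. *)
Lemma kernel_gt0 t : {ae P, forall o, 0 < kernel t (q' t o) o}.
Proof.
have null c : {ae P, forall o, ~ (kernel t c o = 0 /\ q' t o = c)}.
  have mk : measurable (kernel t c @^-1` [set 0] : set (past t)).
    rewrite -[X in measurable X](@setTI (past t)).
    exact: measurable_past_kernel.
  apply: (@ae_notin _ _ _ P (kernel t c @^-1` [set 0] `&` q' t @^-1` [set c])).
    by apply: measurableI; [exact: past_measurable mk|exact: measurable_q'].
  transitivity (\int[P]_(o in kernel t c @^-1` [set 0%R]) (kernel t c o)%:E)%E.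
    by symmetry; apply: channel_set1; exact: (past_chan (leqnn t) mk).
  by rewrite (eq_integral (cst 0%E)) ?integral0// => o /set_mem/= ->.
apply: filterS (ae_forall null) => o /(_ (q' t o)) h.
by rewrite lt0r kernel_ge0 andbT; apply/eqP => k0; exact: h.
Qed.

Lemma likelihood_gt0 T : {ae P, forall o, 0 < likelihood T o}.
Proof.
have := ae_forall (fun t : 'I_T => kernel_gt0 t).
by apply: filterS => o h; apply: prodr_gt0 => t _; exact: h.
Qed.

Lemma output_prob_gt0 T : {ae P, forall o, 0 < output_prob (history q' T o)}.
Proof.
have pos b : {ae P, forall o, history q' T o = b -> 0 < output_prob b}.
  have [b0|bn0] := eqVneq (output_prob b) 0; last first.
    by apply: aeW => o _; rewrite lt0r bn0; exact: pmf_ge0.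
  have mb := @measurable_history_q' T b.
  have Pb : P (history q' T @^-1` [set b]) = 0%E.
    have Pfin : P (history q' T @^-1` [set b]) \is a fin_num by exact: fin_num_measure.
    by rewrite -(fineK Pfin) -[fine _]/(output_prob b) b0.
  by apply: filterS (ae_notin mb Pb) => o h hb; case: h.
by apply: filterS (ae_forall pos) => o /(_ _ erefl).
Qed.

Lemma sum_output_prob T : \sum_(b : T.-tuple M') output_prob b = 1.
Proof.
have := Rintegral_finite_comp P (@measurable_history_q' T) (fun=> 1).
under [in X in _ = X -> _]eq_bigr do rewrite mulr1.
by move=> <-; rewrite /Rintegral (integral_cst P measurableT 1%E) mul1e [X in fine X]probability_setT.
Qed.

Lemma ratio_gt0 T : (forall t, (t < T)%N -> rate t != -oo%E) ->
  {ae P, forall o, [/\ 0 < growth T o, 0 < p0 (x 0%N o), 0 < likelihood T o & 0 < ratio T o]}.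
Proof.
move=> rate_fin.
have jac0 (t : 'I_T) : {ae P, forall o, absjac f (x t o) (w t o) != 0}.
  by have [] := rate_neqNy (rate_fin t (ltn_ord t)).
have := ae_forall jac0.
apply: filterS3 (density_gt0 p0_density) (likelihood_gt0 T) => o p0o lo jo.
have go : 0 < growth T o.
  by apply: prodr_gt0 => t _; rewrite lt0r jo absjac_ge0.
by split => //; rewrite mulr_gt0// invr_gt0 mulr_gt0.
Qed.

(** If [x T] charged a Lebesgue-null set [Z], the integral of its indicator
    against the positive function [ratio T] would be positive, while
    [integral_ratio_le] bounds it by [lambda Z]. *)
Lemma exists_density T : (forall t, (t < T)%N -> rate t != -oo%E) ->
  exists p, is_density (x T) p.
Proof.
move=> rate_fin; apply: dominated_density; apply/null_content_dominatesP => Z mZ Z0.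
have mXZ : measurable (x T @^-1` Z).
  by rewrite -[X in measurable X]setTI; exact: measurable_funPT.
apply: (measure0_ae mXZ).
have null b : {ae P, forall o,
    \1_Z (x T o) * (\1_(history q' T @^-1` [set b]) o * ratio T o) = 0}.
  have nonneg o : 0 <= \1_Z (x T o) * (\1_(history q' T @^-1` [set b]) o * ratio T o).
    by rewrite !indicE; do 2! (apply: mulr_ge0; first by []); exact: ratio_ge0.
  apply: integral0_measure0.
  - apply: measurable_funM.
      exact: (measurableT_comp (measurable_indic mZ) (measurable_x T)).
    apply: measurable_funM; last exact: measurable_past (@measurable_past_ratio T).
    by apply: measurable_indic; exact: measurable_history_q'.
  - exact: nonneg.
  - apply/eqP; rewrite eq_le; apply/andP; split; last first.
      by apply: integral_ge0 => o _; rewrite lee_fin; exact: nonneg.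
    apply: (@le_trans _ _ (\int[lebesgue_rV R N]_y (\1_Z y)%:E)%E); last first.
      by rewrite (integral_indic (lebesgue_rV R N) measurableT mZ) setIT Z0.
    under eq_integral do rewrite EFinM.
    apply: (@integral_ratio_le T b (fun y => (\1_Z y)%:E)).
    + by apply/measurable_EFinP; exact: measurable_indic.
    + by move=> y; rewrite lee_fin indicE.
apply: filterS2 (ae_forall null) (ratio_gt0 rate_fin) => o h [_ _ _ ro] Zo.
have := h (history q' T o); rewrite !indicE mem_set// mem_set// !mul1r => r0.
by rewrite r0 ltxx in ro.
Qed.

(** Average [integral_ratio_le] over the output strings, with their
    probabilities as weights. *)
Lemma integral_change_of_measure_le1 T g : is_density (x T) g ->
  (\int[P]_o (g (x T o) * ratio T o * output_prob (history q' T o))%:E <= 1)%E.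
Proof.
move=> gT; have [mg g0 _] := gT.
pose F b o : \bar R := ((g (x T o))%:E *
  (\1_(history q' T @^-1` [set b]) o * ratio T o)%:E)%E.
have F0 b o : (0 <= F b o)%E by rewrite mule_ge0// lee_fin// mulr_ge0// ratio_ge0.
have mF b : measurable_fun setT (F b).
  apply: emeasurable_funM; apply/measurable_EFinP.
    exact: (measurableT_comp mg (measurable_x T)).
  apply: measurable_funM; last exact: measurable_past (@measurable_past_ratio T).
  by apply: measurable_indic; exact: measurable_history_q'.
have op0 (b : T.-tuple M') : 0 <= output_prob b by exact: pmf_ge0.
have -> : (\int[P]_o (g (x T o) * ratio T o * output_prob (history q' T o))%:E =
    \int[P]_o \sum_(b : T.-tuple M') ((output_prob b)%:E * F b o))%E.
  apply: eq_integral => o _; rewrite (bigD1 (history q' T o))//= big1 ?adde0.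
    by rewrite /F indicE mem_set// mul1r -!EFinM mulrC.
  move=> b bh; rewrite /F indicE memNset ?mul0r ?mule0//=.
  by move=> hb; rewrite hb eqxx in bh.
rewrite ge0_integral_sum//; last 2 first.
- by move=> b; apply: emeasurable_funM => //; exact: measurable_cst.
- by move=> b o _; rewrite mule_ge0// lee_fin.
rewrite -(sum_output_prob T) -sumEFin; apply: lee_sum => b _.
rewrite ge0_integralZl//; last by rewrite lee_fin.
rewrite -[leRHS]mule1 -(integral_density1 gT); apply: lee_wpmul2l; first by rewrite lee_fin.
apply: (@integral_ratio_le T b (fun y => (g y)%:E)); first exact/measurable_EFinP.
by move=> y; rewrite lee_fin.
Qed.

Lemma measurable_output_prob T :
  measurable_fun setT (fun o => output_prob (history q' T o)).
Proof.
apply: (@measurable_finite_comp _ _ _ (history q' T) _ _ (@output_prob T)).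
exact: measurable_history_q'.
Qed.

Lemma log2_change_of_measure T g : is_density (x T) g ->
  (forall t, (t < T)%N -> rate t != -oo%E) ->
  {ae P, forall o, 0 < g (x T o) * ratio T o * output_prob (history q' T o) /\
    log2 (g (x T o)) + log_growth T o =
    log2 (g (x T o) * ratio T o * output_prob (history q' T o)) +
    (log2 (p0 (x 0%N o)) + info_density T o)}.
Proof.
move=> gT rate_fin.
apply: filterS3 (density_gt0 gT) (ratio_gt0 rate_fin) (output_prob_gt0 T).
move=> o g0 [S0 p00 l0 r0] op0; have gr0 := mulr_gt0 g0 r0; split; first exact: mulr_gt0.
rewrite (log2M gr0 op0) (log2M g0 r0) /ratio log2M ?invr_gt0 ?mulr_gt0//.
rewrite log2V ?mulr_gt0// log2M//.
have -> : log2 (growth T o) = log_growth T o.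
  by rewrite /growth log2_prod// => i; exact: absjac_ge0.
have -> : log2 (likelihood T o) = \sum_(t < T) log2 (kernel t (q' t o) o).
  by rewrite /likelihood log2_prod// => i; exact: kernel_ge0.
by rewrite /info_density /output_logprob; ring.
Qed.

(** The Gibbs inequality for [Z], term by term.  In [a + S <= c + b] below, [c] and
    [b] are integrable; the upper bound on the entropy of [x T.+1] controls the
    negative part of [a], hence the positive part of [S]; so [S] is integrable, and
    then so is [a]. *)
Lemma sum_rate_le T : density_entropy p0 \is a fin_num ->
  (forall t, (t < T.+1)%N -> rate t != -oo%E) ->
  (diff_entropy (x T.+1) < +oo)%E ->
  (\sum_(t < T.+1) rate t <=
   diff_entropy (x T.+1) - density_entropy p0 + (directed_info P q q' T.+1)%:E)%E.
Proof.
move=> h0fin rate_fin.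
have [g gT ->] := diff_entropy_density (exists_density rate_fin).
have [mg g0 _] := gT.
move=> hTfin; have negfin := density_entropy_lty gT hTfin.
set S := log_growth T.+1; set a := fun o => log2 (g (x T.+1 o)).
set c0 := fun o => log2 (p0 (x 0%N o)).
pose c o := c0 o + info_density T.+1 o.
pose Z o := g (x T.+1 o) * ratio T.+1 o * output_prob (history q' T.+1 o).
pose b o := (ln 2)^-1 * (Z o - 1).
have ma : measurable_fun setT a by exact: measurable_log2_density gT.
have mS : measurable_fun setT S.
  exact: measurable_past (@measurable_past_log_growth T.+1).
have mc0 : measurable_fun setT c0 by exact: measurable_log2_density p0_density.
have ic0 : P.-integrable setT (EFin \o c0).
  apply/integrableP; split; first exact/measurable_EFinP.
  have := integral_fin_num_abs P measurableT mc0; rewrite /comp => ->.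
  by rewrite -fin_numN -density_entropyE.
have iadd (h h' : Omega -> R) : P.-integrable setT (EFin \o h) ->
    P.-integrable setT (EFin \o h') -> P.-integrable setT (EFin \o (fun o => h o + h' o)).
  by move=> ih ih'; exact: (integrableD measurableT ih ih').
have iD := integrable_info_density T.+1.
have ic : P.-integrable setT (EFin \o c).
  exact: iadd.
have mZ : measurable_fun setT Z.
  apply: measurable_funM; last exact: measurable_output_prob.
  apply: measurable_funM; last exact: measurable_past (@measurable_past_ratio T.+1).
  exact: (measurableT_comp mg (measurable_x T.+1)).
have Z0 o : 0 <= Z o.
  by rewrite /Z; apply: mulr_ge0; [apply: mulr_ge0 => //; exact: ratio_ge0|exact: pmf_ge0].
have [ib b_le0] := integral_log_bound mZ Z0 (integral_change_of_measure_le1 gT).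
have icb : P.-integrable setT (EFin \o (fun o => c o + b o)).
  exact: iadd.
(* This is log2 Z <= b, rearranged. *)
have key : {ae P, forall o, a o + S o <= c o + b o}.
  apply: filterS (log2_change_of_measure gT rate_fin) => o [Zo].
  rewrite -/(Z o) -/(a o) -/(S o) -/(c o) => ->; rewrite addrC lerD2l.
  exact: log2_le_sub1.
have mcb : measurable_fun setT (fun o => `|(c o + b o)%:E|%E).
  by apply: measurableT_comp => //; exact: measurable_int icb.
have cb_lty : (\int[P]_o `|(c o + b o)%:E| < +oo)%E by case/integrableP: icb.
have S_lty : (\int[P]_o (Num.max 0 (S o))%:E < +oo)%E.
  apply: (@integral_pos_lty _ _ _ P S
    (fun o => `|(c o + b o)%:E| + (Num.max 0 (- a o))%:E)%E) => //.
  - apply: emeasurable_funD => //; apply/measurable_EFinP.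
    by apply: measurable_maxr => //; exact: measurableT_comp.
  - by move=> o; rewrite adde_ge0// lee_fin le_max lexx.
  - apply: filterS key => o keyo; rewrite -EFinD lee_fin.
    have := ler_norm (c o + b o).
    by case: (leP 0 (- a o)) => ?; lra.
  - have mna : measurable_fun setT (fun o => (Num.max 0 (- a o))%:E).
      by apply/measurable_EFinP; apply: measurable_maxr => //; exact: measurableT_comp.
    rewrite (ge0_integralD P measurableT (fun o _ => abse_ge0 _) mcb
      (fun o _ => max0_ge0 _) mna).
    exact: lte_add_pinfty.
have [iS SE] := integral_log_growth
  (fun t tT => let: And3 _ h _ := rate_neqNy (rate_fin t tT) in h) S_lty.
have ia : P.-integrable setT (EFin \o a).
  apply: integrable_posneg => //.
  apply: (@integral_pos_lty _ _ _ P a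
    (fun o => `|(c o + b o)%:E| + `|(S o)%:E|)%E) => //.
  - apply: emeasurable_funD => //; apply: measurableT_comp => //.
    exact: measurable_int iS.
  - by move=> o; rewrite adde_ge0.
  - apply: filterS key => o keyo; rewrite -EFinD lee_fin.
    have := ler_norm (c o + b o); have := ler_norm (- S o); rewrite normrN; lra.
  - have mabsS : measurable_fun setT (fun o => `|(S o)%:E|%E).
      by apply: measurableT_comp => //; exact: measurable_int iS.
    rewrite (ge0_integralD P measurableT (fun o _ => abse_ge0 _) mcb
      (fun o _ => abse_ge0 _) mabsS).
    by apply: lte_add_pinfty => //; case/integrableP: iS.
have iaS : P.-integrable setT (EFin \o (fun o => a o + S o)).
  exact: iadd.
have := ae_le_integral iaS icb key.
have ED (h h' : Omega -> R) : P.-integrable setT (EFin \o h) ->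
    P.-integrable setT (EFin \o h') ->
    (\int[P]_o (h o + h' o)%:E = \int[P]_o (h o)%:E + \int[P]_o (h' o)%:E)%E.
  by move=> ih ih'; exact: (integralD measurableT ih ih').
rewrite (ED _ _ ia iS) (ED _ _ ic ib) (ED _ _ ic0 iD) SE.
have -> : (\sum_(t < T.+1) \int[P]_o mean_logjac (x t o) = \sum_(t < T.+1) rate t)%E.
  by apply: eq_bigr => t _; have [] := rate_neqNy (rate_fin t (ltn_ord t)).
have DE : (\int[P]_o (info_density T.+1 o)%:E = (directed_info P q q' T.+1)%:E)%E.
  rewrite directed_infoE /Rintegral fineK//; exact: integrable_fin_num iD.
rewrite DE (density_entropyE gT) (density_entropyE p0_density) -/a -/c0.
have /fineK <- := integrable_fin_num measurableT ia.
have /fineK <- := integrable_fin_num measurableT ic0.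
move: b_le0; have /fineK <- := integrable_fin_num measurableT ib.
have : (\sum_(t < T.+1) rate t)%E \is a fin_num.
  rewrite [X in X \is a fin_num](_ : _ = (\int[P]_o (S o)%:E)%E).
    exact: integrable_fin_num iS.
  rewrite SE; apply: eq_bigr => t _.
  by have [] := rate_neqNy (rate_fin t (ltn_ord t)).
move=> /fineK <-; rewrite -!EFinN -!EFinD !lee_fin.
lra.
Qed.

End unfolding.
End filtration.

Theorem theorem2p2 (d : measure_display) (Omega : measurableType d)
  (R : realType) (P : probability Omega R) (N s : nat) (M M' : finType)
  (f : 'rV[R]_N -> 'rV[R]_N -> 'rV[R]_N) (B : 'M[R]_(N, s))
  (nu : probability 'rV[R]_N R)
  (K : channel R M M') (gamma : policy R N s M M')
  (x w : nat -> {RV P >-> 'rV[R]_N}) (u : nat -> Omega -> 'rV[R]_s)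
  (q : nat -> Omega -> M) (q' : nat -> Omega -> M')
  (f_borel : measurable_fun [set: 'rV[R]_N * 'rV[R]_N] (fun z => f z.1 z.2))
  (f_C1 : C1_in_state f)
  (f_invertible : forall v : 'rV[R]_N, bijective (f ^~ v))
  (noise : iid_noise (x 0%N) w nu)
  (loop : closed_loop f B K gamma x w u q q')
  (x0_entropy : diff_entropy (x 0%N) \is a fin_num)
  (entropy_growth :
    (limn_esup (fun t : nat => t%:R^-1%:E * diff_entropy (x t)) <= 0)%E) :
  (limn_esup (fun T : nat => (T%:R^-1 * directed_info P q q' T)%:E) >=
   limn_esup (fun T : nat => T%:R^-1%:E *
     \sum_(t < T) \int[distribution P (x t)]_y
        \int[nu]_v log2e (`|\det ('J (f ^~ v) y)|%:E)))%E.
Proof.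
have [p0 p0_density h0E] : exists2 p0, is_density (x 0%N) p0 &
    diff_entropy (x 0%N) = density_entropy p0.
  apply: diff_entropy_density; apply: diff_entropy_neqNy.
  by move: x0_entropy; rewrite fin_numE => /andP[].
rewrite h0E in x0_entropy.
apply: limn_esup_le => e e0.
have Tinv (T : nat) : (0 < T)%N -> 0 < T%:R^-1 :> R by move=> T0; rewrite invr_gt0 ltr0n.
have [rate_fin|] := pselect (forall t, rate f nu x t != -oo%E); last first.
  move=> /existsNP[t0 /negP]; rewrite negbK => /eqP rateNy.
  (* One rate equal to -oo makes all later averages -oo. *)
  near=> T.
  have T0 : (t0 < T)%N by near: T; exists t0.+1.
  rewrite [X in (_ * X)%E](_ : _ = -oo%E).
    by rewrite gt0_muleNy ?leNye// lte_fin Tinv// (leq_trans _ T0).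
  by apply/esum_eqNyP; exists (Ordinal T0); rewrite mem_index_enum.
set h0 : R := fine (density_entropy p0).
have e20 : (0 < (e / 2)%:E)%E by rewrite lte_fin divr_gt0.
have hT := near_lt_limn_esup (le_lt_trans entropy_growth e20).
near=> T.
have T0 : (0 < T)%N by near: T; exists 1%N.
(* Half of the slack absorbs h(x T) / T, the other half - h(x 0) / T. *)
have Tbig : 2 * `|h0| / e <= T%:R by near: T; exact: nbhs_infty_ger.
have T0' : 0 < T%:R :> R by rewrite ltr0n.
have hTe : (diff_entropy (x T) <= T%:R%:E * (e / 2)%:E)%E.
  by rewrite -lee_pdivrMl//; apply: ltW; near: T.
rewrite lee_pdivrMl//.
have hTy : (diff_entropy (x T) < +oo)%E by apply: le_lt_trans hTe _; exact: ltry.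
have /(_ T.-1) := sum_rate_le f_borel noise loop f_C1 f_invertible p0_density
  x0_entropy (fun t _ => rate_fin t).
rewrite prednK// => /(_ hTy) /le_trans; apply.
apply: (@le_trans _ _ (T%:R%:E * (e / 2)%:E - density_entropy p0 + (directed_info P q q' T)%:E)%E).
  by rewrite !leeD2r.
rewrite -(fineK x0_entropy) -/h0 -EFinM -EFinN -!EFinD -EFinM lee_fin.
rewrite mulrDr mulVKf ?gt_eqF//.
move: Tbig; rewrite ler_pdivrMr// => Tbig.
have := ler_norm (- h0); rewrite normrN => h0le.
lra.
Unshelve. all: by end_near.
Qed.
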